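(* Let $\mathcal C\subset\mathbb V^{d+1}$ be a proper open convex cone and let $K\subset\mathbb A^{d+1}$ be a $\mathcal C$-convex domain. Then there exists a unique family of Radon measures $S_0(K),\dots,S_d(K)$ on $\mathbb P(\mathcal C^* )$ such that for all $\varepsilon>0$ and every Borel set $b\subseteq\mathbb P(\mathcal C^* )$, $$V_\varepsilon(K)(b)=\mathrm{vol}\bigl(\mathcal N_\varepsilon(K)(b)\bigr)=\frac1{d+1}\sum_{i=0}^{d}\varepsilon^{d+1-i}\binom{d+1}{i}S_i(K)(b).$$ Moreover, one always has $S_0(K)=\mathrm{vol}_{\Sigma_{\mathcal C}^*}$, the canonical volume of the polar affine sphere $\Sigma_{\mathcal C}^*$, radially identified with $\mathbb P(\mathcal C^* )$.
   Context: Setting: $d\ge2$; $\mathbb V^{d+1}$ is an oriented $(d+1)$-dimensional real vector space with a linear volume form; $\mathbb A^{d+1}$ is the real affine space with translation space $\mathbb V^{d+1}$, with the induced volume measure $\mathrm{vol}$. A convex cone is proper if it is non-empty and its closure contains no entire line. For a proper open convex cone $\mathcal C$, put $\mathcal C^*=\mathrm{int}\{\varphi\in(\mathbb V^{d+1})^*:\varphi(v)\le0\ \forall v\in\mathcal C\}$. A point $[\varphi]\in\mathbb P(\mathcal C^* )$ is identified with the linear hyperplane $\ker\varphi$, regarded as a direction of affine hyperplanes. A convex domain is a non-empty open convex set; a supporting hyperplane of it is an affine hyperplane $H$ with $H\cap K=\emptyset$, $H\cap\partial K\ne\emptyset$. A $\mathcal C$-convex domain is a convex domain $K\subset\mathbb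 A^{d+1}$ with $K+\mathcal C=K$ whose set of directions of supporting hyperplanes contains $\mathbb P(\mathcal C^* )$ and is contained in $\overline{\mathbb P(\mathcal C^* )}$ (equivalently, the recession cone of $K$ is $\overline{\mathcal C}$). Coordinates and affine sphere: fix an origin and a positively oriented unit-volume basis so that $\mathbb A^{d+1}\simeq\mathbb V^{d+1}\simeq\mathbb R^{d+1}$ and $\mathcal C=\{t(x,1):x\in\Omega,t>0\}$ with $\Omega\subset\mathbb R^d$ bounded open convex containing $0$. Identifying the dual with $\mathbb R^{d+1}$ by the dot product, $\mathcal C^*=\{t(y,-1):y\in\Omega^*,t>0\}$ with $\Omega^*=\{y\in\mathbb R^d:x\cdot y<1\ \forall x\in\overline\Omega\}$, and $\mathbb P(\mathcal C^* )\simeq\Omega^*$. Let $\omega_{\mathcal C}:\Omega^*\to(-\infty,0)$ be the unique smooth convex function with $\det\mathrm{Hess}\,\omega=(-\omega)^{-d-2}$ in $\Omega^*$ and $\omega|_{\partial\Omega^*}=0$. The map $N_{\Sigma_{\mathcal C}}(y)=(\nabla\omega_{\mathcal C}(y),\nabla\omega_{\mathcal C}(y)\cdot y-\omega_{\mathcal C}(y))$ parametrises the Cheng--Yau affine sphere $\Sigma_{\mathcal C}\subset\mathbb V^{d+1}$ (independent of the choices); $N_{\Sigma_{\mathcal C}}[\varphi]$ is the unique vector of $\Sigma_{\mathcal C}$ at which the tangent hyperplane of $\Sigma_{\mathcal C}$ has direction $[\varphi]$. The polar affine sphere is $\Sigma_{\mathcal C}^*=\{-\omega_{\mathcal C}(y)^{-1}(y,-1):y\in\Omega^*\}$,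 and its canonical volume, transported radially to $\mathbb P(\mathcal C^* )\simeq\Omega^*$, is $(-\omega_{\mathcal C})^{-d-1}\mathcal L$, $\mathcal L$ being Lebesgue measure. Parallel neighbourhoods: for a $\mathcal C$-convex domain $K$, $\varepsilon>0$ and a Borel set $b\subseteq\mathbb P(\mathcal C^* )$, $\mathcal N_\varepsilon(K)(b)$ is the set of points $P+tN_{\Sigma_{\mathcal C}}[\varphi]$ with $[\varphi]\in b$, $t\in(0,\varepsilon)$, and $P\in\partial K$ a point at which $K$ has a supporting hyperplane of direction $[\varphi]$. $V_\varepsilon(K)(b)=\mathrm{vol}(\mathcal N_\varepsilon(K)(b))$. A Radon measure is a (non-negative) Borel measure finite on compact sets. *)

(* Defs.v *)
From HB Require Import structures.
From mathcomp Require Import all_boot all_order all_algebra.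
From mathcomp Require Import all_classical all_reals all_analysis.

Set Implicit Arguments.
Unset Strict Implicit.
Unset Printing Implicit Defensive.
Import Order.TTheory GRing.Theory Num.Theory.
Import numFieldNormedType.Exports.
Local Open Scope classical_set_scope.
Local Open Scope ring_scope.

Section LebesgueRn.
Context {R : realType} (n : nat).
Implicit Types (a b : 'rV[R]_n) (c : 'rV[R]_n * 'rV[R]_n).

Definition box c : set 'rV[R]_n :=
  [set x | forall i, c.1 0 i < x 0 i <= c.2 0 i].

(* The factor (0 < n) only matters in dimension 0, where it makes the volume
   vanish so that lebn below is an outer measure for every n. *)
Definition box_vol c : \bar R :=
  ((\prod_(i < n) Num.max 0 (c.2 0 i - c.1 0 i)) *+ (0 < n)%N)%:E.

Definition box_cover (X : set 'rV[R]_n) : set (nat -> 'rV[R]_n * 'rV[R]_n) :=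
  [set F | X `<=` \bigcup_k box (F k)].

(* Lebesgue outer measure on R^n. *)
Definition lebn (X : set 'rV[R]_n) : \bar R :=
  ereal_inf [set (\sum_(k <oo) box_vol (F k))%E | F in box_cover X].

Local Open Scope ereal_scope.

Lemma box_vol_ge0 c : 0 <= box_vol c.
Proof.
rewrite lee_fin mulrn_wge0// prodr_ge0// => i _.
by rewrite le_max lexx.
Qed.

Lemma lebn_ge0 X : 0 <= lebn X.
Proof.
apply: le_ereal_inf_tmp => _ [F _ <-]; apply: nneseries_ge0 => k _ _.
exact: box_vol_ge0.
Qed.

Lemma le_lebn : {homo lebn : X Y / X `<=` Y >-> X <= Y}.
Proof.
move=> X Y XY; apply/ereal_inf_le_tmp => _ [F YF <-].
by exists F => //; exact: subset_trans XY YF.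
Qed.

Lemma lebn0 : lebn set0 = 0.
Proof.
apply/eqP; rewrite eq_le lebn_ge0 andbT; apply: ereal_inf_lbound.
exists (fun=> (0%R, 0%R)) => //; apply: eseries0 => k _ _.
rewrite /box_vol /= (_ : (_ *+ _)%R = 0%R) //.
case: (posnP n) => [_|n0]; first exact: mulr0n.
by rewrite (bigD1 (Ordinal n0))//= subrr maxxx mul0r mul0rn.
Qed.

Lemma lebn_sigma_subadditive : sigma_subadditive lebn.
Proof.
move=> A; have [[i ioo]|] := pselect (exists i, lebn (A i) = +oo).
  rewrite (eseries_pinfty _ _ ioo) ?leey// => k _.
  by rewrite -ltNye (lt_le_trans _ (lebn_ge0 _)).
rewrite -forallNE => Aoo.
suff add2e (e : {posnum R}) :
    lebn (\bigcup_k A k) <= \sum_(i <oo) lebn (A i) + e%:num%:E.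
  by apply/lee_addgt0Pr => _/posnumP[].
rewrite (le_trans _ (epsilon_trick _ _ _))//; last first.
  by move=> k; exact: lebn_ge0.
pose P k F := box_cover (A k) F /\
  \sum_(j <oo) box_vol (F j) <= lebn (A k) + (e%:num / (2 ^ k.+1)%:R)%:E.
have [G PG] : {G & forall k, P k (G k)}.
  apply: (@choice _ _ P) => k; rewrite /P /lebn.
  set S := (X in ereal_inf X); move infS : (ereal_inf S) => iS.
  case: iS infS => [r Sr|Soo|Soo].
  - have en1 : (0 < e%:num / (2 ^ k.+1)%:R)%R by [].
    have /(lb_ereal_inf_adherent en1) : ereal_inf S \is a fin_num by rewrite Sr.
    by move=> [x [F AF <-] xS]; exists F; split => //; rewrite -Sr; exact/ltW.
  - by have := Aoo k; rewrite /lebn Soo.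
  - suff : lbound S 0 by move/le_ereal_inf_tmp; rewrite Soo.
    move=> /= _ [F AF <-]; apply: nneseries_ge0 => j _ _; exact: box_vol_ge0.
pose v (ij : nat * nat) := box_vol (G ij.1 ij.2).
have v_ge0 x : 0 <= v x by exact: box_vol_ge0.
apply: (@le_trans _ _ (\esum_(i in setT) v i)).
  apply: ereal_inf_lbound => /=.
  have /card_esym/ppcard_eqP[f] := card_nat2.
  exists (fun k => G (f k).1 (f k).2).
    move=> t [i _ /(PG i).1[j _ Bijt]]; exists (f^-1%FUN (i, j)) => //=.
    by rewrite invK ?inE.
  transitivity (\sum_(k <oo) (v \o f) k); first by [].
  by rewrite -(esum_pred_image v f xpredT) ?[fun=> _]set_true ?image_eq.
rewrite (_ : esum _ _ = \sum_(i <oo) \sum_(j <oo ) v (i, j)); last first.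
  pose J : nat -> set (nat * nat) := fun i => [set (i, j) | j in setT].
  rewrite (_ : setT = \bigcup_k J k); last first.
    by rewrite predeqE => -[a b]; split => // _; exists a => //; exists b.
  rewrite esum_bigcupT /=; last 2 first.
    - apply/trivIsetP => i j _ _ ij.
      rewrite predeqE => -[p m] /=; split => //= -[] [_] _ [<-{p} _].
      by move=> [m' _] [] /esym/eqP; rewrite (negbTE ij).
    - by move=> pm; exact: v_ge0.
  rewrite -(image_id [set: nat]) -fun_true esum_pred_image//; last first.
    by move=> k _; apply: esum_ge0 => *; exact: v_ge0.
  apply: eq_eseriesr => /= j _.
  rewrite -(esum_pred_image v (pair j) predT)//=; last first.
    by move=> ? ? _ _; exact: (@can_inj _ _ _ snd).
  by congr esum; rewrite predeqE => -[a b]; split; move=> [i _ <-]; exists i.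
apply: lee_lim.
- by apply: is_cvg_nneseries => *; apply: nneseries_ge0 => *; exact: v_ge0.
- by apply: is_cvg_nneseries => *; apply: adde_ge0 => //; exact: lebn_ge0.
- by near=> k; apply: lee_sum => i _; exact: (PG i).2.
Unshelve. all: by end_near. Qed.

HB.instance Definition _ := isOuterMeasure.Build R 'rV[R]_n lebn
  lebn0 lebn_ge0 le_lebn lebn_sigma_subadditive.

Definition leb_outer : {outer_measure set 'rV[R]_n -> \bar R} := lebn.

(* Lebesgue measure on the (Caratheodory) Lebesgue-measurable sets. *)
Definition lebesgueRn : {measure set (caratheodory_type leb_outer) -> \bar R} :=
  (leb_outer : set (caratheodory_type leb_outer) -> \bar R).

End LebesgueRn.

Arguments lebn {R} n X.
Arguments leb_outer {R} n.
Arguments lebesgueRn {R} n.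

Section Calculus.
Context {R : realType} {d : nat}.
Implicit Types (f : 'rV[R]_d -> R) (x y : 'rV[R]_d) (U : set 'rV[R]_d).

Definition dotrv x y : R := \sum_i x 0 i * y 0 i.

Definition partials (s : seq 'I_d) f : 'rV[R]_d -> R :=
  foldr (fun i g => fun x => 'D_(delta_mx 0 i) g x) f s.

Definition smooth_on U f :=
  forall s x, U x -> {for x, continuous (partials s f)} /\
    forall i, derivable (partials s f) x (delta_mx 0 i).

Definition grad f y : 'rV[R]_d := \row_i partials [:: i] f y.

Definition hess f y : 'M[R]_d := \matrix_(i, j) partials [:: i; j] f y.

(* Omega^*, the domain of the dual cone in the chart y |-> [(y, -1)]. *)
Definition dual_domain (Om : set 'rV[R]_d) : set 'rV[R]_d :=
  [set y | forall x, closure Om x -> dotrv x y < 1].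

(* om is the (unique, by Cheng and Yau) solution of the Monge-Ampere problem
   on U; its values outside the closure of U are irrelevant. *)
Definition cheng_yau U (om : 'rV[R]_d -> R) :=
  [/\ smooth_on U om,
      convex_function U om,
      forall y, U y -> om y < 0,
      forall y, U y -> \det (hess om y) = (- om y) ^- d.+2 &
      {within closure U, continuous om} /\
        forall y, closure U y -> ~ U y -> om y = 0].

Definition borelRn := g_sigma_algebraType (@open 'rV[R]_d).

(* A Radon measure on the open subset U of R^d, extended by zero to the Borel
   sets of R^d; it need not be finite near the boundary of U. *)
Definition radon_on U (mu : {measure set borelRn -> \bar R}) :=
  mu (~` U) = 0%E /\ forall k, compact k -> k `<=` U -> (mu k < +oo)%E.

(* The canonical volume of the polar affine sphere, in the chart of
   dual_domain: (- om)^(-d-1) times Lebesgue measure. *)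
Definition polar_sphere_volume (om : 'rV[R]_d -> R) (b : set 'rV[R]_d) : \bar R :=
  (\int[lebesgueRn d]_(y in b) ((- om y) ^- d.+1)%:E)%E.

(* (x, t) as a vector of R^(d+1), with t as last coordinate. *)
Definition snoc x (t : R) : 'rV[R]_d.+1 :=
  \row_(i < d.+1) if unlift ord_max i is Some j then x 0 j else t.

End Calculus.

Arguments borelRn : clear implicits.

Section VectorSpace.
Context {R : realType} {V : vectType R}.
Implicit Types (U C : set V).

(* The topology of a finite-dimensional real vector space is the one
   transported from R^n by the coordinates in some (equivalently, any) basis. *)
Definition chart0 : 'rV[R]_(\dim {:V}) -> V :=
  fun x => \sum_i x 0 i *: (vbasis {:V})`_i.
Definition vopen U := open (chart0 @^-1` U).
Definition vclosure U : set V := chart0 @` closure (chart0 @^-1` U).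
Definition vinterior U : set V := chart0 @` (chart0 @^-1` U)°.

Definition proper_open_convex_cone C :=
  [/\ vopen C,
      convex_set C,
      forall t v, 0 < t -> C v -> C (t *: v),
      C !=set0 &
      ~ exists p v, v != 0 /\ forall s : R, vclosure C (p + s *: v)].

Definition volume_form n (w : ('I_n -> V) -> R) :=
  let upd e i u := fun k => if k == i then u else e k in
  [/\ forall e i (a : R) u v,
        w (upd e i (a *: u + v)) = a * w (upd e i u) + w (upd e i v),
      forall e i j, i != j -> e i = e j -> w e = 0 &
      exists e, w e != 0].

End VectorSpace.

(* atrans p v is p + v, and avec p q is q - p. *)
Record affineSpace (R : realType) (V : vectType R) := AffineSpace {
  apoint :> Type;
  atrans : apoint -> V -> apoint;
  avec : apoint -> apoint -> V;
  atransD : forall p u v, atrans (atrans p u) v = atrans p (u + v);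
  atransK : forall p v, avec p (atrans p v) = v;
  avecK : forall p q, atrans p (avec p q) = q }.

Section Domains.
Context {R : realType} {V : vectType R} {A : affineSpace V}.
Implicit Types (K H : set A) (C : set V) (phi : 'Hom(V, R^o)).

Definition vec_from (p : A) K : set V := [set v | K (atrans p v)].

Definition convex_domain K :=
  [/\ K !=set0, forall p, vopen (vec_from p K) &
      forall p, convex_set (vec_from p K)].

Definition aboundary K : set A :=
  [set p | vclosure (vec_from p K) 0 /\ ~ vinterior (vec_from p K) 0].

(* The affine hyperplane through q with direction ker phi. *)
Definition ahyperplane phi (q : A) : set A := [set p | phi (avec q p) = 0].

Definition supporting H K := H `&` K = set0 /\ H `&` aboundary K !=set0.

(* Subsets of P(V^* ) are represented by their preimages in V^* \ {0}. *)
Definition supporting_directions K : set 'Hom(V, R^o) :=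
  [set phi | phi != 0 /\ exists q, supporting (ahyperplane phi q) K].

Definition dual_cone C : set 'Hom(V, R^o) :=
  vinterior [set phi : 'Hom(V, R^o) | forall v, C v -> phi v <= 0].

Definition dual_directions C : set 'Hom(V, R^o) :=
  [set phi | phi != 0 /\ exists2 c : R, c != 0 & dual_cone C (c *: phi)].

(* As V^* \ {0} -> P(V^* ) is open, the preimage of the closure of P(C^* ) is
   the closure in V^* \ {0} of the preimage of P(C^* ). *)
Definition C_convex_domain C K :=
  [/\ convex_domain K,
      [set atrans q v | q in K & v in C] = K,
      dual_directions C `<=` supporting_directions K &
      supporting_directions K `<=` vclosure (dual_directions C)].

End Domains.

Section Frames.
Context {R : realType} {d : nat} {V : vectType R}.
Implicit Types (e : d.+1.-tuple V) (C : set V) (om : 'rV[R]_d -> R).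

Definition vecf e (x : 'rV[R]_d.+1) : V := \sum_i x 0 i *: tnth e i.

(* e is a positively oriented unit-volume basis (the orientation is the one
   in which the volume form w is positive) in which C is the cone over
   Om x {1}. *)
Definition adapted_basis (w : ('I_d.+1 -> V) -> R) C e (Om : set 'rV[R]_d) :=
  [/\ basis_of {:V} e, w (tnth e) = 1,
      [/\ open Om, convex_set Om, bounded_set Om & Om 0] &
      C = [set v | exists t x, [/\ 0 < t, Om x & v = t *: vecf e (snoc x 1)]]].

(* The linear form with coordinates (y, -1); y |-> [dual_form e y] identifies
   dual_domain Om with P(C^* ). *)
Definition dual_form e (y : 'rV[R]_d) : 'Hom(V, R^o) :=
  \sum_i snoc y (-1) 0 i *: linfun (coord e i : V -> R^o).

Definition sphere_normal e om (y : 'rV[R]_d) : V :=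
  vecf e (snoc (grad om y) (dotrv (grad om y) y - om y)).

Context {A : affineSpace V}.
Implicit Types (o : A) (K S : set A).

Definition frame_preimage o e S : set 'rV[R]_d.+1 :=
  [set x | S (atrans o (vecf e x))].

(* Volume in A; it does not depend on the origin o nor on the unit-volume
   basis e. *)
Definition avol o e S : \bar R := lebesgueRn d.+1 (frame_preimage o e S).

Definition avol_measurable o e S :=
  (leb_outer d.+1).-cara.-measurable (frame_preimage o e S).

Definition parallel_nbhd e om K (eps : R) (b : set 'rV[R]_d) : set A :=
  [set X | exists y t P, [/\ b y, 0 < t < eps, aboundary K P,
     exists2 q, supporting (ahyperplane (dual_form e y) q) K &
                ahyperplane (dual_form e y) q P &
     X = atrans P (t *: sphere_normal e om y)]].

Definition steiner_formula o e om (Om : set 'rV[R]_d) K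
    (S : 'I_d.+1 -> {measure set (borelRn R d) -> \bar R}) :=
  forall (eps : R) (b : set (borelRn R d)),
    0 < eps -> measurable b -> b `<=` dual_domain Om ->
    avol o e (parallel_nbhd e om K eps b) =
    ((d.+1%:R^-1)%:E *
       \sum_(i < d.+1) (eps ^+ (d.+1 - i) * 'C(d.+1, i)%:R)%:E * S i b)%E.

End Frames.

(* Main.v *)
Require Import Defs.
From HB Require Import structures.
From mathcomp Require Import all_boot all_order all_fingroup all_algebra.
From mathcomp Require Import all_classical all_reals all_analysis.
From mathcomp Require Import measurable_realfun ring lra complex.
Import Order.TTheory GRing.Theory Num.Theory.
Import numFieldNormedType.Exports.
Local Open Scope classical_set_scope.
Local Open Scope ring_scope.
Set Implicit Arguments.
Unset Strict Implicit.
Unset Printing Implicit Defensive.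

(* In the chart, write l_y(x, t) = y . x - t and let u(y) be the supremum of
   l_y over K, so that K is the set of the points X for which u(y) - l_y(X) is
   bounded away from 0 as y ranges over Omega^*. Since om is a strictly convex
   function vanishing on the boundary of Omega^*, every X in K determines a
   unique pair (y, s) with s > 0 such that u(z) - l_z(X) + s om(z) >= 0 for all
   z, with equality at y; it satisfies X = P + s N(y) for a boundary point P
   with supporting direction y. Hence N_eps(b) is the set of the X whose pair
   lies in b x (0, eps), and as the pair depends continuously on X it is Borel
   when b is.

   If u is smooth, (y, s) |-> X has Jacobian - om det (Hess u + s Hess om),
   a polynomial in s with nonnegative coefficients and leading coefficient
   (- om)^(-d-1); integrating in s gives the formula. In general u is
   approximated from below by soft maxima of finitely many of the affine
   functions y |-> l_y(X_i), with X_i dense in K; the pair (y, s) is stable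
   under this approximation. Polynomials of bounded degree converge
   coefficientwise as soon as they converge at enough points, so the volume
   over an open set b, squeezed between limits of volumes over slightly
   smaller sets and itself with a slightly larger eps, is again polynomial in
   eps. Outer regularity extends this to Borel sets; locally the coefficients
   are measures, which are then summed over a countable Borel partition of
   Omega^*. *)

(** * Lebesgue measure in coordinates *)

(** Volume is here [lebn], an outer measure given by box covers, so the change of variables rests on
    metric estimates. Strict differentiability, a two-point condition, suits them: followed by the
    inverse of its Jacobian matrix, the map is close to the identity on a small ball, hence
    injective there and Lipschitz in both directions with constants near 1. Both volume inequalities
    follow up to a factor near 1.

    In the limit the pairs (y, s) converge only pointwise, so volumes are merely semicontinuous: one
    inequality holds over open sets, the other only after enlarging b and eps. Nonnegativity of the
    Jacobian coefficients is what repairs this. The value of a polynomial at eps = 1 then bounds all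
    its coefficients, and a cluster point of the coefficient vectors suffices. The top coefficient
    is independent of u, by the Monge-Ampere equation, and so survives every limit.

    These arguments need finite volumes, which may fail over the whole dual domain. Hence the
    localisation to small balls, over which the sets swept out by K and by all its approximations
    are uniformly bounded. *)

Section RowVectorNorm.
Context {R : realType} {n : nat}.
Implicit Types x y : 'rV[R]_n.

Lemma rv_norm_leP x (c : R) : 0 <= c ->
  reflect (forall i, `|x 0 i| <= c) (`|x| <= c).
Proof.
move=> c0; apply: (iffP idP) => [xc i|xc].
  apply: le_trans xc; rewrite [leRHS]/Num.norm /= mx_normrE.
  by apply: (@le_bigmax _ _ _ _ (fun ij => `|x ij.1 ij.2|) (0, i)).
rewrite /Num.norm /= mx_normrE; apply/bigmax_leP; split=> // -[a i] _ /=.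
by rewrite ord1.
Qed.

Lemma rv_norm_ltP x (c : R) : 0 < c ->
  reflect (forall i, `|x 0 i| < c) (`|x| < c).
Proof.
move=> c0; apply: (iffP idP) => [xc i|xc].
  by apply: le_lt_trans xc; move: i; apply/rv_norm_leP.
rewrite /Num.norm /= mx_normrE; apply/bigmax_ltP; split=> // -[a i] _ /=.
by rewrite ord1.
Qed.

Lemma rv_coord_le x i : `|x 0 i| <= `|x|.
Proof. by move: i; apply/rv_norm_leP. Qed.

Lemma rv_ballP x (r : R) y : ball x r y <-> `|x - y| < r.
Proof. by rewrite -ball_normE. Qed.

Lemma open_ballP (U : set 'rV[R]_n) x : open U -> U x ->
  exists2 r : R, 0 < r & forall y, `|y - x| < r -> U y.
Proof.
move=> oU Ux; have /nbhs_ballP[r /= r0 rU] := open_nbhs_nbhs (conj oU Ux).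
by exists r => // y yx; apply: rU; apply/rv_ballP; rewrite distrC.
Qed.

Lemma ballP_open (U : set 'rV[R]_n) :
  (forall x, U x -> exists2 r : R, 0 < r & forall y, `|y - x| < r -> U y) ->
  open U.
Proof.
move=> h; rewrite openE => x /h[r r0 rU]; apply/nbhs_ballP; exists r => //.
by move=> y /rv_ballP; rewrite distrC; exact: rU.
Qed.

Lemma rv_continuous_at (V : normedModType R) (f : 'rV[R]_n -> V) x :
  (forall e : R, 0 < e -> exists2 r : R, 0 < r &
    forall y, `|y - x| < r -> `|f x - f y| < e) -> {for x, continuous f}.
Proof.
have F : Filter (nbhs x) := nbhs_filter x.
move=> h; apply: (proj2 (@cvgrPdist_lt _ _ _ (nbhs x) F f (f x))) => e /h[r r0 rf].
apply/nbhs_ballP; exists r => //.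
by move=> y /rv_ballP; rewrite distrC => /rf.
Qed.

Lemma continuous_at_rv (V : normedModType R) (f : 'rV[R]_n -> V) x :
  {for x, continuous f} -> forall e : R, 0 < e -> exists2 r : R, 0 < r &
    forall y, `|y - x| < r -> `|f x - f y| < e.
Proof.
have F : Filter (nbhs x) := nbhs_filter x.
move=> /(proj1 (@cvgrPdist_lt _ _ _ (nbhs x) F f (f x))) fx e /fx /nbhs_ballP[r /= r0 rf]; exists r => // y yx.
by apply: rf; apply/rv_ballP; rewrite distrC.
Qed.

End RowVectorNorm.

(** The side []p, q]] of a box cut at [a]: the two parts, empty ones counted as 0, are together no
    longer than the side. *)
Lemma max_split_le {R : realFieldType} (p q a : R) :
  Num.max 0 (Num.min q a - p) + Num.max 0 (q - Num.max p a) <= Num.max 0 (q - p).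
Proof.
have [qa|aq] := leP q a.
  rewrite (max_l (_ : q - Num.max p a <= 0)) ?addr0// subr_le0 le_max qa orbT//.
have [pa|ap] := leP p a; last by rewrite (max_l (_ : a - p <= 0)) ?add0r; lra.
by rewrite !max_r; lra.
Qed.

Section LebesgueBasics.
Context {R : realType} {n : nat}.
Implicit Types (X Y : set 'rV[R]_n) (c : 'rV[R]_n * 'rV[R]_n).
Local Open Scope ereal_scope.

Lemma lebn_le_cover X F : box_cover X F -> lebn n X <= \sum_(k <oo) box_vol (F k).
Proof. by move=> XF; apply: ereal_inf_lbound; exists F. Qed.

Lemma le_lebn_of_cover X (r : \bar R) :
  (forall F, box_cover X F -> r <= \sum_(k <oo) box_vol (F k)) -> r <= lebn n X.
Proof. by move=> h; apply: le_ereal_inf_tmp => _ [F XF <-]; exact: h. Qed.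

Lemma box_vol_gt0E (n0 : (0 < n)%N) c :
  box_vol c = (\prod_(i < n) Num.max 0 (c.2 0 i - c.1 0 i))%:E.
Proof. by rewrite /box_vol n0 mulr1n. Qed.

Lemma box_vol00 : box_vol ((0, 0)%R : 'rV[R]_n * 'rV[R]_n) = 0.
Proof.
rewrite /box_vol /=; case: (posnP n) => [_|n0]; first by rewrite mulr0n.
by rewrite (bigD1 (Ordinal n0))//= subrr maxxx mul0r mul0rn.
Qed.

Lemma lebn_box c : lebn n (box c) <= box_vol c.
Proof.
pose F k := if k is 0%N then c else (0, 0)%R : 'rV[R]_n * 'rV[R]_n.
apply: (le_trans (@lebn_le_cover _ F _)).
  by move=> x cx; exists 0%N.
rewrite nneseries_recl//; last by move=> k _; exact: box_vol_ge0.
rewrite /= eseries0 ?adde0// => -[|k]// _ _; exact: box_vol00.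
Qed.

(** Every box of a cover is cut along the hyperplane; only its [i]-th side changes, so the volumes
    of the two halves add up to at most that of the box. *)
Lemma halfspace_caratheodory i (a : R) :
  (leb_outer n).-caratheodory [set x : 'rV[R]_n | (x 0 i <= a)%R].
Proof.
apply: le_caratheodory_measurable => X /=; apply: le_lebn_of_cover => F XF.
pose F1 k : 'rV[R]_n * 'rV[R]_n :=
  ((F k).1, \row_j if j == i then Num.min ((F k).2 0 j) a else (F k).2 0 j)%R.
pose F2 k : 'rV[R]_n * 'rV[R]_n :=
  (\row_j (if j == i then Num.max ((F k).1 0 j) a else (F k).1 0 j), (F k).2)%R.
have X1 : box_cover (X `&` [set x : 'rV[R]_n | (x 0 i <= a)%R]) F1.
  move=> x [/XF[k _ xk] /= xa]; exists k => // j /=; rewrite mxE.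
  by case: eqP => [->|_]; rewrite ?lt_min ?le_min ?xa ?andbT; apply: xk.
have X2 : box_cover (X `&` ~` [set x : 'rV[R]_n | (x 0 i <= a)%R]) F2.
  move=> x [/XF[k _ xk] /= /negP]; rewrite -ltNge => xa.
  exists k => // j /=; rewrite mxE.
  by case: eqP => [->|_]; rewrite ?gt_max ?xa ?andbT; apply: xk.
apply: le_trans (leeD (lebn_le_cover X1) (lebn_le_cover X2)) _.
rewrite -nneseriesD; try by move=> k _ _; exact: box_vol_ge0.
apply: lee_nneseries => [k _ _|k _]; first by apply: adde_ge0; exact: box_vol_ge0.
have n0 : (0 < n)%N by apply: leq_ltn_trans (ltn_ord i).
rewrite !box_vol_gt0E// -EFinD lee_fin !(bigD1 i (P := predT))//=.
rewrite !mxE eqxx.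
set p1 := (\prod_(j < n | j != i) Num.max 0 ((F k).2 0 j - (F k).1 0 j))%R.
rewrite [X in (_ * X + _)%R](_ : _ = p1); last first.
  by apply: eq_bigr => j ji; rewrite mxE (negbTE ji).
rewrite [X in (_ + _ * X)%R](_ : _ = p1); last first.
  by apply: eq_bigr => j ji; rewrite mxE (negbTE ji).
rewrite -mulrDl ler_wpM2r//; first by apply: prodr_ge0 => j _; rewrite le_max lexx.
exact: max_split_le.
Qed.

(** The boxes with rational corners, numbered by [unpickle], with [set0] at indices that encode
    nothing: they play the role of a countable basis. *)
Definition qbox k : set 'rV[R]_n :=
  if @unpickle ('rV[rat]_n * 'rV[rat]_n)%type k is Some c then
    box (map_mx ratr c.1, map_mx ratr c.2) else set0.

Lemma qbox_basis (O : set 'rV[R]_n) x : open O -> O x ->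
  exists2 k, qbox k x & qbox k `<=` O.
Proof.
move=> oO /(open_ballP oO)[r r0 rO].
have /choice[a aP] (i : 'I_n) : exists q : rat, (x 0 i - r < ratr q < x 0 i)%R.
  by have [|q] := @rat_in_itvoo R (x 0 i - r)%R (x 0 i)%R; [lra|rewrite in_itv/=; exists q].
have /choice[b bP] (i : 'I_n) : exists q : rat, (x 0 i < ratr q < x 0 i + r)%R.
  by have [|q] := @rat_in_itvoo R (x 0 i)%R (x 0 i + r)%R; [lra|rewrite in_itv/=; exists q].
exists (pickle (\row_i a i, \row_i b i)%R); rewrite /qbox pickleK.
  by move=> i; rewrite !mxE; have := aP i; have := bP i; lra.
move=> y xy; apply: rO; apply/rv_norm_ltP => // i; rewrite !mxE ltr_norml.
by have := aP i; have := bP i; have := xy i; rewrite !mxE; lra.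
Qed.

Lemma qbox_caratheodory k : (leb_outer n).-cara.-measurable (qbox k).
Proof.
rewrite /qbox; case: unpickle => [c|]; last exact: measurable0.
have -> : box (map_mx (ratr : rat -> R) c.1, map_mx (ratr : rat -> R) c.2) =
    \bigcap_(i in [set: 'I_n]) ([set x : 'rV[R]_n | (x 0 i <= ratr (c.2 0 i))%R]
      `&` ~` [set x : 'rV[R]_n | (x 0 i <= ratr (c.1 0 i))%R]).
  apply/seteqP; split => x /= cx i; have := cx i; rewrite !mxE.
    by move=> /andP[h1 h2] _; split => //; apply/negP; rewrite -ltNge.
  by move=> /(_ I) [h2 /negP]; rewrite -ltNge => ->.
apply: (@fin_bigcap_measurable _ (caratheodory_type (leb_outer n)));
  first exact: finite_finset.
by move=> i _; apply: measurableI; [|apply: measurableC]; exact: halfspace_caratheodory.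
Qed.

Lemma open_caratheodory (O : set 'rV[R]_n) : open O ->
  (leb_outer n).-cara.-measurable O.
Proof.
move=> oO; rewrite (_ : O = \bigcup_k (if `[< qbox k `<=` O >] then qbox k else set0)).
  apply: bigcupT_measurable => k; case: ifP => _; last exact: measurable0.
  exact: qbox_caratheodory.
apply/seteqP; split => [x Ox|x [k _]].
  by have [k kx kO] := qbox_basis oO Ox; exists k => //; case: asboolP.
by case: asboolP => // kO; exact: kO.
Qed.

Lemma borel_caratheodory (b : set (borelRn R n)) : measurable b ->
  (leb_outer n).-cara.-measurable b.
Proof.
move: b; apply: smallest_sub; last exact: open_caratheodory.
split; first exact: measurable0.
- by move=> X mX; rewrite setTD; exact: measurableC.
- by move=> F mF; exact: bigcupT_measurable.
Qed.

Lemma open_borel (O : set 'rV[R]_n) : open O -> measurable (O : set (borelRn R n)).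
Proof. by move=> oO; apply: sub_sigma_algebra. Qed.

Lemma closed_borel (O : set 'rV[R]_n) : closed O -> measurable (O : set (borelRn R n)).
Proof. by move=> cO; rewrite -(setCK O); apply: measurableC; apply: open_borel; rewrite openC. Qed.

Lemma qbox_borel k : measurable (qbox k : set (borelRn R n)).
Proof.
rewrite /qbox; case: unpickle => [c|]; last exact: measurable0.
set B := box _; have -> : B =
    \bigcap_(i in [set: 'I_n]) ([set x : 'rV[R]_n | (x 0 i <= ratr (c.2 0 i))%R]
      `&` ~` [set x : 'rV[R]_n | (x 0 i <= ratr (c.1 0 i))%R]).
  apply/seteqP; split => x /= cx i; have := cx i; rewrite !mxE.
    by move=> /andP[h1 h2] _; split => //; apply/negP; rewrite -ltNge.
  by move=> /(_ I) [h2 /negP]; rewrite -ltNge => ->.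
apply: (@fin_bigcap_measurable _ (borelRn R n)); first exact: finite_finset.
have cl i (a : R) : closed [set x : 'rV[R]_n | (x 0 i <= a)%R].
  have /continuous_closedP h : continuous (fun x : 'rV[R]_n => x 0 i)%R.
    exact: coord_continuous.
  exact: (h _ (@closed_le R a)).
by move=> i _; apply: measurableI; [|apply: measurableC]; apply: closed_borel.
Qed.

(** The same set function as [lebesgueRn], but on the Borel sets, so that it shares a measurable
    space with the coefficient measures and with products. *)
Definition leb : set (borelRn R n) -> \bar R := lebn n.

Let leb0 : leb set0 = 0. Proof. exact: lebn0. Qed.
Let leb_ge0 b : 0 <= leb b. Proof. exact: lebn_ge0. Qed.
Let leb_sigma : semi_sigma_additive leb.
Proof.
move=> F mF tF mUF.
exact: (@measure_semi_sigma_additive _ _ _ (lebesgueRn n) F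
  (fun i => borel_caratheodory (mF i)) tF (borel_caratheodory mUF)).
Qed.

HB.instance Definition _ := isMeasure.Build _ (borelRn R n) R leb leb0 leb_ge0 leb_sigma.

Lemma lebn_bounded X (M : R) :
  (forall x, X x -> `|x| <= M)%R -> lebn n X < +oo.
Proof.
move=> XM; pose c : 'rV[R]_n * 'rV[R]_n := (const_mx (- M - 1), const_mx (M + 1))%R.
have XF : X `<=` box c.
  move=> x /XM xM i; rewrite !mxE /=; have := le_trans (rv_coord_le x i) xM.
  by rewrite ler_norml; lra.
apply: le_lt_trans (le_lebn XF) _; apply: le_lt_trans (lebn_box _) _.
by rewrite /box_vol ltry.
Qed.

End LebesgueBasics.
Arguments leb {R} n.
Arguments qbox {R n}.

(** * Lipschitz images and outer measure *)

Section Lipschitz.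
Context {R : realType} {n : nat}.
Implicit Types (X Y b : 'rV[R]_n -> Prop).
Hypothesis n0 : (0 < n)%N.

Lemma lebn_setU (X Y : set 'rV[R]_n) :
  (lebn n (X `|` Y) <= lebn n X + lebn n Y)%E.
Proof.
apply: (le_trans (@le_outer_measureIC _ _ (leb_outer n) X _)).
by apply: leeD; apply: le_lebn => x [[]].
Qed.

Lemma lebn_fin_bigcup (I : finType) (F : I -> set 'rV[R]_n) :
  (lebn n (\bigcup_i F i) <= \sum_i lebn n (F i))%E.
Proof.
have -> : \bigcup_i F i = \big[setU/set0]_(i <- enum I) F i.
  rewrite -bigcup_seq; apply/seteqP; split=> x [i _ Fx]; exists i => //=.
  by rewrite mem_enum.
rewrite -[in leRHS]big_enum /=; elim: (enum I) => [|i s IH].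
  by rewrite !big_nil lebn0.
by rewrite !big_cons; apply: le_trans (lebn_setU _ _) _; exact: leeD.
Qed.

(** Boxes are open on the left, so the lower corner must lie some [e > 0] below the infimum of each
    coordinate; the covering cube therefore has side [D + e]. *)
Lemma lebn_diam (X : set 'rV[R]_n) (D : R) : 0 <= D ->
  (forall x y, X x -> X y -> `|x - y| <= D) ->
  forall e, 0 < e -> (lebn n X <= ((D + e) ^+ n)%:E)%E.
Proof.
move=> D0 XD e e0; have [->|/set0P[x0 X0]] := eqVneq X set0.
- by rewrite lebn0 lee_fin exprn_ge0//; lra.
- pose Xi i := [set x 0 i | x in X].
  have Xi_inf i : has_inf (Xi i).
    split; first by exists (x0 0 i), x0.
    exists (x0 0 i - D) => _ [x Xx <-]; have := le_trans (rv_coord_le (x0 - x) i) (XD _ _ X0 Xx).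
    by rewrite !mxE ler_norml; lra.
  pose c : 'rV[R]_n * 'rV[R]_n := (\row_i (inf (Xi i) - e), \row_i (inf (Xi i) + D)).
  have Xc : X `<=` box c.
    move=> x Xx i; rewrite /c /= !mxE; apply/andP; split.
      by have := inf_lbound (proj2 (Xi_inf i)) (imageP _ Xx : Xi i (x 0 i)); lra.
    rewrite -lerBlDr; apply: lb_le_inf; first by case: (Xi_inf i).
    move=> _ [y Xy <-]; have := le_trans (rv_coord_le (x - y) i) (XD _ _ Xx Xy).
    by rewrite !mxE ler_norml; lra.
  apply: le_trans (le_lebn Xc) _; apply: le_trans (lebn_box _) _.
  rewrite box_vol_gt0E// lee_fin /= -[leRHS](_ : \prod_(i < n) (D + e) = _).
    apply: ler_prod => i _; rewrite !mxE le_max lexx/= ge_max.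
    by apply/andP; split; lra.
  by rewrite prodr_const card_ord.
Qed.

(** Cells of side [h] have images of diameter at most [c h] in the sup norm, hence of measure at
    most [(c h + h^2)^n] by [lebn_diam] with slack [h^2]; at most [prod (a_i / h + 1)] of them meet
    the box. As [h] tends to 0 the product tends to [c^n prod a_i]. *)
Lemma lebn_lipschitz_box (b : set 'rV[R]_n) (f : 'rV[R]_n -> 'rV[R]_n) (c : R)
    (B : 'rV[R]_n * 'rV[R]_n) : 0 < c ->
  (forall x y, b x -> b y -> `|f x - f y| <= c * `|x - y|) ->
  (lebn n (f @` (b `&` box B)) <= (c ^+ n)%:E * box_vol B)%E.
Proof.
move=> c0 fc; have [B0|] := eqVneq (box B) set0.
  rewrite B0 setI0 image_set0 lebn0 mule_ge0//; last exact: box_vol_ge0.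
  by rewrite lee_fin exprn_ge0// ltW.
move/set0P => [xB BxB]; pose a i := B.2 0 i - B.1 0 i.
have a0 i : 0 < a i by have := BxB i; rewrite /a; lra.
rewrite box_vol_gt0E// -EFinM.
under eq_bigr do rewrite -/(a _) max_r ?ltW//.
suff key h : 0 < h ->
    (lebn n (f @` (b `&` box B)) <= ((c * h + h * h) ^+ n * \prod_i (a i / h + 1))%:E)%E.
  (* The bound after cancelling [h^n]: a polynomial in [h], hence continuous at 0. *)
  pose p : {poly R} := (c%:P + 'X) ^+ n * \prod_i ((a i)%:P + 'X).
  have pE h : p.[h] = (c + h) ^+ n * \prod_i (a i + h).
    by rewrite /p hornerM horner_exp horner_prod !hornerE; under eq_bigr do rewrite !hornerE.
  have {}key h : 0 < h -> (lebn n (f @` (b `&` box B)) <= p.[h]%:E)%E.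
    move=> h0; apply: le_trans (key h h0) _; rewrite lee_fin pE -mulrDl exprMn -mulrA.
    rewrite (_ : h ^+ n = \prod_(i < n) h); last by rewrite prodr_const card_ord.
    rewrite -big_split /=.
    by rewrite le_eqVlt; apply/orP; left; apply/eqP; congr (_ * _); apply: eq_bigr => i _; field; rewrite gt_eqF.
  have -> : c ^+ n * \prod_i a i = p.[0].
    by rewrite pE addr0; congr (_ * _); apply: eq_bigr => i _; rewrite addr0.
  apply/lee_addgt0Pr => e e0.
  have /cvgr_distC_lt/(_ _ e0) : p.[h] @[h --> (0:R)] --> p.[0] by exact: continuous_horner.
  move=> /nbhs_ballP[r /= r0 rp]; have r20 : 0 < r / 2 by lra.
  apply: le_trans (key _ r20) _; rewrite -EFinD lee_fin.
  have : ball 0 r (r / 2) by rewrite /ball /= sub0r normrN gtr0_norm//; lra.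
  by move=> /rp /=; rewrite ltr_norml; lra.
move=> h0; have h0' := ltW h0.
pose t (x : 'rV[R]_n) i := Num.truncn ((x 0 i - B.1 0 i) / h).
pose M := (\max_(i < n) Num.truncn (a i / h)).+1.
pose N i := (Num.truncn (a i / h)).+1.
have th x i : box B x -> (t x i < N i)%N.
  move=> Bx; have := Bx i => /andP[x1 x2]; rewrite /N ltnS /t.
  rewrite -ltnS truncn_lt_nat ?divr_ge0//; last by lra.
  have /andP[_] := truncn_itv (divr_ge0 (ltW (a0 i)) h0').
  by apply: le_lt_trans; rewrite ler_pM2r ?invr_gt0// /a; lra.
pose cell (k : {ffun 'I_n -> 'I_M}) := f @` (b `&` box B `&` [set x | forall i, t x i = k i]).
have sub : f @` (b `&` box B) `<=` \bigcup_k cell k.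
  move=> _ [x [bx Bx] <-]; exists [ffun i => inord (t x i)] => //.
  exists x => //; split => // i; rewrite ffunE inordK//.
  by apply: leq_trans (th x i Bx) _; rewrite /N ltnS; exact: leq_bigmax.
apply: le_trans (le_lebn sub) _; apply: le_trans (lebn_fin_bigcup _) _.
have ch0 : 0 < c * h + h * h by rewrite addr_gt0 ?mulr_gt0.
apply: (@le_trans _ _ (\sum_(k : {ffun 'I_n -> 'I_M})
    ((c * h + h * h) ^+ n * \prod_i ((k i < N i)%N%:R : R))%:E)%E); last first.
  rewrite sumEFin lee_fin -mulr_sumr ler_pM2l ?exprn_gt0//.
  rewrite -(bigA_distr_bigA (fun i (j : 'I_M) => ((j < N i)%N%:R : R))).
  apply: ler_prod => i _; rewrite sumr_ge0//= -natr_sum.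
  have -> : (\sum_(j < M) (j < N i)%N = N i)%N.
    rewrite -(big_mkord xpredT (fun j => (j < N i)%N : nat)) (@big_cat_nat _ _ _ (N i))//=; last first.
      by rewrite /N /M ltnS; exact: leq_bigmax.
    rewrite (@eq_big_nat _ _ _ 0%N (N i) _ (fun=> 1%N)); last by move=> j /andP[_ ->].
    rewrite (@eq_big_nat _ _ _ (N i) M _ (fun=> 0%N)); last first.
      by move=> j /andP[Nj _]; rewrite ltnNge Nj.
    by rewrite sum_nat_const_nat subn0 muln1 big1_eq addn0.
  rewrite /N -addn1 natrD lerD2r; have /andP[] := truncn_itv (divr_ge0 (ltW (a0 i)) h0').
  by [].
apply: lee_sum => k _; have [allN|] := boolP [forall i, (k i < N i)%N].
  rewrite big1 ?mulr1; last by move=> i _; rewrite (forallP allN).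
  apply: lebn_diam; [by rewrite mulr_ge0// ltW| |by rewrite mulr_gt0].
  move=> _ _ [x [[bx Bx] kx] <-] [y [[by_ By] ky] <-].
  apply: le_trans (fc _ _ bx by_) _; rewrite ler_pM2l//.
  apply/rv_norm_leP => // i; rewrite !mxE.
  have tt : t x i = t y i by rewrite kx ky.
  have xp : 0 <= (x 0 i - B.1 0 i) / h by rewrite divr_ge0//; have := Bx i; lra.
  have yp : 0 <= (y 0 i - B.1 0 i) / h by rewrite divr_ge0//; have := By i; lra.
  have := truncn_itv xp; have := truncn_itv yp; rewrite -/(t x i) -/(t y i) tt.
  rewrite !ler_pdivlMr// !ltr_pdivrMr// -[(t y i).+1]addn1 natrD mulrDl mul1r ler_norml.
  by move: (_%:R * h) => z; lra.
(* A cell whose index is out of range in some direction misses the box. *)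
rewrite negb_forall => /existsP[i /negP Ni].
rewrite [cell k](_ : _ = set0) ?lebn0.
  by rewrite lee_fin mulr_ge0// ?exprn_ge0 ?prodr_ge0// ltW.
apply/seteqP; split => // y [x [[_ Bx] kx] _]; apply: Ni.
by rewrite -kx; exact: th.
Qed.

Lemma lebn_lipschitz (b : set 'rV[R]_n) (f : 'rV[R]_n -> 'rV[R]_n) (c : R) :
  0 < c -> (forall x y, b x -> b y -> `|f x - f y| <= c * `|x - y|) ->
  (lebn n (f @` b) <= (c ^+ n)%:E * lebn n b)%E.
Proof.
move=> c0 fc; rewrite -lee_pdivrMl ?exprn_gt0//; apply: le_lebn_of_cover => F bF.
rewrite lee_pdivrMl ?exprn_gt0// -nneseriesZl; last by move=> *; exact: box_vol_ge0.
apply: (@le_trans _ _ (\sum_(k <oo) lebn n (f @` (b `&` box (F k))))%E).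
  apply: le_trans (lebn_sigma_subadditive _); apply: le_lebn => _ [x bx <-].
  by have [k _ Fx] := bF _ bx; exists k => //; exists x.
by apply: lee_nneseries => [k _ _|k _]; [exact: lebn_ge0|exact: lebn_lipschitz_box].
Qed.

End Lipschitz.

(** * Linear images and the determinant *)

Section LinearImage.
Context {R : realType} {m : nat}.
Notation n := m.+1.
Implicit Types (b : set 'rV[R]_n) (A T : 'M[R]_n).

Lemma norm_mulmx_le A (c : R) (x : 'rV[R]_n) :
  (forall j, \sum_i `|A i j| <= c) -> `|x *m A| <= c * `|x|.
Proof.
move=> Ac; have c0 : 0 <= c by apply: le_trans (Ac 0); apply: sumr_ge0.
apply/rv_norm_leP; first exact: mulr_ge0.
move=> j; rewrite mxE; apply: le_trans (ler_norm_sum _ _ _) _.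
apply: (@le_trans _ _ (\sum_i `|A i j| * `|x|)).
  by apply: ler_sum => i _; rewrite normrM mulrC ler_wpM2l// rv_coord_le.
by rewrite -mulr_suml ler_wpM2r.
Qed.

(** For matrices acting on row vectors, column sums bound the operator norm in the sup norm. The
    factor is sharp enough for permutations and for the nearly diagonal factor in
    [lebn_triangular]. *)
Lemma lebn_mulmx_norm A (c : R) b : 0 < c -> (forall j, \sum_i `|A i j| <= c) ->
  (lebn n (mulmx^~ A @` b) <= (c ^+ n)%:E * lebn n b)%E.
Proof.
move=> c0 Ac; apply: lebn_lipschitz => // x y _ _.
by rewrite -mulmxBl; exact: norm_mulmx_le.
Qed.

(** A positive diagonal matrix maps boxes to boxes. *)
Lemma lebn_diag (v : 'rV[R]_n) b : (forall i, 0 < v 0 i) ->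
  (lebn n (mulmx^~ (diag_mx v) @` b) <= (\prod_i v 0 i)%:E * lebn n b)%E.
Proof.
move=> v0; have V0 : 0 < \prod_i v 0 i by apply: prodr_gt0.
rewrite -lee_pdivrMl//; apply: le_lebn_of_cover => F bF; rewrite lee_pdivrMl//.
pose G k := ((F k).1 *m diag_mx v, (F k).2 *m diag_mx v).
have bG : box_cover (mulmx^~ (diag_mx v) @` b) G.
  move=> _ [x /bF[k _ xk] <-]; exists k => // i.
  by rewrite /G /= !mul_mx_diag !mxE ltr_pM2r// ler_pM2r//; exact: xk.
apply: le_trans (lebn_le_cover bG) _.
rewrite -nneseriesZl; last by move=> *; exact: box_vol_ge0.
apply: lee_nneseries => [k _ _|k _]; first exact: box_vol_ge0.
rewrite !box_vol_gt0E// -EFinM lee_fin -big_split /=; apply: ler_prod => i _.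
rewrite le_max lexx /= !mul_mx_diag !mxE -mulrBl mulrC.
by rewrite maxr_pMr ?mulr0// ltW.
Qed.

Lemma mulmx_image_comp A T b :
  mulmx^~ (A *m T) @` b = mulmx^~ T @` (mulmx^~ A @` b).
Proof.
apply/seteqP; split=> [_ [x bx <-]|_ [_ [x bx <-] <-]].
  by exists (x *m A); [exists x|rewrite mulmxA].
by exists x => //; rewrite mulmxA.
Qed.

(* Conjugating by the diagonal matrix with entries K ^ (rk i) makes the
   off-diagonal part of T arbitrarily small. *)
Lemma lebn_triangular (rk : 'I_n -> nat) T b : (forall i, T i i != 0) ->
  (forall i j, i != j -> T i j != 0 -> (rk i < rk j)%N) ->
  (lebn n (mulmx^~ T @` b) <= (\prod_i `|T i i|)%:E * lebn n b)%E.
Proof.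
move=> T0 Trk; have P0 : 0 < \prod_i `|T i i| by apply: prodr_gt0 => i _; rewrite normr_gt0.
rewrite -lee_pdivrMl//.
have [->|boo] := eqVneq (lebn n b) +oo%E; first by rewrite leey.
have [r br] : exists r, lebn n b = r%:E.
  by case: (lebn n b) boo (lebn_ge0 (n := n) b) => [r _ _|//|//]; exists r.
rewrite lee_pdivrMl// br.
suff key e : 0 < e -> (lebn n (mulmx^~ T @` b) <=
    ((1 + e) ^+ n * \prod_i `|T i i| * r)%:E)%E.
  pose p : {poly R} := (1 + 'X) ^+ n * (\prod_i `|T i i|)%:P * r%:P.
  have pE h : p.[h] = (1 + h) ^+ n * (\prod_i `|T i i|) * r.
    by rewrite /p !hornerM horner_exp !hornerE.
  have -> : ((\prod_i `|T i i|)%:E * r%:E = p.[0]%:E)%E by rewrite pE addr0 expr1n mul1r.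
  apply/lee_addgt0Pr => e e0.
  have /cvgr_distC_lt/(_ _ e0) : p.[h] @[h --> (0:R)] --> p.[0] by exact: continuous_horner.
  move=> /nbhs_ballP[d /= d0 dp]; have d20 : 0 < d / 2 by lra.
  apply: le_trans (key _ d20) _; rewrite -EFinD lee_fin -pE.
  have : ball 0 d (d / 2) by rewrite /ball /= sub0r normrN gtr0_norm//; lra.
  by move=> /dp /=; rewrite ltr_norml; lra.
(* [M] bounds every off-diagonal column sum of [T] relative to the diagonal. Conjugation divides
   each such entry by at least [K], and [M / K <= e]. *)
move=> e0; pose M := \sum_j \sum_i `|T i j| / `|T j j|.
have M0 : 0 <= M by apply: sumr_ge0 => j _; apply: sumr_ge0 => i _; exact: divr_ge0.
pose K := 1 + M / e; have K1 : 1 <= K by rewrite lerDl divr_ge0// ltW.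
have K0 : 0 < K by lra.
pose d i := K ^+ rk i; have d0 i : 0 < d i by exact: exprn_gt0.
pose D' : 'rV[R]_n := \row_i (d i)^-1; pose E : 'rV[R]_n := \row_i (d i * `|T i i|).
pose S : 'M[R]_n := \matrix_(i, j) (d i * T i j / (d j * `|T j j|)).
have TE : T = diag_mx D' *m S *m diag_mx E.
  apply/matrixP => i j; rewrite mul_diag_mx mul_mx_diag !mxE.
  by field; rewrite normr_eq0 T0 !gt_eqF ?d0.
have D'0 i : 0 < D' 0 i by rewrite mxE invr_gt0.
have E0 i : 0 < E 0 i by rewrite mxE mulr_gt0// normr_gt0.
have Se j : \sum_i `|S i j| <= 1 + e.
  rewrite (bigD1 j)//= mxE -mulf_div divff ?gt_eqF// mul1r normrM normfV normr_id.
  rewrite divff ?normr_eq0// lerD2l.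
  apply: (@le_trans _ _ (\sum_(i | i != j) (`|T i j| / `|T j j|) / K)).
    apply: ler_sum => i ij; rewrite mxE.
    have [->|Tij] := eqVneq (T i j) 0; first by rewrite mulr0 mul0r normr0 !mul0r.
    rewrite -mulf_div normrM [`|d i / d j|]gtr0_norm ?divr_gt0// normrM normfV normr_id mulrC.
    rewrite ler_wpM2l ?divr_ge0// /d ler_pdivrMr ?exprn_gt0// ler_pdivlMl// -exprS; apply: ler_weXn2l => //; exact: Trk.
  rewrite -mulr_suml ler_pdivrMr//; apply: (@le_trans _ _ M).
    apply: (@le_trans _ _ (\sum_i `|T i j| / `|T j j|)).
      by rewrite [leRHS](bigD1 j)//= lerDr divr_ge0.
    rewrite /M [leRHS](bigD1 j)//= lerDl; apply: sumr_ge0 => i _.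
    by apply: sumr_ge0 => k _; exact: divr_ge0.
  by rewrite /K mulrDr mulr1 mulrCA divff ?gt_eqF// mulr1; lra.
rewrite TE !mulmx_image_comp.
apply: le_trans (lebn_diag _ E0) _.
have e10 : 0 < 1 + e by lra.
have E0' : (0 <= (\prod_i E 0 i)%:E)%E by rewrite lee_fin prodr_ge0// => i _; rewrite ltW.
apply: le_trans (lee_wpmul2l E0' (lebn_mulmx_norm _ e10 Se)) _.
apply: le_trans (lee_wpmul2l E0' (lee_wpmul2l _ (lebn_diag _ D'0))) _.
  by rewrite lee_fin exprn_ge0// ltW.
rewrite br -!EFinM lee_fin.
have -> : \prod_i E 0 i = \prod_i (d i) * \prod_i `|T i i|.
  by rewrite -big_split; apply: eq_bigr => i _; rewrite mxE.
have -> : \prod_i D' 0 i = (\prod_i (d i))^-1.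
  by rewrite -prodfV; apply: eq_bigr => i _; rewrite mxE.
have : \prod_i d i != 0 by rewrite gt_eqF// prodr_gt0.
move: (\prod_i d i) ((1 + e) ^+ n) => q z q0.
rewrite le_eqVlt; apply/orP; left; apply/eqP; rewrite -TE; field.
exact: q0.
Qed.

Lemma lebn_perm (P : 'M[R]_n) b : is_perm_mx P ->
  (lebn n (mulmx^~ P @` b) <= lebn n b)%E.
Proof.
move=> /is_perm_mxP[s ->]; rewrite -[leRHS]mul1e -[1%E](_ : ((1:R) ^+ n)%:E = _).
  apply: lebn_mulmx_norm => // j; rewrite (bigD1 ((s^-1)%g j))//= big1 ?addr0.
    by rewrite !mxE permKV eqxx normr1.
  move=> i ij; rewrite !mxE; case: eqP => [sij|_]; last by rewrite normr0.
  by rewrite -sij permK eqxx in ij.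
by rewrite expr1n.
Qed.

(** LUP decomposition reduces to permutations and triangular matrices; the rank is [i] for the upper
    factor and [n - i] for the lower one. The opposite inequality is this one applied to the inverse
    matrix. *)
Lemma lebn_mulmx_le A b : A \in unitmx ->
  (lebn n (mulmx^~ A @` b) <= `|\det A|%:E * lebn n b)%E.
Proof.
move=> Au; have := cormen_lup_correct A; have := cormen_lup_perm A.
have := cormen_lup_detL A; have := @cormen_lup_lower R m A; have := @cormen_lup_upper R m A.
case: (cormen_lup A) => -[P L] U /= Uu Ll dL /[dup] Pp /is_perm_mxP[s Ps] PA.
have dU : \det U = \prod_i U i i.
  rewrite -det_tr det_trig; first by apply: eq_bigr => i _; rewrite mxE.
  by apply/is_trig_mxP => i j ij; rewrite mxE Uu.
have dPA : `|\det A| = `|\det U|.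
  have /(congr1 (fun M => `|\det M|)) := PA; rewrite -!mulmxE !det_mulmx dL mul1r.
  by rewrite normrM Ps det_perm normrX normrN1 expr1n mul1r.
have dU0 : \det U != 0.
  by rewrite -normr_eq0 -dPA normr_eq0 -unitfE -unitmxE.
have U0 i : U i i != 0.
  by move: dU0; rewrite dU => /prodf_neq0; exact.
have AE : A = perm_mx s^-1%g *m L *m U.
  by rewrite -mulmxA mulmxE -PA Ps -mulmxE mulmxA -perm_mxM fingroup.mulVg perm_mx1 mul1mx.
rewrite {1}AE !mulmx_image_comp dPA dU normr_prod.
apply: le_trans (@lebn_triangular (fun i => i) _ _ U0 _) _.
  by move=> i j ij; apply: contraR; rewrite -leqNgt => ji; rewrite Uu// ltn_neqAle ji eq_sym ij.
apply: lee_wpmul2l; first by rewrite lee_fin prodr_ge0.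
have L1 i : L i i = 1 by rewrite Ll ?eqxx.
apply: le_trans (@lebn_triangular (fun i => (n - i)%N) L _ _ _) _.
- by move=> i; rewrite L1 oner_eq0.
- move=> i j ij; apply: contraR; rewrite -leqNgt => ji; rewrite Ll ?(negbTE ij)//.
  by move: ji; rewrite leq_sub2lE// ltnW.
under eq_bigr do rewrite L1 normr1.
rewrite big1_eq mul1e; apply: lebn_perm; exact: perm_mx_is_perm.
Qed.

End LinearImage.

(** * Splitting off the last coordinate *)

Section Snoc.
Context {R : realType} {d : nat}.
Implicit Types (x y : 'rV[R]_d) (X : 'rV[R]_d.+1).

Definition rinit X : 'rV[R]_d := \row_i X 0 (lift ord_max i).
Definition rlast X : R := X 0 ord_max.

Lemma snoc_lift y t i : snoc y t 0 (lift ord_max i) = y 0 i.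
Proof. by rewrite mxE liftK. Qed.

Lemma snoc_max y t : snoc y t 0 ord_max = t.
Proof. by rewrite mxE unlift_none. Qed.

Lemma rinit_snoc y t : rinit (snoc y t) = y.
Proof. by apply/rowP => i; rewrite mxE snoc_lift. Qed.

Lemma rlast_snoc y t : rlast (snoc y t) = t.
Proof. exact: snoc_max. Qed.

Lemma snoc_rinit X : snoc (rinit X) (rlast X) = X.
Proof.
by apply/rowP => i; case: (unliftP ord_max i) => [j|] ->; rewrite ?snoc_lift ?snoc_max// mxE.
Qed.

Lemma big_lift (T : Type) (idx : T) (op : Monoid.law idx) (F : 'I_d.+1 -> T) :
  \big[op/idx]_i F i = op (\big[op/idx]_(i < d) F (lift ord_max i)) (F ord_max).
Proof.
rewrite big_ord_recr /=; congr (op _ _); apply: eq_bigr => i _; congr F.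
by apply: val_inj; rewrite /= /bump leqNgt ltn_ord.
Qed.

Lemma dotrv_snoc x y (s t : R) : dotrv (snoc x s) (snoc y t) = dotrv x y + s * t.
Proof.
by rewrite /dotrv big_lift !snoc_max; congr (_ + _); apply: eq_bigr => i _; rewrite !snoc_lift.
Qed.

Lemma snoc_norm_le y t (c : R) : 0 <= c ->
  (`|snoc y t| <= c) = (`|y| <= c) && (`|t| <= c).
Proof.
move=> c0; apply/(rv_norm_leP _ c0)/andP => [h|[/(rv_norm_leP _ c0) h tc] i].
  by split; [apply/rv_norm_leP => // i; have := h (lift ord_max i); rewrite snoc_lift
            |have := h ord_max; rewrite snoc_max].
by case: (unliftP ord_max i) => [j|] ->; rewrite ?snoc_lift ?snoc_max.
Qed.

Lemma snoc_norm_lt y t (c : R) : 0 < c ->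
  (`|snoc y t| < c) = (`|y| < c) && (`|t| < c).
Proof.
move=> c0; apply/(rv_norm_ltP _ c0)/andP => [h|[/(rv_norm_ltP _ c0) h tc] i].
  by split; [apply/rv_norm_ltP => // i; have := h (lift ord_max i); rewrite snoc_lift
            |have := h ord_max; rewrite snoc_max].
by case: (unliftP ord_max i) => [j|] ->; rewrite ?snoc_lift ?snoc_max.
Qed.

Lemma snocD x y (s t : R) : snoc x s + snoc y t = snoc (x + y) (s + t).
Proof.
by apply/rowP => i; rewrite !mxE; case: unlift => [j|]//; rewrite mxE.
Qed.

Lemma snocZ (a : R) x (s : R) : a *: snoc x s = snoc (a *: x) (a * s).
Proof.
by apply/rowP => i; rewrite !mxE; case: unlift => [j|]//; rewrite mxE.
Qed.

Lemma snocB x y (s t : R) : snoc x s - snoc y t = snoc (x - y) (s - t).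
Proof.
by apply/rowP => i; rewrite !mxE; case: unlift => [j|]//; rewrite !mxE.
Qed.

Lemma rinitB X Y : rinit (X - Y) = rinit X - rinit Y.
Proof. by apply/rowP => i; rewrite !mxE. Qed.

Lemma rlastB X Y : rlast (X - Y) = rlast X - rlast Y.
Proof. by rewrite /rlast !mxE. Qed.

Lemma rinit_norm_le X : `|rinit X| <= `|X|.
Proof. by apply/rv_norm_leP => // i; rewrite mxE rv_coord_le. Qed.

Lemma rlast_norm_le X : `|rlast X| <= `|X|.
Proof. exact: rv_coord_le. Qed.

End Snoc.

Section BorelMeasurability.
Context {R : realType}.

Lemma borel_measurable_fun d (T : measurableType d) (n : nat) (f : T -> 'rV[R]_n) :
  (forall O : set 'rV[R]_n, open O -> measurable (f @^-1` O)) ->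
  measurable_fun [set: T] (f : T -> borelRn R n).
Proof.
move=> fO; apply: (@measurability _ _ _ (borelRn R n) _ f (@open 'rV[R]_n)).
  by [].
move=> _ [U oU <-]; by rewrite setTI; exact: fO.
Qed.

Lemma real_measurable_fun d (T : measurableType d) (f : T -> R) :
  (forall O : set R, open O -> measurable (f @^-1` O)) ->
  measurable_fun [set: T] (f : T -> measurableTypeR R).
Proof.
move=> fO; apply: (measurability _ (RGenOInfty.measurableE R)) => _ [_ [x ->] <-].
by rewrite setTI; apply: fO; exact: interval_open.
Qed.

Definition snoc_split {d} (X : borelRn R d.+1) : borelRn R d * measurableTypeR R :=
  (rinit X, rlast X).

Lemma rinit_continuous d : continuous (@rinit R d).
Proof.
move=> X; apply: rv_continuous_at => e e0; exists e => // Z ZX.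
by rewrite -rinitB; apply: le_lt_trans (rinit_norm_le _) _; rewrite distrC.
Qed.

Lemma rlast_continuous d : continuous (@rlast R d).
Proof. exact: coord_continuous. Qed.

Lemma measurable_snoc_split d : measurable_fun setT (@snoc_split d).
Proof.
have m1 : measurable_fun setT (@rinit R d : borelRn R d.+1 -> borelRn R d).
  apply: borel_measurable_fun => O oO; apply: open_borel.
  by move: O oO; apply/continuousP; exact: rinit_continuous.
have m2 : measurable_fun setT (@rlast R d : borelRn R d.+1 -> measurableTypeR R).
  apply: real_measurable_fun => O oO; apply: open_borel.
  by move: O oO; apply/continuousP; exact: rlast_continuous.
exact: (measurable_fun_pair m1 m2).
Qed.

End BorelMeasurability.

Section SigmaFinite.
Context {R : realType} {n : nat}.

Definition cball k : set 'rV[R]_n := [set x | `|x| <= k%:R].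

Lemma closed_cball k : closed (cball k).
Proof.
have /continuous_closedP h : continuous (fun x : 'rV[R]_n => `|x|) by exact: norm_continuous.
exact: (h _ (@closed_le R k%:R)).
Qed.

Lemma bigcup_cball : \bigcup_k cball k = setT.
Proof.
apply/seteqP; split=> // x _; exists (Num.truncn `|x|).+1 => //=.
by have /andP[_ /ltW] := truncn_itv (normr_ge0 x).
Qed.

Lemma cball_subset k l : (k <= l)%N -> cball k `<=` cball l.
Proof. by move=> kl x /= /le_trans; apply; rewrite ler_nat. Qed.

Lemma lebn_cball k : (lebn n (cball k) < +oo)%E.
Proof. by apply: (@lebn_bounded _ _ _ k%:R). Qed.

Let leb_sigma_finite : sigma_finite setT (@leb R n).
Proof.
exists cball; first by rewrite bigcup_cball.
by move=> k; split; [apply: closed_borel; exact: closed_cball|exact: lebn_cball].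
Qed.

HB.instance Definition _ := Measure_isSigmaFinite.Build _ _ _ (@leb R n) leb_sigma_finite.

End SigmaFinite.

(** * Lebesgue measure as a product measure *)

Section LebesgueProduct.
Context {R : realType} {d : nat}.
Hypothesis d0 : (0 < d)%N.
Local Open Scope ereal_scope.
Notation lam := (@lebesgue_measure R).
Notation Y := (borelRn R d * measurableTypeR R)%type.

Lemma box_vol_snoc (F : 'rV[R]_d.+1 * 'rV[R]_d.+1) :
  box_vol F = box_vol (rinit F.1, rinit F.2) * lam `](rlast F.1), (rlast F.2)]%classic.
Proof.
rewrite !box_vol_gt0E// big_lift EFinM; congr (_ * _).
  by congr (_%:E); apply: eq_bigr => i _; rewrite !mxE.
rewrite lebesgue_measure_itv /= lte_fin -/(rlast _) -/(rlast F.2).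
case: ltP => [h|h]; first by rewrite max_r// ?subr_ge0 ltW.
by rewrite max_l// subr_le0.
Qed.

(** In a box cover of the preimage, the boxes whose last side contains [t] cover the section at
    height [t] once projected. Hence the measure of the section is at most
    [\sum_k V k * \1_(I k) t], which integrates to the total volume of the cover. *)
Lemma product_le_lebn (X : set Y) : measurable X ->
  (leb d \x lam) X <= lebn d.+1 [set Z | X (snoc_split Z)].
Proof.
move=> mX; apply: le_lebn_of_cover => F XF.
have -> : (leb d \x lam) X = (leb d \x^ lam) X.
  by apply: product_measure_unique => //= *; rewrite product_measure2E.
rewrite /product_measure2.
pose I k : set (measurableTypeR R) := `](rlast (F k).1), (rlast (F k).2)]%classic.
pose V k := box_vol (rinit (F k).1, rinit (F k).2).
have mI k : measurable (I k) by exact: measurable_itv.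
have V0 k : 0 <= V k by exact: box_vol_ge0.
rewrite (eq_eseriesr (g := fun k => V k * lam (I k))); last first.
  by move=> k _; rewrite box_vol_snoc.
rewrite (eq_eseriesr (g := fun k => \int[lam]_t (V k * (\1_(I k) t)%:E))); last first.
  move=> k _; rewrite ge0_integralZl//.
  - by rewrite integral_indic// setIT.
  - by apply/measurable_EFinP.
have mf k : measurable_fun setT (fun t => V k * (\1_(I k) t)%:E).
  by apply: emeasurable_funM; [exact: measurable_cst|apply/measurable_EFinP].
have f0 k t : 0 <= V k * (\1_(I k) t)%:E by rewrite mule_ge0// lee_fin.
rewrite -(integral_nneseries lam measurableT mf (fun k t _ => f0 k t)).
apply: ge0_le_integral => //.
- exact: (@measurable_fun_ysection _ _ _ _ _ (leb d)).
- exact: ge0_emeasurable_sum.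
move=> t _ /=; pose G k : 'rV[R]_d * 'rV[R]_d :=
  if t \in I k then (rinit (F k).1, rinit (F k).2) else (0, 0)%R.
have cov : box_cover (ysection X t) G.
  move=> y; rewrite /ysection /= inE => Xyt.
  have [|k _ Fk] := XF (snoc y t); first by rewrite /= /snoc_split rinit_snoc rlast_snoc.
  exists k => //; rewrite /G ifT; last first.
    by rewrite inE /I /= in_itv /=; have := Fk ord_max; rewrite snoc_max.
  by move=> i; rewrite !mxE; have := Fk (lift ord_max i); rewrite snoc_lift.
apply: le_trans (lebn_le_cover cov) _.
apply: lee_nneseries => [k _ _|k _]; first exact: box_vol_ge0.
rewrite /G indicE; case: ifP => _; first by rewrite mule1.
by rewrite box_vol00 mule0.
Qed.

Lemma lebn_strip_le (b : set 'rV[R]_d) (a c : R) : (a < c)%R ->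
  lebn d.+1 [set Z | b (rinit Z) /\ (a < rlast Z <= c)%R] <= lebn d b * (c - a)%:E.
Proof.
move=> ac; have ac0 : (0 < c - a)%R by rewrite subr_gt0.
rewrite muleC -lee_pdivrMl//; apply: le_lebn_of_cover => F bF; rewrite lee_pdivrMl//.
pose G k : 'rV[R]_d.+1 * 'rV[R]_d.+1 := (snoc (F k).1 a, snoc (F k).2 c).
have cov : box_cover [set Z | b (rinit Z) /\ (a < rlast Z <= c)%R] G.
  move=> Z [/= /bF[k _ Fk] ac']; exists k => // i /=; rewrite -(snoc_rinit Z).
  case: (unliftP ord_max i) => [j|] ->; rewrite ?snoc_lift ?snoc_max//.
apply: le_trans (lebn_le_cover cov) _.
rewrite -nneseriesZl; last by move=> *; exact: box_vol_ge0.
apply: lee_nneseries => [k _ _|k _]; first exact: box_vol_ge0.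
rewrite box_vol_snoc /= !rinit_snoc !rlast_snoc lebesgue_measure_itv /= lte_fin ac.
by rewrite -surjective_pairing muleC.
Qed.

(** On a slab [Q k], of finite measure, [lebn] is at most the product measure. Since
    [product_le_lebn] gives the opposite inequality both for [X] and for its complement in [Q k],
    equality is forced on each part. The slabs then increase to the whole space. *)
Lemma lebn_productE (X : set Y) : measurable X ->
  lebn d.+1 [set Z | X (snoc_split Z)] = (leb d \x lam) X.
Proof.
move=> mX.
pose Q k : set Y := cball k `*` `](- k%:R)%R, k%:R]%classic.
have mQ k : measurable (Q k).
  by apply: measurableX; [apply: closed_borel; exact: closed_cball|exact: measurable_itv].
pose S (Z : set Y) := [set x : 'rV[R]_d.+1 | Z (snoc_split x)].
have mS Z : measurable Z -> measurable (S Z : set (borelRn R d.+1)).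
  by move=> mZ; rewrite -[S Z]setTI; exact: measurable_snoc_split.
pose P : {measure set Y -> \bar R} := (leb d \x lam)%E.
have PQ k : P (Q k) = lebn d (cball k) * lam `](- k%:R)%R, k%:R]%classic.
  by rewrite /P /= product_measure1E//; apply: closed_borel; exact: closed_cball.
have PQoo k : P (Q k) < +oo.
  rewrite PQ lte_mul_pinfty ?lebn_ge0//; first by rewrite ge0_fin_numE ?lebn_ge0 ?lebn_cball.
  by rewrite lebesgue_measure_itv /=; case: ifP => // _; rewrite ltry.
have leQ k : lebn d.+1 (S (Q k)) <= P (Q k).
  (* [lebn_strip_le] wants a nondegenerate interval, and for [k = 0] the interval is empty. *)
  case: k => [|k].
    rewrite [S _](_ : _ = set0) ?lebn0//; apply/seteqP; split => // Z [_] /=.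
    by rewrite in_itv /=; lra.
  have k0 : (- k.+1%:R < k.+1%:R :> R)%R.
    by apply: (@lt_trans _ _ 0%R); rewrite ?oppr_lt0 ltr0n.
  rewrite PQ lebesgue_measure_itv /= lte_fin k0; apply: le_trans (lebn_strip_le _ k0).
  by apply: le_lebn => Z [/= ? ]; rewrite in_itv.
have eqQ k : leb d.+1 (S (Q k `&` X)) = P (Q k `&` X).
  have h1 : P (Q k `&` X) <= leb d.+1 (S (Q k `&` X)) by apply: product_le_lebn; exact: measurableI.
  have h2 : P (Q k `\` X) <= leb d.+1 (S (Q k `\` X)) by apply: product_le_lebn; exact: measurableD.
  have e1 : P (Q k) = P (Q k `&` X) + P (Q k `\` X) by rewrite addeC -measureDI.
  have e2 : leb d.+1 (S (Q k)) = leb d.+1 (S (Q k `&` X)) + leb d.+1 (S (Q k `\` X)).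
    by rewrite addeC [LHS](measureDI _ (mS _ (mQ k)) (mS _ mX)).
  have := leQ k; rewrite -/(leb d.+1 _) e1 e2 => le12.
  have f1 : P (Q k `\` X) \is a fin_num.
    rewrite ge0_fin_numE//; apply: le_lt_trans (PQoo k).
    by apply: le_measure; rewrite ?inE//; exact: measurableD.
  apply/eqP; rewrite eq_le h1 andbT -(@leeD2rE _ (P (Q k `\` X)))//.
  by apply: le_trans le12; exact: leeD2l.
have UQ : \bigcup_k (Q k `&` X) = X.
  rewrite -setI_bigcupl (_ : \bigcup_k Q k = setT) ?setTI//.
  apply/seteqP; split=> // -[y t] _.
  pose m : R := (Num.max `|y : 'rV[R]_d| `|t : R|)%R.
  exists (Num.truncn m).+1 => //.
  have m0 : (0 <= m)%R by rewrite le_max normr_ge0.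
  have /andP[_] := truncn_itv m0; rewrite gt_max => /andP[yN tN].
  split => /=; first exact: ltW.
  by rewrite in_itv /=; move: tN; rewrite ltr_norml => /andP[-> /ltW].
have ndQ : {homo (fun k => Q k `&` X) : k l / (k <= l)%N >-> (k <= l)%O}.
  move=> k l kl; apply/subsetPset => -[y t] [[/= yk tk] Xyt]; split => //; split => /=.
    exact: cball_subset yk.
  move: tk; rewrite !in_itv /=; have : (k%:R <= l%:R :> R)%R by rewrite ler_nat.
  by lra.
have c1 : P (Q k `&` X) @[k --> \oo] --> P X.
  rewrite -[in X in _ --> X]UQ; apply: nondecreasing_cvg_mu => //.
  - by move=> k; exact: measurableI.
  - by rewrite UQ.
have c2 : leb d.+1 (S (Q k `&` X)) @[k --> \oo] --> leb d.+1 (S X).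
  rewrite -[in X in _ --> X]UQ (_ : S (\bigcup_k (Q k `&` X)) = \bigcup_k S (Q k `&` X))//.
  apply: (@nondecreasing_cvg_mu _ _ _ (leb d.+1) (fun k => S (Q k `&` X))).
  - by move=> k; apply: mS; exact: measurableI.
  - by apply: bigcupT_measurable => k; apply: mS; exact: measurableI.
  - by move=> k l /ndQ /subsetPset kl; apply/subsetPset => Z; exact: kl.
have c3 : P (Q k `&` X) @[k --> \oo] --> leb d.+1 (S X).
  by rewrite -(_ : (fun k => leb d.+1 (S (Q k `&` X))) = fun k => P (Q k `&` X))//; apply/funext.
exact: (cvg_unique _ c3 c1).
Qed.

End LebesgueProduct.

(** * Strict differentiability *)

Section ConvexSets.
Context {R : realType} {V : lmodType R}.

Lemma convex_setP (U : set V) : convex_set U ->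
  forall x y (t : R), 0 <= t <= 1 -> U x -> U y -> U (t *: x + (1 - t) *: y).
Proof.
move=> cU x y t /andP[t0 t1] Ux Uy.
by have := cU x y (Itv01 t0 t1); rewrite !inE; exact.
Qed.

Lemma convex_setPC (U : set V) :
  (forall x y (t : R), 0 <= t <= 1 -> U x -> U y -> U (t *: x + (1 - t) *: y)) ->
  convex_set U.
Proof.
move=> cU x y t; rewrite !inE => Ux Uy; apply: (cU x y t%:inum _ Ux Uy).
by apply/andP; split; [exact: ge0|exact: le1].
Qed.

Lemma convex_functionP (U : set V) (f : V -> R) : convex_function U f ->
  forall x y (t : R), 0 <= t <= 1 -> U x -> U y ->
    f (t *: x + (1 - t) *: y) <= t * f x + (1 - t) * f y.
Proof.
move=> cf x y t /andP[t0 t1] Ux Uy.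
by have := cf (Itv01 t0 t1) x y; rewrite !inE; exact.
Qed.

End ConvexSets.

Section Dot.
Context {R : realType} {n : nat}.
Implicit Types (x y z L : 'rV[R]_n).

Lemma dotrvC x y : dotrv x y = dotrv y x.
Proof. by apply: eq_bigr => i _; rewrite mulrC. Qed.

Lemma dotrvDr x y z : dotrv x (y + z) = dotrv x y + dotrv x z.
Proof. by rewrite -big_split; apply: eq_bigr => i _; rewrite mxE mulrDr. Qed.

Lemma dotrvZr (a : R) x y : dotrv x (a *: y) = a * dotrv x y.
Proof. by rewrite mulr_sumr; apply: eq_bigr => i _; rewrite mxE mulrCA. Qed.

Lemma dotrvNr x y : dotrv x (- y) = - dotrv x y.
Proof. by rewrite -scaleN1r dotrvZr mulN1r. Qed.

Lemma dotrvBr x y z : dotrv x (y - z) = dotrv x y - dotrv x z.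
Proof. by rewrite dotrvDr dotrvNr. Qed.

Lemma dotrvDl x y z : dotrv (y + z) x = dotrv y x + dotrv z x.
Proof. by rewrite !(dotrvC _ x) dotrvDr. Qed.

Lemma dotrvZl (a : R) x y : dotrv (a *: y) x = a * dotrv y x.
Proof. by rewrite !(dotrvC _ x) dotrvZr. Qed.

Lemma dotrvNl x y : dotrv (- y) x = - dotrv y x.
Proof. by rewrite !(dotrvC _ x) dotrvNr. Qed.

Lemma dotrvBl x y z : dotrv (y - z) x = dotrv y x - dotrv z x.
Proof. by rewrite !(dotrvC _ x) dotrvBr. Qed.

Lemma dotrv0r x : dotrv x 0 = 0.
Proof. by apply: big1 => i _; rewrite mxE mulr0. Qed.

Lemma dotrv0l x : dotrv 0 x = 0.
Proof. by rewrite dotrvC dotrv0r. Qed.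

Definition l1norm x : R := \sum_i `|x 0 i|.

Lemma l1norm_ge0 x : 0 <= l1norm x. Proof. exact: sumr_ge0. Qed.

Lemma dotrv_le x y : `|dotrv x y| <= l1norm x * `|y|.
Proof.
apply: le_trans (ler_norm_sum _ _ _) _; rewrite mulr_suml; apply: ler_sum => i _.
by rewrite normrM ler_wpM2l// rv_coord_le.
Qed.

Lemma l1norm_le x : l1norm x <= n%:R * `|x|.
Proof.
apply: (@le_trans _ _ (\sum_(i < n) `|x|)); first by apply: ler_sum => i _; exact: rv_coord_le.
by rewrite sumr_const card_ord mulr_natl.
Qed.

Lemma dotrv_delta i x : dotrv (delta_mx 0 i) x = x 0 i.
Proof.
rewrite /dotrv (bigD1 i)//= big1 ?addr0; first by rewrite mxE !eqxx mul1r.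
by move=> j ji; rewrite mxE (negbTE ji) andbF mul0r.
Qed.

Lemma dotrv_eq0 x : (forall y, dotrv y x = 0) -> x = 0.
Proof. by move=> h; apply/rowP => i; rewrite -dotrv_delta h mxE. Qed.

Lemma dotrv_ge0 x : 0 <= dotrv x x.
Proof. by apply: sumr_ge0 => i _; rewrite -expr2 sqr_ge0. Qed.

Lemma dotrv_self_eq0 x : dotrv x x = 0 -> x = 0.
Proof.
move=> /psumr_eq0P x0; apply/rowP => i; rewrite mxE; apply/eqP.
by rewrite -sqrf_eq0 expr2 x0// => j _; rewrite -expr2 sqr_ge0.
Qed.

End Dot.

(* [sdiff f L x]: f is strictly differentiable at x, with gradient L. *)
Definition sdiff {R : realType} {n : nat} (f : 'rV[R]_n -> R) (L x : 'rV[R]_n) :=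
  forall e : R, 0 < e -> exists2 r : R, 0 < r &
    forall y z, `|y - x| < r -> `|z - x| < r ->
      `|f y - f z - dotrv L (y - z)| <= e * `|y - z|.

Section StrictDifferentiability.
Context {R : realType} {n : nat}.
Implicit Types (f g : 'rV[R]_n -> R) (L M x y z : 'rV[R]_n).

Lemma sdiff_lip f L x : sdiff f L x -> exists2 r : R, 0 < r &
  forall y z, `|y - x| < r -> `|z - x| < r -> `|f y - f z| <= (l1norm L + 1) * `|y - z|.
Proof.
move=> /(_ 1 ltr01)[r r0 rf]; exists r => // y z yr zr.
have := rf _ _ yr zr; have := dotrv_le L (y - z).
rewrite mulrDl; move: (l1norm L * _) (f y - f z) (dotrv _ _) => a b c.
by rewrite !ler_norml; lra.
Qed.

Lemma sdiff_near f L x e : sdiff f L x -> 0 < e -> exists2 r : R, 0 < r &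
  forall y, `|y - x| < r -> `|f y - f x| < e.
Proof.
move=> /sdiff_lip[r r0 rf] e0; have N0 := l1norm_ge0 L.
have l0 : 0 < l1norm L + 1 by lra.
exists (Num.min r (e / (l1norm L + 1))); first by rewrite lt_min r0 divr_gt0.
move=> y; rewrite lt_min => /andP[yr ye].
apply: le_lt_trans (rf y x yr _) _; first by rewrite subrr normr0.
by rewrite -ltr_pdivlMl// mulrC.
Qed.

Lemma sdiff_continuous f L x : sdiff f L x -> {for x, continuous f}.
Proof.
move=> fL; apply: rv_continuous_at => e /(sdiff_near fL)[r r0 rf]; exists r => //.
by move=> y /rf; rewrite distrC.
Qed.

Lemma sdiff_cst (a : R) x : sdiff (fun=> a) 0 x.
Proof.
move=> e e0; exists 1 => // y z _ _.
by rewrite subrr sub0r dotrv0l oppr0 normr0 mulr_ge0// ltW.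
Qed.

Lemma sdiff_linear (f : 'rV[R]_n -> R) L x : (forall y, f y = dotrv L y) -> sdiff f L x.
Proof.
move=> fL e e0; exists 1 => // y z _ _.
by rewrite !fL -dotrvBr subrr normr0 mulr_ge0// ltW.
Qed.

Lemma sdiffD f g L M x : sdiff f L x -> sdiff g M x ->
  sdiff (fun y => f y + g y) (L + M) x.
Proof.
move=> fL gM e e0; have e20 : 0 < e / 2 by lra.
have [r r0 rf] := fL _ e20; have [s s0 sg] := gM _ e20.
exists (Num.min r s); first by rewrite lt_min r0.
move=> y z; rewrite !lt_min => /andP[yr ys] /andP[zr zs].
have := rf _ _ yr zr; have := sg _ _ ys zs; rewrite dotrvDl.
move: (dotrv _ _) (dotrv _ _) `|y - z| => a b c; rewrite !ler_norml.
by move=> h1 h2; lra.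
Qed.

Lemma sdiffM f g L M x : sdiff f L x -> sdiff g M x ->
  sdiff (fun y => f y * g y) (g x *: L + f x *: M) x.
Proof.
move=> fL gM e e0.
(* [K] exceeds the sum of the coefficients of the four error terms below, where [|g z| <= |g x| + 1]
   and [|f y| <= |f x| + 1]. *)
pose K := `|f x| + `|g x| + l1norm L + l1norm M + 3.
have := normr_ge0 (f x); have := normr_ge0 (g x).
have := l1norm_ge0 L; have := l1norm_ge0 M => m1 m2 m3 m4.
have K0 : 0 < K by rewrite /K; lra.
pose d := Num.min 1 (e / (4 * K)).
have d0 : 0 < d by rewrite lt_min ltr01 divr_gt0// mulr_gt0.
have d1 : d <= 1 by rewrite ge_min lexx.
have dK : d * K <= e / 4.
  have : d <= e / (4 * K) by rewrite ge_min lexx orbT.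
  by rewrite ler_pdivlMr ?mulr_gt0//; lra.
have [r1 r10 h1] := fL _ d0; have [r2 r20 h2] := gM _ d0.
have [r3 r30 h3] := sdiff_near fL d0; have [r4 r40 h4] := sdiff_near gM d0.
exists (Num.min (Num.min r1 r2) (Num.min r3 r4)); first by rewrite !lt_min r10 r20 r30.
move=> y z; rewrite !lt_min => /andP[/andP[y1 y2] /andP[y3 y4]] /andP[/andP[z1 z2] /andP[z3 z4]].
have := h1 _ _ y1 z1; have := h2 _ _ y2 z2; have := h3 _ y3; have := h4 _ z4.
have := dotrv_le L (y - z); have := dotrv_le M (y - z).
rewrite dotrvDl !dotrvZl.
move: (dotrv L _) (dotrv M _) `|y - z| (normr_ge0 (y - z)) => a b c c0 aL bM gz fy gg ff.
have -> : f y * g y - f z * g z - (g x * a + f x * b) =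
    (f y - f z - a) * g z + (g y - g z - b) * f y + a * (g z - g x) + b * (f y - f x) by ring.
have gz1 : `|g z| <= `|g x| + 1.
  by have := ler_normD (g z - g x) (g x); rewrite subrK; move: (ltW gz) d1; clear -R; lra.
have fy1 : `|f y| <= `|f x| + 1.
  by have := ler_normD (f y - f x) (f x); rewrite subrK; move: (ltW fy) d1; clear -R; lra.
have B1 : `|(f y - f z - a) * g z| <= d * c * (`|g x| + 1).
  by rewrite normrM ler_pM.
have B2 : `|(g y - g z - b) * f y| <= d * c * (`|f x| + 1).
  by rewrite normrM ler_pM.
have B3 : `|a * (g z - g x)| <= l1norm L * c * d by rewrite normrM ler_pM// ltW.
have B4 : `|b * (f y - f x)| <= l1norm M * c * d by rewrite normrM ler_pM// ltW.
have B : `|(f y - f z - a) * g z + (g y - g z - b) * f y + a * (g z - g x) + b * (f y - f x)|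
   <= d * K * c.
  apply: le_trans (ler_normD _ _) _; apply: le_trans (lerD (le_trans (ler_normD _ _)
    (lerD (le_trans (ler_normD _ _) (lerD B1 B2)) B3)) B4) _.
  have : 0 <= d * c by rewrite mulr_ge0// ltW.
  rewrite /K (_ : d * c * (`|g x| + 1) + d * c * (`|f x| + 1) + l1norm L * c * d + l1norm M * c * d
    = d * (`|f x| + `|g x| + l1norm L + l1norm M + 3) * c - d * c); last by ring.
  by clear -R; lra.
apply: le_trans B _; apply: ler_wpM2r => //; clear - dK e0; lra.
Qed.

Lemma sdiffZ (a : R) f L x : sdiff f L x -> sdiff (fun y => a * f y) (a *: L) x.
Proof.
move=> fL; have := sdiffM (sdiff_cst a x) fL.
by rewrite scaler0 add0r.
Qed.

Lemma sdiffN f L x : sdiff f L x -> sdiff (fun y => - f y) (- L) x.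
Proof.
move=> /(sdiffZ (-1)); rewrite scaleN1r => h e /h[r r0 rf]; exists r => // y z yr zr.
by have := rf _ _ yr zr; rewrite !mulN1r.
Qed.

Lemma sdiff_sum (I : Type) (s : seq I) (f : I -> 'rV[R]_n -> R) (L : I -> 'rV[R]_n) x :
  (forall i, sdiff (f i) (L i) x) ->
  sdiff (fun y => \sum_(i <- s) f i y) (\sum_(i <- s) L i) x.
Proof.
move=> fL; elim: s => [|i s IH].
  rewrite big_nil (_ : (fun y => _) = fun=> 0); first exact: sdiff_cst.
  by apply/funext => y; rewrite big_nil.
rewrite big_cons (_ : (fun y => _) = fun y => f i y + \sum_(j <- s) f j y); first exact: sdiffD.
by apply/funext => y; rewrite big_cons.
Qed.

(** The hypothesis on [h] is strict differentiability at [f x] with derivative [l]. *)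
Lemma sdiff_comp f L x (h : R -> R) (l : R) : sdiff f L x ->
  (forall e : R, 0 < e -> exists2 r : R, 0 < r & forall a b, `|a - f x| < r -> `|b - f x| < r ->
    `|h a - h b - l * (a - b)| <= e * `|a - b|) ->
  sdiff (h \o f) (l *: L) x.
Proof.
move=> fL hl e e0; have N0 := l1norm_ge0 L; have [r1 r10 h1] := sdiff_lip fL.
have d10 : 0 < e / 2 / (l1norm L + 1) by rewrite !divr_gt0//; lra.
have d20 : 0 < e / 2 / (`|l| + 1) by rewrite !divr_gt0//; have := normr_ge0 l; lra.
have [r2 r20 h2] := hl _ d10; have [r3 r30 h3] := fL _ d20.
have [r4 r40 h4] := sdiff_near fL r20.
exists (Num.min (Num.min r1 r3) r4); first by rewrite !lt_min r10 r30.
move=> y z; rewrite !lt_min => /andP[/andP[y1 y3] y4] /andP[/andP[z1 z3] z4] /=.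
have := h2 _ _ (h4 _ y4) (h4 _ z4); have := h3 _ _ y3 z3; have := h1 _ _ y1 z1.
rewrite dotrvZl; move: (dotrv _ _) (normr_ge0 (y - z)) => a; move: `|y - z| => c c0 H1 H3 H2.
have -> : h (f y) - h (f z) - l * a = (h (f y) - h (f z) - l * (f y - f z)) + l * (f y - f z - a).
  by ring.
apply: le_trans (ler_normD _ _) _.
have -> : e * c = e / 2 * c + e / 2 * c by field.
apply: lerD.
  apply: le_trans H2 _; apply: le_trans (ler_wpM2l (ltW d10) H1) _.
  by rewrite mulrA divfK// gt_eqF// ltr_wpDl.
rewrite normrM; apply: le_trans (ler_wpM2l (normr_ge0 _) H3) _.
rewrite mulrA ler_wpM2r// mulrCA -[leRHS]mulr1 ler_wpM2l//; first by rewrite divr_ge0// ltW.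
by rewrite ler_pdivrMr ?ltr_wpDl// mul1r lerDl.
Qed.

Lemma sdiff_is_derive f L x v (t : R) : sdiff f L (x + t *: v) ->
  is_derive t (1 : R) (fun t : R => f (x + t *: v)) (dotrv L v).
Proof.
move=> fL; have key : (fun h : R => h^-1 *: (((fun t : R => f (x + t *: v)) \o shift t) (h *: 1) -
    f (x + t *: v))) @ 0^' --> dotrv L v.
  apply/cvgrPdist_le => e e0; have v1 : 0 < `|v| + 1 by have := normr_ge0 v; lra.
  have e10 : 0 < e / (`|v| + 1) by rewrite divr_gt0.
  have [r r0 rf] := fL _ e10.
  have rv0 : 0 < r / (`|v| + 1) by rewrite divr_gt0.
  exists (r / (`|v| + 1)) => // h /=; rewrite sub0r normrN => hr h0.
  have hv : `|(x + (h *: 1 + t) *: v) - (x + t *: v)| = `|h| * `|v|.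
    by rewrite opprD addrACA subrr add0r -scalerBl addrK -normrZ; congr `|_ *: _|; exact: mulr1.
  have hv1 : `|h| * `|v| < r.
    apply: le_lt_trans (_ : `|h| * (`|v| + 1) < _); last by rewrite -ltr_pdivlMr.
    by rewrite ler_wpM2l//; lra.
  have := rf (x + (h *: 1 + t) *: v) (x + t *: v); rewrite hv subrr normr0 => /(_ hv1 r0).
  rewrite opprD addrACA subrr add0r -scalerBl addrK dotrvZr.
  have -> : h *: (1 : R) = h by exact: mulr1.
  move=> H; have hn0 : `|h| != 0 by rewrite normr_eq0.
  have -> : dotrv L v - h^-1 * (f (x + (h + t) *: v) - f (x + t *: v)) =
    - (h^-1 * (f (x + (h + t) *: v) - f (x + t *: v) - h * dotrv L v)) by field.
  rewrite normrN normrM normfV ler_pdivrMl ?normr_gt0//; apply: le_trans H _.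
  rewrite mulrCA ler_wpM2l// mulrAC ler_pdivrMr// ler_wpM2l//; lra.
by apply: DeriveDef; [apply/cvg_ex; exists (dotrv L v)|apply/cvg_lim].
Qed.

End StrictDifferentiability.

Section MeanValue.
Context {R : realType}.

Lemma mvt_sym (phi dphi : R -> R) (h : R) :
  (forall t : R, `|t| <= `|h| -> is_derive t (1 : R) phi (dphi t)) ->
  exists2 t : R, `|t| <= `|h| & phi h - phi 0 = dphi t * h.
Proof.
move=> dp; have [h0|h0|->] := ltgtP h 0; last by exists 0; rewrite ?normr0// subrr mulr0.
- have [| |t] := @MVT R phi dphi h 0 h0.
  + move=> t; rewrite in_itv /= => /andP[ht t0]; apply: dp.
    by rewrite !ltr0_norm//; lra.
  + apply: derivable_within_continuous => t; rewrite in_itv /= => /andP[ht t0].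
    by apply: ex_derive; apply: dp; rewrite (ltr0_norm h0) ler_norml; lra.
  + rewrite in_itv /= => /andP[ht t0] E; exists t; first by rewrite !ltr0_norm//; lra.
    by rewrite -opprB E; ring.
- have [| |t] := @MVT R phi dphi 0 h h0.
  + move=> t; rewrite in_itv /= => /andP[ht t0]; apply: dp.
    by rewrite !gtr0_norm//; lra.
  + apply: derivable_within_continuous => t; rewrite in_itv /= => /andP[ht t0].
    by apply: ex_derive; apply: dp; rewrite (gtr0_norm h0) ler_norml; lra.
  + rewrite in_itv /= => /andP[ht t0] E; exists t; first by rewrite !gtr0_norm//; lra.
    by rewrite E; ring.
Qed.

Lemma derivable_is_derive n (g : 'rV[R]_n -> R) w v (t : R) :
  derivable g (w + t *: v) v ->
  is_derive t (1 : R) (fun t : R => g (w + t *: v)) ('D_v g (w + t *: v)).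
Proof.
move=> dg.
have E : (fun h : R => h^-1 *: (((fun t : R => g (w + t *: v)) \o shift t) (h *: 1) - g (w + t *: v))) =
    fun h => h^-1 *: ((g \o shift (w + t *: v)) (h *: v) - g (w + t *: v)).
  apply/funext => h /=; congr (_ *: (g _ - _)).
  by rewrite [_%:A]mulr1 scalerDl addrCA.
by apply: DeriveDef; rewrite /derivable /derive E.
Qed.

(** The difference [g y - g z] is telescoped along a path that changes one coordinate at a time; on
    each leg the mean value theorem produces a partial derivative at a point close to [x]. Sup-norm
    balls are boxes, so the path stays in the ball. *)
Lemma sdiff_of_partials n (g : 'rV[R]_n -> R) (U : set 'rV[R]_n) x :
  open U -> U x ->
  (forall y i, U y -> derivable g y (delta_mx 0 i)) ->
  (forall i, {for x, continuous (fun y => 'D_(delta_mx 0 i) g y)}) ->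
  sdiff g (\row_i 'D_(delta_mx 0 i) g x) x.
Proof.
move=> oU Ux dg cg e e0; have [r0 r00 rU] := open_ballP oU Ux.
have e1 : 0 < e / n.+1%:R by rewrite divr_gt0.
have /choice[ri riP] i : exists r : R, 0 < r /\ forall y, `|y - x| < r ->
    `|'D_(delta_mx 0 i) g x - 'D_(delta_mx 0 i) g y| < e / n.+1%:R.
  by have [r ? ?] := continuous_at_rv (cg i) e1; exists r.
pose r := \big[Num.min/r0]_i ri i.
have r_gt0 : 0 < r by apply: lt_bigmin => // i _; case: (riP i).
have rr0 : r <= r0 by apply: bigmin_le_id.
have rri i : r <= ri i by apply: bigmin_le_cond.
exists r => // y z yr zr.
pose w k : 'rV[R]_n := \row_i if (i < k)%N then y 0 i else z 0 i.
have w0 : w 0%N = z by apply/rowP => i; rewrite mxE ltn0.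
have wn : w n = y by apply/rowP => i; rewrite mxE ltn_ord.
rewrite -{1}w0 -{1}wn -(telescope_sumr (fun k => g (w k)) (leq0n n)) big_mkord /dotrv.
rewrite -sumrB; apply: le_trans (ler_norm_sum _ _ _) _.
apply: (@le_trans _ _ (\sum_(k < n) e / n.+1%:R * `|y - z|)); last first.
  rewrite sumr_const card_ord -mulrnAl ler_wpM2r// -mulr_natr mulrAC ler_pdivrMr//.
  by rewrite ler_pM2l// ler_nat.
apply: ler_sum => k _; rewrite !mxE.
pose h := y 0 k - z 0 k.
have wS t : w k + t *: delta_mx 0 k =
    \row_i if (i < k)%N then y 0 i else z 0 i + (if i == k then t else 0).
  apply/rowP => i; rewrite !mxE eqxx /=; have [->|ik] := eqVneq i k; first by rewrite ltnn mulr1.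
  by rewrite mulr0 !addr0.
have wk1 : w k.+1 = w k + h *: delta_mx 0 k.
  apply/rowP => i; rewrite wS !mxE ltnS leq_eqVlt.
  have [/val_inj ->|ik] := eqVneq (val i) (val k); first by rewrite eqxx ltnn /h; ring.
  by rewrite (_ : (i == k) = false) ?addr0//; apply/negbTE; apply: contra ik => /eqP ->.
(* [t * h >= 0] and [|t| <= |h|] keep the [k]-th coordinate between [z 0 k] and [y 0 k]. *)
have wr t : `|t| <= `|h| -> t * h >= 0 -> `|w k + t *: delta_mx 0 k - x| < r.
  move=> th th0; apply/rv_norm_ltP => // i; rewrite wS !mxE.
  have yi := rv_norm_ltP _ r_gt0 yr i; have zi := rv_norm_ltP _ r_gt0 zr i.
  case: ifP => _; first by rewrite !mxE in yi.
  rewrite !mxE in yi zi; case: eqP => [ik|_]; last by rewrite addr0.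
  move: th th0 yi zi; rewrite ik /h; move: (y 0 k) (z 0 k) (x 0 k) => a b c.
  rewrite !ltr_norml.
  have [ab|ab|ab] := ltgtP 0 (a - b).
  + rewrite pmulr_lge0// (gtr0_norm ab) ler_norml; lra.
  + rewrite nmulr_lge0// (ltr0_norm ab) ler_norml; lra.
  + by rewrite -ab normr0 normr_le0 => /eqP ->; lra.
have [t [th thge tE]] : exists t : R, [/\ `|t| <= `|h|, t * h >= 0 &
    g (w k.+1) - g (w k) = 'D_(delta_mx 0 k) g (w k + t *: delta_mx 0 k) * h].
  pose phi t := g (w k + t *: delta_mx 0 k).
  have dphi t : `|t| <= `|h| -> t * h >= 0 ->
      is_derive t (1 : R) phi ('D_(delta_mx 0 k) g (w k + t *: delta_mx 0 k)).
    move=> th th0; apply: derivable_is_derive; apply: dg; apply: rU.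
    exact: lt_le_trans (wr _ th th0) rr0.
  have [h0|h0|h0] := ltgtP h 0.
  + have [| |t] := @MVT R phi (fun t => 'D_(delta_mx 0 k) g (w k + t *: delta_mx 0 k)) h 0 h0.
    * move=> t; rewrite in_itv /= => /andP[ht t0]; apply: dphi.
        by rewrite !ltr0_norm//; lra.
      by rewrite nmulr_lge0// ltW.
    * apply: derivable_within_continuous => t; rewrite in_itv /= => /andP[ht t0].
      apply: ex_derive; apply: dphi; first by rewrite (ltr0_norm h0) ler_norml; lra.
      by rewrite nmulr_lge0.
    * rewrite in_itv /= => /andP[ht t0] E; exists t; split; first by rewrite !ltr0_norm//; lra.
        by rewrite nmulr_lge0// ltW.
      by move: E; rewrite /phi scale0r addr0 -wk1 => E; rewrite -opprB E; ring.
  + have [| |t] := @MVT R phi (fun t => 'D_(delta_mx 0 k) g (w k + t *: delta_mx 0 k)) 0 h h0.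
    * move=> t; rewrite in_itv /= => /andP[ht t0]; apply: dphi.
        by rewrite !gtr0_norm//; lra.
      by rewrite pmulr_lge0// ltW.
    * apply: derivable_within_continuous => t; rewrite in_itv /= => /andP[ht t0].
      apply: ex_derive; apply: dphi; first by rewrite (gtr0_norm h0) ler_norml; lra.
      by rewrite pmulr_lge0.
    * rewrite in_itv /= => /andP[ht t0] E; exists t; split; first by rewrite !gtr0_norm//; lra.
        by rewrite pmulr_lge0// ltW.
      by move: E; rewrite /phi scale0r addr0 -wk1 => ->; ring.
  + exists 0; rewrite normr0 mul0r; split => //.
    by rewrite wk1 h0 scale0r addr0 subrr mulr0.
rewrite tE -/h -mulrBl normrM.
have := rv_coord_le (y - z) k; rewrite !mxE -/h => hyz.
apply: ler_pM => //; rewrite distrC ltW//; case: (riP k) => _; apply.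
exact: lt_le_trans (wr _ th thge) (rri k).
Qed.

End MeanValue.

(** * The Cheng-Yau function *)

Section SecondDifference.
Context {R : realType} {n : nat}.
Implicit Types (x u v L : 'rV[R]_n).

(** The mean value theorem in the direction [u] is applied to the difference of [f] on two parallel
    segments, and strict differentiability of the derivative along [u] evaluates the result. The
    second difference is symmetric in [u] and [v], which yields the symmetry of the Hessian. *)
Lemma second_difference (f : 'rV[R]_n -> R) (Gf : 'rV[R]_n -> 'rV[R]_n) x u v (r e h : R) L :
  0 <= h ->
  (forall y, `|y - x| < r -> sdiff f (Gf y) y) ->
  (forall y z, `|y - x| < r -> `|z - x| < r ->
    `|dotrv (Gf y) u - dotrv (Gf z) u - dotrv L (y - z)| <= e * `|y - z|) ->
  h * (`|u| + `|v|) < r ->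
  `|f (x + h *: u + h *: v) - f (x + h *: u) - f (x + h *: v) + f x - h * (h * dotrv L v)|
    <= h * (e * (h * `|v|)).
Proof.
move=> h0 fG pL hr.
have u0 := normr_ge0 u; have v0 := normr_ge0 v.
have b1 t : `|t| <= `|h| -> `|x + t *: u - x| < r.
  move=> th; rewrite addrAC subrr add0r normrZ; apply: le_lt_trans hr.
  apply: le_trans (ler_wpM2r u0 th) _; rewrite ger0_norm// ler_wpM2l//; lra.
have b2 t : `|t| <= `|h| -> `|x + h *: v + t *: u - x| < r.
  move=> th; have -> : x + h *: v + t *: u - x = h *: v + t *: u.
    by apply/rowP => k; rewrite !mxE; ring.
  apply: le_lt_trans hr.
  apply: le_trans (ler_normD _ _) _; rewrite !normrZ mulrDr addrC.
  by apply: lerD; [apply: le_trans (ler_wpM2r u0 th) _|]; rewrite ger0_norm.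
have [t th tE] := @mvt_sym R (fun t => f (x + h *: v + t *: u) - f (x + t *: u))
  (fun t => dotrv (Gf (x + h *: v + t *: u)) u - dotrv (Gf (x + t *: u)) u) h
  (fun t th => is_deriveB (sdiff_is_derive (fG _ (b2 t th))) (sdiff_is_derive (fG _ (b1 t th)))).
have := pL _ _ (b2 t th) (b1 t th).
have -> : x + h *: v + t *: u - (x + t *: u) = h *: v.
  by apply/rowP => k; rewrite !mxE; ring.
rewrite dotrvZr normrZ (ger0_norm h0).
move: tE; rewrite !scale0r !addr0 -[x + h *: u + h *: v]addrA [h *: u + _]addrC addrA.
move: (dotrv _ _ - dotrv _ _) => q.
move: (f (x + h *: v + h *: u)) (f (x + h *: u)) (f (x + h *: v)) (f x) => a b c a' E Q.
have -> : a - b - c + a' - h * (h * dotrv L v) = h * (q - h * dotrv L v).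
  by rewrite mulrBr [h * q]mulrC -E; ring.
by rewrite normrM ger0_norm// ler_wpM2l.
Qed.

Lemma norm_delta_le (i : 'I_n) : `|delta_mx 0 i : 'rV[R]_n| <= 1.
Proof.
apply/rv_norm_leP => // j; rewrite mxE /=.
by case: (j == i); rewrite ?normr1 ?normr0.
Qed.

End SecondDifference.

Lemma le0_of_small {R : realFieldType} (a K : R) : 0 <= K ->
  (forall e : R, 0 < e -> a <= e * K) -> a <= 0.
Proof.
move=> K0 h; rewrite leNgt; apply/negP => a0.
have K1 : 0 < 2 * (K + 1) by lra.
have := h (a / (2 * (K + 1))) (divr_gt0 a0 K1).
rewrite mulrAC ler_pdivlMr//; have : 0 <= a * K by rewrite mulr_ge0// ltW.
lra.
Qed.

Section ChengYauFunction.
Context {R : realType} {d : nat}.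
Variables (W : set 'rV[R]_d) (om : 'rV[R]_d -> R).
Hypotheses (oW : open W) (hom : cheng_yau W om).
Implicit Types (x y z u v : 'rV[R]_d).

Lemma om_lt0 y : W y -> om y < 0.
Proof. by case: hom => _ _ + _ _; exact. Qed.

Lemma om_sdiff y : W y -> sdiff om (grad om y) y.
Proof.
move=> Wy; case: hom => sm _ _ _ _.
apply: (@sdiff_of_partials R d om W y oW Wy) => [z i Wz|i].
  by have [_] := sm [::] z Wz; exact.
by have [] := sm [:: i] y Wy.
Qed.

Lemma dom_sdiff y i : W y -> sdiff (partials [:: i] om) (\row_k hess om y k i) y.
Proof.
move=> Wy; case: hom => sm _ _ _ _.
have -> : \row_k hess om y k i = \row_k 'D_(delta_mx 0 k) (partials [:: i] om) y.
  by apply/rowP => k; rewrite !mxE.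
apply: (@sdiff_of_partials R d _ W y oW Wy) => [z k Wz|k].
  by have [_] := sm [:: i] z Wz; exact.
by have [] := sm [:: k; i] y Wy.
Qed.

Lemma gradE y i : grad om y 0 i = partials [:: i] om y.
Proof. by rewrite mxE. Qed.

Lemma hess_sym y i j : W y -> hess om y i j = hess om y j i.
Proof.
move=> Wy; apply/eqP; rewrite -subr_eq0 -normr_le0.
apply: (@le0_of_small _ _ 2) => // e e0.
have [r0 r00 rW] := open_ballP oW Wy.
have [r1 r10 h1] := dom_sdiff i Wy e0; have [r2 r20 h2] := dom_sdiff j Wy e0.
pose r := Num.min r0 (Num.min r1 r2).
have rr0 : r <= r0 by rewrite ge_min lexx.
have rr1 : r <= r1 by rewrite !ge_min lexx orbT.
have rr2 : r <= r2 by rewrite !ge_min lexx !orbT.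
have rp : 0 < r by rewrite !lt_min r00 r10.
have dE z k : dotrv (grad om z) (delta_mx 0 k) = partials [:: k] om z.
  by rewrite dotrvC dotrv_delta gradE.
pose h := r / 4; have h0 : 0 < h by rewrite /h; lra.
have ni := norm_delta_le (R := R) i; have nj := norm_delta_le (R := R) j.
have hr a b : a <= 1 -> b <= 1 -> h * (a + b) < r.
  move=> a1 b1; apply: (@le_lt_trans _ _ (h * 2)); last by rewrite /h; lra.
  by rewrite ler_pM2l//; lra.
have G z : `|z - y| < r -> sdiff om (grad om z) z.
  by move=> zr; apply: om_sdiff; apply: rW; apply: lt_le_trans rr0.
have hp k rk z1 z2 : r <= rk -> (forall z1 z2, `|z1 - y| < rk -> `|z2 - y| < rk ->
    `|partials [:: k] om z1 - partials [:: k] om z2 - dotrv (\row_l hess om y l k) (z1 - z2)|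
      <= e * `|z1 - z2|) -> `|z1 - y| < r -> `|z2 - y| < r ->
    `|dotrv (grad om z1) (delta_mx 0 k) - dotrv (grad om z2) (delta_mx 0 k)
      - dotrv (\row_l hess om y l k) (z1 - z2)| <= e * `|z1 - z2|.
  by move=> rk_le hk z1r z2r; rewrite !dE; apply: hk; apply: lt_le_trans rk_le.
have E1 := second_difference (u := delta_mx 0 i) (v := delta_mx 0 j) (ltW h0) G
  (fun z1 z2 => hp i r1 z1 z2 rr1 h1) (hr _ _ ni nj).
have E2 := second_difference (u := delta_mx 0 j) (v := delta_mx 0 i) (ltW h0) G
  (fun z1 z2 => hp j r2 z1 z2 rr2 h2) (hr _ _ nj ni).
move: E1 E2; rewrite !(dotrvC (\row_k _)) !dotrv_delta !mxE.
rewrite [y + h *: delta_mx 0 j + _]addrAC.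
set a := om (y + h *: delta_mx 0 i + h *: delta_mx 0 j); set b := om (y + h *: delta_mx 0 i).
set c := om (y + h *: delta_mx 0 j); set a' := om y.
have B k : `|delta_mx 0 k : 'rV[R]_d| <= 1 -> h * (e * (h * `|delta_mx 0 k : 'rV[R]_d|)) <= h * h * e.
  move=> k1; rewrite -mulrA ler_pM2l// mulrCA ler_pM2l// ger_pMr//.
move=> /le_trans/(_ (B _ nj)) E1 /le_trans/(_ (B _ ni)) E2.
have hh : 0 < h * h by rewrite mulr_gt0.
rewrite -(ler_pM2l hh) -{1}(gtr0_norm hh) -normrM.
set p := partials [:: i; j] om y; set p' := partials [:: j; i] om y; move: E1 E2.
rewrite (_ : a - c - b + a' = a - b - c + a'); last by ring.
move: (a - b - c + a') => D E1 E2.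
rewrite (_ : h * h * (p - p') = (D - h * (h * p')) - (D - h * (h * p))); last by ring.
apply: le_trans (ler_normB _ _) _; apply: le_trans (lerD E1 E2) _.
by rewrite le_eqVlt; apply/orP; left; apply/eqP; ring.
Qed.


Lemma tangent_below y z : W y -> W z -> om y + dotrv (grad om y) (z - y) <= om z.
Proof.
move=> Wy Wz; have [_ /convex_functionP cf _ _ _] := hom.
rewrite -subr_le0; apply: (@le0_of_small _ _ `|z - y|) => // e e0.
have [r r0 rf] := om_sdiff Wy e0.
have v0 := normr_ge0 (z - y); pose t := Num.min 1 (r / (`|z - y| + 1)).
have t0 : 0 < t by rewrite lt_min ltr01 divr_gt0//; lra.
have t1 : t <= 1 by rewrite ge_min lexx.
have tr : t * `|z - y| < r.
  have : t <= r / (`|z - y| + 1) by rewrite ge_min lexx orbT.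
  by rewrite ler_pdivlMr; lra.
have := cf z y t; rewrite (ltW t0) t1 => /(_ isT Wz Wy).
have -> : t *: z + (1 - t) *: y = y + t *: (z - y).
  by apply/rowP => k; rewrite !mxE; ring.
have := rf (y + t *: (z - y)) y; rewrite subrr normr0 addrAC subrr add0r normrZ (gtr0_norm t0).
move=> /(_ tr r0); rewrite dotrvZr ler_norml => /andP[] + _.
move: (dotrv _ _) (om (y + _)) => D F h1 h2.
rewrite -(ler_pM2l t0); move: h1 h2; lra.
Qed.

Lemma grad_monotone y z : W y -> W z ->
  0 <= dotrv (grad om z - grad om y) (z - y).
Proof.
move=> Wy Wz; have := tangent_below Wy Wz; have := tangent_below Wz Wy.
by rewrite -(opprB z y) dotrvNr dotrvBl; lra.
Qed.

Definition quad (H : 'M[R]_d) v : R := dotrv v (v *m H).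

Lemma grad_expansion y v e : W y -> 0 < e -> exists2 r : R, 0 < r &
  forall t : R, 0 <= t -> t < r -> W (y + t *: v) /\
   `|dotrv (grad om (y + t *: v) - grad om y) v - t * quad (hess om y) v| <= t * e.
Proof.
move=> Wy e0; have [r0 r00 rW] := open_ballP oW Wy.
have K0 : 0 < l1norm v * `|v| + 1 by rewrite ltr_wpDl// mulr_ge0// l1norm_ge0.
have e1 : 0 < e / (l1norm v * `|v| + 1) by rewrite divr_gt0.
have /choice[ri riP] i : exists r : R, 0 < r /\ forall z1 z2, `|z1 - y| < r -> `|z2 - y| < r ->
    `|partials [:: i] om z1 - partials [:: i] om z2 - dotrv (\row_l hess om y l i) (z1 - z2)|
      <= e / (l1norm v * `|v| + 1) * `|z1 - z2|.
  by have [r ? ?] := dom_sdiff i Wy e1; exists r.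
pose r := \big[Num.min/r0]_i ri i.
have r_gt0 : 0 < r by apply: lt_bigmin => // i _; case: (riP i).
have rr0 : r <= r0 by apply: bigmin_le_id.
have rri i : r <= ri i by apply: bigmin_le_cond.
have v0 := normr_ge0 v; exists (r / (`|v| + 1)); first by rewrite divr_gt0//; lra.
move=> t t0; rewrite ltr_pdivlMr; last by lra.
move=> tr; have tv : `|y + t *: v - y| < r.
  rewrite addrAC subrr add0r normrZ ger0_norm//.
  by apply: le_lt_trans tr; rewrite ler_wpM2l//; lra.
split; first by apply: rW; apply: lt_le_trans rr0.
have -> : t * quad (hess om y) v = \sum_i dotrv (\row_l hess om y l i) (t *: v) * v 0 i.
  rewrite /quad mulr_sumr; apply: eq_bigr => i _.
  have -> : dotrv (\row_l hess om y l i) (t *: v) = t * (v *m hess om y) 0 i.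
    rewrite dotrvZr; congr (_ * _); rewrite [RHS]mxE; apply: eq_bigr => l _.
    by rewrite [in LHS]mxE mulrC.
  by rewrite mulrA mulrAC.
rewrite dotrvBl /dotrv -!sumrB; apply: le_trans (ler_norm_sum _ _ _) _.
apply: (@le_trans _ _ (\sum_i e / (l1norm v * `|v| + 1) * (t * `|v|) * `|v 0 i|)).
  apply: ler_sum => i _; rewrite -!mulrBl normrM ler_wpM2r// !gradE.
  have := proj2 (riP i) (y + t *: v) y; rewrite subrr normr0 => /(_ _ (proj1 (riP i))).
  move=> /(_ (lt_le_trans tv (rri i))).
  have -> : y + t *: v - y = t *: v by rewrite addrAC subrr add0r.
  by rewrite normrZ ger0_norm.
rewrite -mulr_sumr -/(l1norm v).
have -> : e / (l1norm v * `|v| + 1) * (t * `|v|) * l1norm v =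
  t * e * ((l1norm v * `|v|) / (l1norm v * `|v| + 1)) by field; rewrite gt_eqF.
have q1 : l1norm v * `|v| / (l1norm v * `|v| + 1) <= 1.
  by rewrite ler_pdivrMr//; lra.
by rewrite -[leRHS]mulr1 ler_wpM2l// mulr_ge0// ltW.
Qed.

Lemma hess_psd y v : W y -> 0 <= quad (hess om y) v.
Proof.
move=> Wy; rewrite -oppr_le0; apply: (@le0_of_small _ _ 1) => // e e0.
have [r r0 rf] := grad_expansion v Wy e0.
have r20 : 0 < r / 2 by lra.
have [|Wt] := rf (r / 2) (ltW r20); first by lra.
have := grad_monotone Wy Wt; rewrite [y + _ - y]addrAC subrr add0r dotrvZr pmulr_rge0//.
rewrite mulr1 ler_norml => D0 /andP[_ h]; rewrite -(ler_pM2l r20); move: D0 h; lra.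
Qed.

Lemma quadD (H : 'M[R]_d) u v (t : R) : (forall i j, H i j = H j i) ->
  quad H (v + t *: u) = quad H v + 2 * t * dotrv u (v *m H) + t ^+ 2 * quad H u.
Proof.
move=> Hs; have sym : dotrv v (u *m H) = dotrv u (v *m H).
  rewrite /dotrv (eq_bigr (fun i => \sum_j v 0 i * u 0 j * H j i)); last first.
    by move=> i _; rewrite mxE mulr_sumr; apply: eq_bigr => j _; rewrite mulrA.
  rewrite exchange_big; apply: eq_bigr => j _; rewrite mxE mulr_sumr; apply: eq_bigr => i _.
  by rewrite Hs; ring.
rewrite /quad mulmxDl -scalemxAl !(dotrvDl, dotrvDr, dotrvZl, dotrvZr) sym; ring.
Qed.

(** An isotropic vector of a positive semidefinite form lies in its kernel, and the Monge-Ampere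
    equation makes the Hessian invertible. *)
Lemma hess_pos y v : W y -> v != 0 -> 0 < quad (hess om y) v.
Proof.
move=> Wy v0; rewrite lt_neqAle hess_psd// andbT eq_sym; apply/eqP => q0.
have Hv u : dotrv u (v *m hess om y) = 0.
  pose b := dotrv u (v *m hess om y); pose q := quad (hess om y) u.
  have h t : 0 <= 2 * t * b + t ^+ 2 * q.
    have := hess_psd (v + t *: u) Wy; rewrite quadD; last by move=> i j; exact: hess_sym.
    by rewrite q0 add0r.
  have q_ge0 : 0 <= q by exact: hess_psd.
  (* This [t] makes [2 t b + t^2 q] equal to [- (b / (q + 1))^2 (q + 2)]; the denominator [q + 1]
     also covers [q = 0]. *)
  have := h (- b / (q + 1)); have q1 : q + 1 != 0 by rewrite gt_eqF//; lra.
  have -> : 2 * (- b / (q + 1)) * b + (- b / (q + 1)) ^+ 2 * q =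
    - (b / (q + 1)) ^+ 2 * (q + 2) by field.
  rewrite mulNr oppr_ge0 => hb; have : (b / (q + 1)) ^+ 2 * (q + 2) == 0.
    by rewrite eq_le hb mulr_ge0 ?sqr_ge0//; lra.
  have q2 : q + 2 != 0 by rewrite gt_eqF//; lra.
  by rewrite mulf_eq0 sqrf_eq0 mulf_eq0 invr_eq0 (negbTE q1) (negbTE q2) !orbF => /eqP.
have vH : v *m hess om y = 0 by apply: dotrv_eq0.
have [_ _ _ /(_ _ Wy) dH _] := hom.
have Hu : hess om y \in unitmx.
  by rewrite unitmxE unitfE dH invr_eq0 expf_neq0// oppr_eq0 lt_eqF// om_lt0.
by move/eqP: v0; apply; rewrite -(mulmxK Hu v) vH mul0mx.
Qed.

(** Equality at [z], together with the tangents at [y] and at [y + t (z - y)], would prevent the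
    slope along [z - y] from increasing, whereas by [hess_pos] it increases by at least half of
    [t * quad]. *)
Lemma tangent_below_lt y z : W y -> W z -> z != y ->
  om y + dotrv (grad om y) (z - y) < om z.
Proof.
move=> Wy Wz zy; rewrite lt_neqAle tangent_below// andbT; apply/eqP => E.
have v0 : z - y != 0 by rewrite subr_eq0.
have q0 := hess_pos Wy v0; have q20 : 0 < quad (hess om y) (z - y) / 2 by lra.
have [r r0 rf] := grad_expansion (z - y) Wy q20.
pose t := Num.min (1 / 2) (r / 2).
have t0 : 0 < t by rewrite lt_min; apply/andP; split; lra.
have t1 : t <= 1 / 2 by rewrite ge_min lexx.
have tr : t < r by apply: (@le_lt_trans _ _ (r / 2)); [rewrite ge_min lexx orbT|lra].
have [Wt] := rf t (ltW t0) tr; rewrite ler_norml dotrvBl => /andP[+ _].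
have h1 := tangent_below Wt Wz; have h2 := tangent_below Wy Wt.
move: h1 h2; rewrite -E (_ : z - (y + t *: (z - y)) = (1 - t) *: (z - y)); last first.
  by apply/rowP => k; rewrite !mxE; ring.
rewrite addrAC subrr add0r !dotrvZr.
have tq : 0 < t * quad (hess om y) (z - y) by rewrite mulr_gt0.
move: (dotrv _ _) (dotrv _ _) => a b h1 h2 h3.
have : (1 - t) * (b - a) <= 0 by lra.
rewrite pmulr_rle0; last by lra.
by move: h3 tq; lra.
Qed.

End ChengYauFunction.

(** * Touching by multiples of the Cheng-Yau function *)

Section Clusters.
Context {R : realType} {n : nat}.

Lemma compact_cball (M : R) : compact [set x : 'rV[R]_n | `|x| <= M].
Proof.
apply: bounded_closed_compact.
  exists M; split; first exact: num_real.
  by move=> N MN x /= xM; apply: le_trans xM (ltW MN).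
have /continuous_closedP h : continuous (fun x : 'rV[R]_n => `|x|) by exact: norm_continuous.
exact: (h _ (@closed_le R M)).
Qed.

(** The indices run through an infinite set [A], so that it can be applied to a subsequence
    violating an expected limit. *)
Lemma bounded_cluster (P : nat -> 'rV[R]_n) (A : set nat) (M : R) :
  (forall N, exists2 k, (N <= k)%N & A k) -> (forall k, A k -> `|P k| <= M) ->
  exists q, forall (e : R) N, 0 < e -> exists k, [/\ (N <= k)%N, A k & `|P k - q| < e].
Proof.
move=> Ainf PM.
have /choice[phi phiP] N : exists k, (N <= k)%N /\ A k.
  by have [k ? ?] := Ainf N; exists k.
have [|q [_ cq]] := @compact_cball M (P \o phi @ \oo) _.
  by exists 0%N => // N _ /=; apply: PM; case: (phiP N).
exists q => e N e0.
have [||x [[k Nk <-] /rv_ballP qx]] := cq [set P (phi k) | k in [set k | (N <= k)%N]] (ball q e).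
- by exists N => // k /= Nk; exists k.
- exact: nbhsx_ballx.
exists (phi k); split; [|by case: (phiP k)|by rewrite distrC].
by apply: leq_trans Nk _; case: (phiP k).
Qed.

End Clusters.

Section Touch.
Context {R : realType} {d : nat}.
Implicit Types (u om : 'rV[R]_d -> R) (y z : 'rV[R]_d) (X : 'rV[R]_d.+1).

Definition lform y X : R := dotrv y (rinit X) - rlast X.

Definition gap u y X : R := u y - lform y X.

(* Equivalently, X = p + s N(y) for a boundary point p of the gap domain with
   supporting direction y: see touch_contact and contact_touch. *)
Definition touch (W : set 'rV[R]_d) om u X y (s : R) :=
  [/\ W y, 0 < s, gap u y X + s * om y = 0 &
      forall z, W z -> 0 <= gap u z X + s * om z].

Definition gap_domain (W : set 'rV[R]_d) u : set 'rV[R]_d.+1 :=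
  [set X | exists2 c : R, 0 < c & forall y, W y -> c <= gap u y X].

Definition convex_on (W : set 'rV[R]_d) u := forall x y (t : R), 0 <= t <= 1 ->
  W x -> W y -> u (t *: x + (1 - t) *: y) <= t * u x + (1 - t) * u y.

Definition lsc_on (W : set 'rV[R]_d) u := forall y (e : R), W y -> 0 < e ->
  exists2 r : R, 0 < r & forall z, W z -> `|z - y| < r -> u y - e <= u z.

Lemma lformBr y X Y : lform y (X - Y) = lform y X - lform y Y.
Proof. by rewrite /lform rinitB rlastB dotrvBr; ring. Qed.

Lemma lformBl y z X : lform y X - lform z X = dotrv (y - z) (rinit X).
Proof. by rewrite /lform dotrvBl; ring. Qed.

Lemma lform_le y X : `|lform y X| <= (l1norm y + 1) * `|X|.
Proof.
rewrite /lform mulrDl mul1r; apply: le_trans (ler_normB _ _) _; apply: lerD.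
  apply: le_trans (dotrv_le _ _) _; apply: ler_wpM2l; first exact: l1norm_ge0.
  exact: rinit_norm_le.
exact: rlast_norm_le.
Qed.

Lemma lform_convex y z X (t : R) :
  lform (t *: y + (1 - t) *: z) X = t * lform y X + (1 - t) * lform z X.
Proof. by rewrite /lform dotrvDl !dotrvZl; ring. Qed.

End Touch.

Section TouchTheory.
Context {R : realType} {d : nat}.
Variables (W : set 'rV[R]_d) (om : 'rV[R]_d -> R) (y0 : 'rV[R]_d) (MW : R).
Hypotheses (oW : open W) (cW : convex_set W) (hom : cheng_yau W om).
Hypotheses (Wy0 : W y0) (WM : forall y, W y -> `|y| <= MW).
Implicit Types (u : 'rV[R]_d -> R) (y z : 'rV[R]_d) (X : 'rV[R]_d.+1).

(** The tangent of [om] at [y0] is affine, hence bounded on the bounded set [W]. *)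
Lemma om_ge : exists2 M : R, 0 < M & forall y, W y -> - M <= om y.
Proof.
have N0 := l1norm_ge0 (grad om y0); have MW0 := le_trans (normr_ge0 _) (WM Wy0).
have om0 := om_lt0 hom Wy0.
exists (- om y0 + l1norm (grad om y0) * (MW + MW) + 1).
  have : 0 <= l1norm (grad om y0) * (MW + MW) by rewrite mulr_ge0// addr_ge0.
  by lra.
move=> y Wy; have := tangent_below oW hom Wy0 Wy.
have := dotrv_le (grad om y0) (y - y0).
have : l1norm (grad om y0) * `|y - y0| <= l1norm (grad om y0) * (MW + MW).
  apply: ler_wpM2l => //; apply: le_trans (ler_normB _ _) _.
  by apply: lerD; exact: WM.
rewrite ler_norml; lra.
Qed.

Lemma om_within y : closure W y -> forall e : R, 0 < e -> exists2 r : R, 0 < r &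
  forall z, closure W z -> `|z - y| < r -> `|om z - om y| < e.
Proof.
case: hom => _ _ _ _ [/subspace_continuousP h _] Wy e e0.
have /cvgrPdist_lt/(_ _ e0) := h _ Wy.
move=> /nbhs_ballP[r /= r0 rh]; exists r => // z Wz zy.
by rewrite distrC; apply: rh => //; apply/rv_ballP; rewrite distrC.
Qed.

(** The boundary value 0 keeps limits of touching points inside [W]: it is enough that [om] stays
    away from 0 along the sequence. *)
Lemma om_boundary y : closure W y -> om y < 0 -> W y.
Proof.
case: hom => _ _ _ _ [_ h] cy oy; apply: contrapT => nW.
by rewrite (h _ cy nW) ltxx in oy.
Qed.

(** Since [om < 0], raising [s] lowers [gap + s om] everywhere, so only one [s] gives it the minimum
    0. For this [s] two zeros are impossible: by strict convexity of [om] the function would be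
    negative at their midpoint. *)
Lemma touch_unique u X y s y' s' : convex_on W u ->
  touch W om u X y s -> touch W om u X y' s' -> y = y' /\ s = s'.
Proof.
move=> cu [Wy s0 E h] [Wy' s'0 E' h'].
have le_s a b (t t' : R) : W a -> W b -> gap u a X + t * om a = 0 ->
    0 <= gap u a X + t' * om a -> t' <= t.
  move=> Wa Wb Ea ha; rewrite leNgt; apply/negP => tt'.
  have : (t' - t) * om a < 0 by rewrite pmulr_rlt0 ?subr_gt0// (om_lt0 hom).
  by lra.
have ss' : s = s'.
  by apply/eqP; rewrite eq_le (le_s y' y s' s)//; [rewrite (le_s y y' s s')//; exact: h'|exact: h].
split=> //; subst s'; apply/eqP/negPn/negP => yy'.
pose m := (1 / 2 : R) *: y + (1 - 1 / 2 : R) *: y'.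
have half : 0 <= (1 / 2 : R) <= 1 by lra.
have Wm : W m by exact: (convex_setP cW half Wy Wy').
have um := cu _ _ _ half Wy Wy'; have lm := lform_convex y y' X (1 / 2).
have ym : y - m = (1 / 2 : R) *: (y - y') by apply/rowP => k; rewrite !mxE; field.
have y'm : y' - m = - ((1 / 2 : R) *: (y - y')) by apply/rowP => k; rewrite !mxE; field.
have yn : y != m.
  by rewrite -subr_eq0 ym scaler_eq0 negb_or subr_eq0 yy' andbT; apply/eqP; lra.
have := tangent_below_lt oW hom Wm Wy yn; have := tangent_below oW hom Wm Wy'.
rewrite ym y'm dotrvNr => o1 o2; have om2 : om m < (om y + om y') / 2 by lra.
have := h _ Wm; rewrite /gap lm -/m; rewrite -/m in um.
move: E E'; rewrite /gap.
have : s * om m < s * ((om y + om y') / 2) by rewrite ltr_pM2l.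
by lra.
Qed.

(* Any cluster point of approximate touching pairs for (u_k, X_k) touches the
   limit (u, X); the lower bound on the gaps keeps the pairs away from the
   boundary of W. *)
Section Limit.
Variables (u : 'rV[R]_d -> R) (X : 'rV[R]_d.+1).
Variables (uk : nat -> 'rV[R]_d -> R) (Xk : nat -> 'rV[R]_d.+1).
Variables (yk : nat -> 'rV[R]_d) (sk ek : nat -> R).
Hypothesis uk_le : forall y (e : R), W y -> 0 < e ->
  exists N, forall k, (N <= k)%N -> uk k y <= u y + e.
Hypothesis uk_ge : forall y (e : R), W y -> 0 < e -> exists2 r : R, 0 < r &
  exists N, forall k z, (N <= k)%N -> W z -> `|z - y| < r -> u y - e <= uk k z.
Hypothesis Xk_cvg : forall e : R, 0 < e -> exists N, forall k, (N <= k)%N -> `|Xk k - X| < e.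
Hypothesis ek_cvg : forall e : R, 0 < e -> exists N, forall k, (N <= k)%N -> ek k < e.
Variables (c : R) (N0 : nat).
Hypothesis c0 : 0 < c.
Hypothesis gap_ge : forall k z, (N0 <= k)%N -> W z -> c <= gap (uk k) z (Xk k).
Hypothesis sk0 : forall k, (N0 <= k)%N -> 0 < sk k.
Hypothesis Wyk : forall k, (N0 <= k)%N -> W (yk k).
Hypothesis hk : forall k z, (N0 <= k)%N -> W z -> 0 <= gap (uk k) z (Xk k) + sk k * om z.
Hypothesis Ek : forall k, (N0 <= k)%N -> gap (uk k) (yk k) (Xk k) + sk k * om (yk k) <= ek k.

(** Nonnegativity at the single point [y0], where [om y0 < 0], bounds [sk]. *)
Lemma sk_le : exists2 S : R, 0 < S & exists N, forall k, (N <= k)%N -> sk k <= S.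
Proof.
have [N1 h1] := uk_le Wy0 ltr01; have [N2 h2] := Xk_cvg ltr01.
have o0 := om_lt0 hom Wy0; have oN : 0 < - om y0 by lra.
pose B := `|u y0 + 1 - lform y0 X + (l1norm y0 + 1)| + 1.
have B0 : 0 < B by rewrite /B; have := normr_ge0 (u y0 + 1 - lform y0 X + (l1norm y0 + 1)); lra.
exists (B / - om y0); first exact: divr_gt0.
exists (maxn N0 (maxn N1 N2)) => k; rewrite !geq_max => /andP[k0 /andP[k1 k2]].
rewrite ler_pdivlMr//; have := hk k0 Wy0; have := h1 _ k1; have := ltW (h2 _ k2).
have : `|lform y0 (Xk k - X)| <= l1norm y0 + 1 -> lform y0 X - (l1norm y0 + 1) <= lform y0 (Xk k).
  by rewrite lformBr ler_norml; lra.
have l0 := l1norm_ge0 y0.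
move=> H /(ler_wpM2l (_ : 0 <= l1norm y0 + 1))/= H1; have {}H1 := H1 (ltW (ltr_wpDl l0 ltr01)).
rewrite mulr1 in H1; have {H}H := H (le_trans (lform_le _ _) H1).
have := ler_norm (u y0 + 1 - lform y0 X + (l1norm y0 + 1)); rewrite /gap /B; lra.
Qed.

Lemma touch_cluster (A : set nat) : (forall N, exists2 k, (N <= k)%N & A k) ->
  exists y s, touch W om u X y s /\ forall (e : R) N, 0 < e ->
    exists k, [/\ (N <= k)%N, A k, `|yk k - y| < e & `|sk k - s| < e].
Proof.
move=> Ainf; have [S S0 [N1 h1]] := sk_le; have [M M0 hM] := om_ge.
have c20 : 0 < c / 2 by rewrite divr_gt0.
have [N2 h2] := ek_cvg c20.
pose N3 := maxn N0 (maxn N1 N2).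
have l0 k : (N3 <= k)%N -> (N0 <= k)%N by rewrite geq_max => /andP[].
have l1 k : (N3 <= k)%N -> (N1 <= k)%N by rewrite !geq_max => /and3P[].
have l2 k : (N3 <= k)%N -> (N2 <= k)%N by rewrite !geq_max => /and3P[].
(* From a gap of at least [c] and an error below [c / 2]. As [sk] and [- om] are both bounded above,
   this keeps [om (yk k)] and [sk k] away from 0. *)
have so k : (N3 <= k)%N -> c / 2 <= sk k * - om (yk k).
  move=> k3; have := Ek (l0 _ k3); have := h2 _ (l2 _ k3).
  have := gap_ge (l0 _ k3) (Wyk (l0 _ k3)); lra.
have oy k : (N3 <= k)%N -> om (yk k) <= - (c / 2 / S).
  move=> k3; rewrite lerNr ler_pdivrMr//; apply: le_trans (so k k3) _; rewrite mulrC.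
  apply: ler_wpM2l; [have := om_lt0 hom (Wyk (l0 _ k3)); lra|exact: h1 (l1 _ k3)].
have sge k : (N3 <= k)%N -> c / 2 / M <= sk k.
  move=> k3; rewrite ler_pdivrMr//; apply: le_trans (so k k3) _.
  apply: ler_wpM2l; first exact: ltW (sk0 (l0 _ k3)).
  by have := hM _ (Wyk (l0 _ k3)); lra.
pose P k := snoc (yk k) (sk k).
have [||q hq] := @bounded_cluster R d.+1 P (A `&` [set k | (N3 <= k)%N]) (Num.max MW S).
- move=> N; have [k + Ak] := Ainf (maxn N N3); rewrite geq_max => /andP[k1 k2].
  by exists k.
- move=> k [_ /= k3]; have S0' := ltW S0.
  rewrite snoc_norm_le; last by rewrite le_max S0' orbT.
  have := WM (Wyk (l0 _ k3)); have := h1 _ (l1 _ k3); have := sk0 (l0 _ k3).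
  by rewrite !le_max => sp sS ->; rewrite gtr0_norm// sS orbT.
pose y := rinit q; pose s := rlast q.
have {}hq (e : R) N : 0 < e -> exists k, [/\ (N <= k)%N, (N3 <= k)%N, A k, `|yk k - y| < e & `|sk k - s| < e].
  move=> e0; have [k [Nk [Ak k3] qk]] := hq e N e0; exists k.
  have : `|P k - snoc y s| < e by rewrite snoc_rinit.
  by rewrite snocB snoc_norm_lt// => /andP[].
have cy : closure W y.
  move=> B /nbhs_ballP[e /= e0 eB]; have [k [_ k3 _ ky _]] := hq e 0%N e0.
  exists (yk k); split; first exact: Wyk (l0 _ k3).
  by apply: eB; apply/rv_ballP; rewrite distrC.
have cWW z : W z -> closure W z by exact: subset_closure.
have cS0 : 0 < c / 2 / S by rewrite divr_gt0.
have Wy : W y.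
  apply: om_boundary => //; have [r r0 hr] := om_within cy cS0.
  have [k [_ k3 _ ky _]] := hq r 0%N r0.
  have := hr _ (cWW _ (Wyk (l0 _ k3))) ky; have := oy _ k3; rewrite ltr_norml; lra.
have cM0 : 0 < c / 2 / M by rewrite divr_gt0.
have s0 : 0 < s.
  have [k [_ k3 _ _ ks]] := hq _ 0%N cM0; have := sge _ k3; move: ks; rewrite ltr_norml; lra.
have hall z : W z -> 0 <= gap u z X + s * om z.
  move=> Wz; rewrite -oppr_le0; apply: (@le0_of_small _ _ (1 + (l1norm z + 1) + `|om z|)).
    by rewrite !addr_ge0// l1norm_ge0.
  move=> e e0; have [N4 h4] := uk_le Wz e0; have [N5 h5] := Xk_cvg e0.
  have [k [+ k3 _ _ ks]] := hq e (maxn N4 N5) e0; rewrite geq_max => /andP[k4 k5].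
  have := hk (l0 _ k3) Wz; have := h4 _ k4.
  have := lform_le z (Xk k - X); rewrite lformBr.
  have : (l1norm z + 1) * `|Xk k - X| <= (l1norm z + 1) * e.
    by apply: ler_wpM2l; [have := l1norm_ge0 z; lra|exact: ltW (h5 _ k5)].
  have : `|(sk k - s) * om z| <= e * `|om z| by rewrite normrM ler_wpM2r// ltW.
  rewrite /gap !ler_norml; lra.
exists y, s; split; last first.
  by move=> e N e0; have [k [? ? ? ? ?]] := hq e N e0; exists k.
split => //; apply/eqP; rewrite eq_le hall// andbT.
have MW0 : 0 <= MW by apply: le_trans (WM Wy0).
(* The summands are the errors per unit of [e]: 2 for [uk] and [ek], then the shift of [Xk], the
   move of [yk] inside [lform], and the two changes in [s * om]. *)
apply: (@le0_of_small _ _ (2 + (d%:R * MW + 1) + l1norm (rinit X) + S + `|om y|)).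
  by rewrite !addr_ge0 ?l1norm_ge0 ?mulr_ge0// ltW.
move=> e e0; have [r1 r10 [N4 h4]] := uk_ge Wy e0; have [N5 h5] := Xk_cvg e0.
have [r2 r20 h6] := om_within cy e0; have [N7 h7] := ek_cvg e0.
have r0 : 0 < Num.min (Num.min r1 r2) e by rewrite !lt_min r10 r20.
have [k [+ k3 _]] := hq _ (maxn N4 (maxn N5 N7)) r0.
rewrite !geq_max => /and3P[k4 k5 k7]; rewrite !lt_min => /andP[/andP[y1 y2] y3] /andP[_ s3].
have Wk := Wyk (l0 _ k3).
have := h4 _ _ k4 Wk y1; have := Ek (l0 _ k3); have := h7 _ k7.
have B1 : `|lform (yk k) (Xk k - X)| <= (d%:R * MW + 1) * e.
  apply: le_trans (lform_le _ _) _; apply: ler_pM => //; last exact: ltW (h5 _ k5).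
    by rewrite addr_ge0// l1norm_ge0.
  rewrite lerD2r; apply: le_trans (l1norm_le _) _; rewrite ler_wpM2l//; exact: WM.
have B2 : `|lform (yk k) X - lform y X| <= l1norm (rinit X) * e.
  rewrite lformBl dotrvC; apply: le_trans (dotrv_le _ _) _.
  by rewrite ler_wpM2l ?l1norm_ge0// ltW.
have B3 : `|sk k * (om (yk k) - om y)| <= S * e.
  rewrite normrM ler_pM//; last exact: ltW (h6 _ (cWW _ Wk) y2).
  rewrite gtr0_norm; [exact: h1 (l1 _ k3)|exact: sk0 (l0 _ k3)].
have B4 : `|(sk k - s) * om y| <= e * `|om y| by rewrite normrM ler_wpM2r// ltW.
move: B1 B2 B3 B4; rewrite lformBr /gap !ler_norml; lra.
Qed.

(** A subsequence staying away from [(y, s)] would cluster at another touching pair, against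
    [touch_unique]. *)
Lemma touch_cvg y s : convex_on W u -> touch W om u X y s ->
  forall e : R, 0 < e -> exists N, forall k, (N <= k)%N -> `|yk k - y| < e /\ `|sk k - s| < e.
Proof.
move=> cu tys e e0; apply: contrapT => /forallNP h.
have Ainf N : exists2 k, (N <= k)%N & (~ (`|yk k - y| < e /\ `|sk k - s| < e)).
  by have /existsNP[k /not_implyP[? ?]] := h N; exists k.
have [y' [s' [t' hc]]] := touch_cluster Ainf.
have [ey es] := touch_unique cu tys t'; subst y' s'.
by have [k [_ nk yk1 sk1]] := hc e 0%N e0; apply: nk.
Qed.

End Limit.

End TouchTheory.

Section TouchSets.
Context {R : realType} {d : nat}.
Variables (W : set 'rV[R]_d) (om : 'rV[R]_d -> R) (y0 : 'rV[R]_d) (MW : R).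
Hypotheses (oW : open W) (cW : convex_set W) (hom : cheng_yau W om).
Hypotheses (Wy0 : W y0) (WM : forall y, W y -> `|y| <= MW).
Implicit Types (u : 'rV[R]_d -> R) (y z : 'rV[R]_d) (X p : 'rV[R]_d.+1).

Definition nsphere y : 'rV[R]_d.+1 :=
  snoc (grad om y) (dotrv (grad om y) y - om y).

Definition contact u y p := W y /\ gap u y p = 0 /\ forall z, W z -> 0 <= gap u z p.

Lemma lform_nsphere y z : lform z (nsphere y) = om y + dotrv (grad om y) (z - y).
Proof. by rewrite /lform rinit_snoc rlast_snoc dotrvBr dotrvC; ring. Qed.

(** Lying below [om < 0] gives no uniform bound near the boundary, where [om] tends to 0. Outside a
    ball around [y] strict convexity helps: [om] exceeds its tangent by a constant on the sphere,
    and by convexity at least as much further out. *)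
Lemma tangent_lt0 y : W y -> exists2 c : R, 0 < c &
  forall z, W z -> om y + dotrv (grad om y) (z - y) <= - c.
Proof.
move=> Wy; have [r r0 rW] := open_ballP oW Wy.
pose B := [set z : 'rV[R]_d | `|z - y| <= r / 2].
have BW z : B z -> W z by move=> zy; apply: rW; apply: le_lt_trans zy _; lra.
have cB : compact B.
  apply: bounded_closed_compact.
    exists (`|y| + r / 2); split; first exact: num_real.
    move=> N MN z /= zB; have := ler_normD (z - y) y; rewrite subrK.
    by move: zB; rewrite /B /=; lra.
  have /continuous_closedP h : continuous (fun x : 'rV[R]_d => `|x - y|).
    move=> x; apply: rv_continuous_at => e e0; exists e => // w wx.
    apply: le_lt_trans (ler_dist_dist _ _) _.
    by rewrite (_ : x - y - (w - y) = x - w) ?[`|x - w|]distrC//; apply/rowP => i; rewrite !mxE; ring.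
  exact: (h _ (@closed_le R (r / 2))).
have By : B y by rewrite /B /= subrr normr0; lra.
pose h z := om y + dotrv (grad om y) (z - y).
have hle z : W z -> h z <= om z by exact: tangent_below.
have hcont : continuous h.
  move=> z; apply: (@sdiff_continuous _ _ _ (0 + grad om y)).
  apply: sdiffD; first exact: sdiff_cst.
  move=> e e0; exists 1 => // a b _ _.
  by rewrite -dotrvBr opprB addrA subrK subrr normr0 mulr_ge0// ltW.
pose g z := om z - h z.
have gcont : {within B, continuous g}.
  apply/subspace_continuousP => z Bz; apply: cvg_within_filter.
  rewrite /g; apply: cvgB; first exact: (sdiff_continuous (om_sdiff oW hom (BW _ Bz))).
  exact: hcont.
have omcont : {within B, continuous (fun z => - om z)}.
  apply/subspace_continuousP => z Bz; apply: cvg_within_filter.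
  by apply: cvgN; exact: (sdiff_continuous (om_sdiff oW hom (BW _ Bz))).
have [z1 Bz1 h1] : exists2 z1, B z1 & forall z, B z -> - om z1 <= - om z.
  have [z1 + h1] := compact_EVT_min (ex_intro _ _ By) cB omcont; rewrite inE => Bz1.
  by exists z1 => // z Bz; apply: h1; rewrite inE.
have [S0|/set0P[w0 Sw0]] := eqVneq (B `&` [set z | r / 2 <= `|z - y|]) set0.
  exists (- om z1); first by have := om_lt0 hom (BW _ Bz1); lra.
  move=> z Wz; rewrite opprK.
  (* an empty sphere forces W to be the single point y *)
  have [->|zy] := eqVneq z y; first by rewrite subrr dotrv0r addr0; have := h1 _ By; lra.
  exfalso; have n0 : 0 < `|z - y| by rewrite normr_gt0 subr_eq0.
  have : (B `&` [set z | r / 2 <= `|z - y|]) (y + (r / 2 / `|z - y|) *: (z - y)).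
    have E : `|y + (r / 2 / `|z - y|) *: (z - y) - y| = r / 2.
      rewrite addrAC subrr add0r normrZ gtr0_norm ?divfK ?gt_eqF//.
      by rewrite !divr_gt0.
    by split; rewrite /B /= E.
  by rewrite S0.
have cS : compact (B `&` [set z | r / 2 <= `|z - y|]).
  apply: compact_closedI => //.
  have /continuous_closedP hh : continuous (fun x : 'rV[R]_d => `|x - y|).
    move=> x; apply: rv_continuous_at => e e0; exists e => // w wx.
    apply: le_lt_trans (ler_dist_dist _ _) _.
    by rewrite (_ : x - y - (w - y) = x - w) ?[`|x - w|]distrC//; apply/rowP => i; rewrite !mxE; ring.
  exact: (hh _ (@closed_ge R (r / 2))).
have gS : {within (B `&` [set z | r / 2 <= `|z - y|]), continuous g}.
  by apply: continuous_subspaceW gcont => z [].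
have [z2 [Bz2 /= z2r] h2] : exists2 z2, (B `&` [set z | r / 2 <= `|z - y|]) z2 &
    forall z, B z -> r / 2 <= `|z - y| -> g z2 <= g z.
  have [z2 + h2] := compact_EVT_min (ex_intro _ _ Sw0) cS gS; rewrite inE => Bz2.
  by exists z2 => // z Bz zr; apply: h2; rewrite inE.
have z2y : z2 != y by apply: contraTneq z2r => ->; rewrite subrr normr0 -ltNge; lra.
have g2 : 0 < g z2.
  by have := tangent_below_lt oW hom Wy (BW _ Bz2) z2y; rewrite /g /h; lra.
pose c := Num.min (- om z1) (g z2).
have om1 : 0 < - om z1 by have := om_lt0 hom (BW _ Bz1); lra.
exists c; first by rewrite lt_min om1.
move=> z Wz; rewrite -/(h z).
have [zB|zB] := leP `|z - y| (r / 2).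
  have := hle _ Wz; have := h1 z zB; have : c <= - om z1 by rewrite ge_min lexx.
  by lra.
have n0 : 0 < `|z - y| by apply: lt_trans zB; lra.
pose t := r / 2 / `|z - y|.
have t0 : 0 < t by rewrite !divr_gt0.
have t1 : t < 1 by rewrite ltr_pdivrMr// mul1r.
have ht : 0 <= t <= 1 by lra.
have wE : t *: z + (1 - t) *: y = y + t *: (z - y) by apply/rowP => i; rewrite !mxE; ring.
have Ew : `|y + t *: (z - y) - y| = r / 2.
  by rewrite addrAC subrr add0r normrZ gtr0_norm ?divfK ?gt_eqF.
have := h2 (y + t *: (z - y)); rewrite /B /= Ew lexx => /(_ isT isT) g3.
have [_ /convex_functionP cf _ _ _] := hom.
have := cf z y t ht Wz Wy; rewrite wE => cf1.
have cg : c <= g z2 by rewrite ge_min lexx orbT.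
(* [g] is convex along the ray from [y] and vanishes at [y]. *)
have tg : g (y + t *: (z - y)) <= t * g z.
  rewrite /g /h [y + t *: _ - y]addrAC subrr add0r dotrvZr; move: cf1; lra.
have oz := om_lt0 hom Wz.
have : c <= t * g z by lra.
have c0 : 0 < c by rewrite lt_min om1.
move=> ctg; have gz : 0 < g z by rewrite -(pmulr_rgt0 _ t0); lra.
have : t * g z <= g z by rewrite ger_pMl// ltW.
by move: ctg; rewrite /g; lra.
Qed.

(** [gap + s om] is minimal at [y] with value 0; as the gap is convex and [om] differentiable,
    [- s grad om y] is a subgradient of the gap at [y]. *)
Lemma touch_subgrad u X y s z : convex_on W u -> touch W om u X y s -> W z ->
  - (s * (om y + dotrv (grad om y) (z - y))) <= gap u z X.
Proof.
move=> cu [Wy s0 E h] Wz; rewrite -subr_le0.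
apply: (@le0_of_small _ _ (s * `|z - y|)); first by rewrite mulr_ge0// ltW.
move=> e e0; have [r r0 rf] := om_sdiff oW hom Wy e0.
have v0 := normr_ge0 (z - y); pose t := Num.min 1 (r / (`|z - y| + 1)).
have t0 : 0 < t by rewrite lt_min ltr01 divr_gt0//; lra.
have t1 : t <= 1 by rewrite ge_min lexx.
have tr : t * `|z - y| < r.
  have : t <= r / (`|z - y| + 1) by rewrite ge_min lexx orbT.
  by rewrite ler_pdivlMr; lra.
have ht : 0 <= t <= 1 by rewrite (ltW t0) t1.
have wE : t *: z + (1 - t) *: y = y + t *: (z - y) by apply/rowP => i; rewrite !mxE; ring.
have := cu _ _ _ ht Wz Wy; have := lform_convex z y X t.
have := h _ (convex_setP cW ht Wz Wy); rewrite wE.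
have := rf (y + t *: (z - y)) y; rewrite subrr normr0 [y + t *: _ - y]addrAC subrr add0r.
rewrite normrZ (gtr0_norm t0) => /(_ tr r0); rewrite dotrvZr ler_norml => /andP[_].
move: E; rewrite /gap; move: (dotrv _ _) (om (y + _)) (u (y + _)) (lform (y + _) _).
move=> D o1 u1 l1 E h1 h2 E2 h3; rewrite E2 in h2; rewrite -(ler_pM2l t0).
have : s * (o1 - om y - t * D) <= s * (e * (t * `|z - y|)) by rewrite ler_pM2l.
have : (1 - t) * (u y - lform y X + s * om y) = 0 by rewrite E mulr0.
move: h2 h3; move: (lform y X) (lform z X) => ly lz; lra.
Qed.

(** Moving [X] by [- s N(y)] adds to the gap at [z] exactly [s] times the tangent of [om] at [y],
    and [touch_subgrad] makes the sum nonnegative. *)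
Lemma touch_contact u X y s : convex_on W u -> touch W om u X y s ->
  contact u y (X - s *: nsphere y).
Proof.
move=> cu t; have [Wy s0 E h] := t.
have gE z : gap u z (X - s *: nsphere y) = gap u z X + s * (om y + dotrv (grad om y) (z - y)).
  rewrite /gap lformBr -lform_nsphere /lform.
  rewrite (_ : rinit (s *: nsphere y) = s *: rinit (nsphere y)); last by apply/rowP => i; rewrite !mxE.
  rewrite (_ : rlast (s *: nsphere y) = s * rlast (nsphere y)); last by rewrite /rlast !mxE.
  by rewrite dotrvZr; ring.
split => //; split; first by rewrite gE subrr dotrv0r addr0.
by move=> z Wz; rewrite gE; have := touch_subgrad cu t Wz; lra.
Qed.

Lemma contact_touch u y p (s : R) : 0 < s -> contact u y p ->
  touch W om u (p + s *: nsphere y) y s.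
Proof.
move=> s0 [Wy [E h]].
have gE z : gap u z (p + s *: nsphere y) = gap u z p - s * (om y + dotrv (grad om y) (z - y)).
  rewrite -(opprK (s *: nsphere y)) /gap lformBr -scaleNr -lform_nsphere /lform.
  rewrite (_ : rinit (- s *: nsphere y) = - s *: rinit (nsphere y)); last by apply/rowP => i; rewrite !mxE.
  rewrite (_ : rlast (- s *: nsphere y) = - s * rlast (nsphere y)); last by rewrite /rlast !mxE.
  by rewrite dotrvZr; ring.
split => //; first by rewrite gE E subrr dotrv0r; ring.
move=> z Wz; rewrite gE.
have := h _ Wz; have := tangent_below oW hom Wy Wz.
by rewrite -(ler_pM2l s0) mulrDr; lra.
Qed.

Lemma touch_gap_domain u X y s : convex_on W u -> touch W om u X y s ->
  gap_domain W u X.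
Proof.
move=> cu t; have [Wy s0 _ _] := t; have [c c0 hc] := tangent_lt0 Wy.
exists (s * c); first exact: mulr_gt0.
move=> z Wz; apply: le_trans (touch_subgrad cu t Wz).
by rewrite -mulrN ler_pM2l// lerNr; exact: hc.
Qed.

Lemma gap_domain_near u X : gap_domain W u X -> exists2 c : R, 0 < c &
  exists2 r : R, 0 < r & forall Z, `|Z - X| < r -> forall y, W y -> c <= gap u y Z.
Proof.
move=> [c c0 hc]; have MW0 := le_trans (normr_ge0 _) (WM Wy0).
have K0 : 0 < d%:R * MW + 1 by rewrite ltr_wpDl// mulr_ge0.
exists (c / 2); first by rewrite divr_gt0.
exists (c / 2 / (d%:R * MW + 1)); first by rewrite !divr_gt0.
move=> Z; rewrite ltr_pdivlMr// => ZX y Wy; have := hc _ Wy.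
have := lform_le y (Z - X); rewrite lformBr.
have : (l1norm y + 1) * `|Z - X| <= `|Z - X| * (d%:R * MW + 1).
  rewrite mulrC ler_wpM2l// lerD2r; apply: le_trans (l1norm_le _) _.
  by rewrite ler_wpM2l// WM.
rewrite /gap ler_norml; lra.
Qed.

Lemma open_gap_domain u : open (gap_domain W u).
Proof.
apply: ballP_open => X /gap_domain_near[c c0 [r r0 h]]; exists r => // Z ZX.
by exists c => // y Wy; exact: h.
Qed.

(** [s] is the largest multiple with [gap + s om >= 0], the infimum of [gap / (- om)]. A minimising
    sequence consists of approximate touching pairs for this fixed [s], so [touch_cluster] applies
    with constant [u] and [X]. *)
Lemma touch_exists u X : lsc_on W u -> gap_domain W u X -> exists y s, touch W om u X y s.
Proof.
move=> lu [c c0 hc].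
pose Q := [set gap u y X / - om y | y in W].
have omN y : W y -> 0 < - om y by move=> /(om_lt0 hom); lra.
have Q0 : has_inf Q.
  split; first by exists (gap u y0 X / - om y0), y0.
  exists 0 => _ [y Wy <-]; apply: divr_ge0; last exact: ltW (omN _ Wy).
  by have := hc _ Wy; lra.
pose s := inf Q; have [M M0 hM] := om_ge oW hom Wy0 WM.
have s0 : 0 < s.
  apply: (@lt_le_trans _ _ (c / M)); first by rewrite divr_gt0.
  apply: lb_le_inf; first by case: Q0.
  move=> _ [y Wy <-]; rewrite ler_pdivlMr ?omN// mulrAC ler_pdivrMr//.
  by apply: ler_pM; [lra|exact: ltW (omN _ Wy)|exact: hc|have := hM _ Wy; lra].
have hs z : W z -> 0 <= gap u z X + s * om z.
  move=> Wz; have : s <= gap u z X / - om z by apply: inf_lbound; [case: Q0|exists z].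
  by rewrite ler_pdivlMr ?omN//; lra.
have /choice[yk ykP] (k : nat) : exists y, W y /\ gap u y X + s * om y <= M / k.+1%:R.
  have k0 : (0 : R) < k.+1%:R^-1 by rewrite invr_gt0.
  have [_ [y Wy <-] hy] := inf_adherent k0 Q0; exists y; split => //.
  move: hy; rewrite -/s ltr_pdivrMr ?omN// mulrDl => /ltW hy.
  have : k.+1%:R^-1 * - om y <= k.+1%:R^-1 * M.
    by rewrite ler_pM2l//; have := hM _ Wy; lra.
  by rewrite [M / _]mulrC; move: hy; move: (_^-1) (om y) (gap _ _ _) => q o g; lra.
have [||||||||| |y [s' [t _]]] := @touch_cluster R d W om y0 MW oW hom Wy0 WM u X (fun=> u) (fun=> X) yk
   (fun=> s) (fun k => M / k.+1%:R) _ _ _ _ c 0 c0 _ _ _ _ _ setT.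
- by move=> y e _ e0; exists 0%N => k _; lra.
- move=> y e Wy e0; have [r r0 hr] := lu _ _ Wy e0; exists r => //; exists 0%N => k z _ Wz zy.
  exact: hr.
- by move=> e e0; exists 0%N => k _; rewrite subrr normr0.
- move=> e e0; exists (Num.truncn (M / e)) => k Nk; rewrite ltr_pdivrMr// mulrC -ltr_pdivrMr//.
  have /andP[_ h] := truncn_itv (ltW (divr_gt0 M0 e0)); apply: lt_le_trans h _.
  by rewrite ler_nat ltnS.
- by move=> k z _; exact: hc.
- by [].
- by move=> k _; case: (ykP k).
- by move=> k z _; exact: hs.
- by move=> k _; case: (ykP k).
- by move=> N; exists N.
by exists y, s'.
Qed.

(** A sequence of points tending to [X] whose pairs stay away from [(y, s)] contradicts [touch_cvg]
    with constant [u]. *)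
Lemma touch_continuous u X y s : convex_on W u -> lsc_on W u -> touch W om u X y s ->
  forall e : R, 0 < e -> exists2 r : R, 0 < r & forall Z, `|Z - X| < r ->
    gap_domain W u Z /\ forall y' s', touch W om u Z y' s' -> `|y' - y| < e /\ `|s' - s| < e.
Proof.
move=> cu lu t e e0.
have [c c0 [r r0 hr]] := gap_domain_near (touch_gap_domain cu t).
apply: contrapT => nh.
have /choice[p pP] (k : nat) : exists p : 'rV[R]_d.+1 * 'rV[R]_d * R,
    [/\ `|p.1.1 - X| < Num.min r k.+1%:R^-1, touch W om u p.1.1 p.1.2 p.2 &
        ~ (`|p.1.2 - y| < e /\ `|p.2 - s| < e)].
  apply: contrapT => /forallNP np; apply: nh.
  exists (Num.min r k.+1%:R^-1); first by rewrite lt_min r0 invr_gt0 ltr0Sn.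
  move=> Z Zr; split.
    by exists c => // z Wz; apply: hr => //; move: Zr; rewrite lt_min => /andP[].
  by move=> y' s' t'; apply: contrapT => nn; apply: (np ((Z, y'), s')).
have [|||||||||N hN] := @touch_cvg R d W om y0 MW oW cW hom Wy0 WM u X (fun=> u) (fun k => (p k).1.1)
   (fun k => (p k).1.2) (fun k => (p k).2) (fun=> 0) _ _ _ _ c 0 c0 _ _ _ _ _ y s cu t e e0.
- by move=> z e' _ e'0; exists 0%N => k _; lra.
- move=> z e' Wz e'0; have [r' r'0 hr'] := lu _ _ Wz e'0; exists r' => //; exists 0%N => k w _ Ww wz.
  exact: hr'.
- move=> e' e'0; exists (Num.truncn e'^-1) => k Nk; have [+ _ _] := pP k; rewrite lt_min => /andP[_ h].
  apply: lt_trans h _; rewrite invf_plt ?posrE//.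
  have e'1 : 0 <= e'^-1 by rewrite invr_ge0 ltW.
  have /andP[_ h] := truncn_itv e'1; apply: lt_le_trans h _.
  by rewrite ler_nat ltnS.
- by move=> e' e'0; exists 0%N.
- move=> k z _ Wz; have [+ _ _] := pP k; rewrite lt_min => /andP[h _]; exact: hr.
- by move=> k _; case: (pP k) => _ [_ ? _ _] _.
- by move=> k _; case: (pP k) => _ [? _ _ _] _.
- by move=> k z _ Wz; case: (pP k) => _ [_ _ _ h] _; exact: h.
- by move=> k _; case: (pP k) => _ [_ _ -> _] _.
by have [_ _ nn] := pP N; apply: nn; exact: hN.
Qed.

Definition touchset u (B : set ('rV[R]_d * R)) : set 'rV[R]_d.+1 :=
  [set X | exists y s, touch W om u X y s /\ B (y, s)].

End TouchSets.

(** Packs a countably additive set function as a measure, for use under existential quantifiers. *)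
Lemma measure_exists d (T : measurableType d) (R : realType) (f : set T -> \bar R) :
  f set0 = 0%E -> (forall A, 0 <= f A)%E -> semi_sigma_additive f ->
  exists mu : {measure set T -> \bar R}, forall A, mu A = f A.
Proof.
move=> f0 fge0 fs.
pose H := isMeasure.Build d T R f f0 fge0 fs.
pose mu : {measure set T -> \bar R} := HB.pack f H.
by exists mu.
Qed.

(** * Borel measurability of the touching pair *)

Section TouchMeasurable.
Context {R : realType} {d : nat}.
Variables (W : set 'rV[R]_d) (om : 'rV[R]_d -> R) (y0 : 'rV[R]_d) (MW : R).
Hypotheses (oW : open W) (cW : convex_set W) (hom : cheng_yau W om).
Hypotheses (Wy0 : W y0) (WM : forall y, W y -> `|y| <= MW).
Variable (u : 'rV[R]_d -> R).
Hypotheses (cu : convex_on W u) (lu : lsc_on W u).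
Notation Y := (borelRn R d * measurableTypeR R)%type.
Notation tset := (touchset W om u).

(** The touching pair of [X]; the default [(0, 0)] occurs exactly outside the gap domain when [u] is
    convex and lower semicontinuous. *)
Definition foot (X : borelRn R d.+1) : Y :=
  xget (0, 0) [set p : Y | touch W om u X p.1 p.2].

Lemma footP X y s : touch W om u X y s -> foot X = (y, s).
Proof.
move=> t; rewrite /foot; case: xgetP => [p _ /= tp|/(_ (y, s))/(_ t)//].
by have [e1 e2] := touch_unique oW cW hom cu tp t; rewrite [p]surjective_pairing e1 e2.
Qed.

Lemma foot_out X : ~ gap_domain W u X -> foot X = (0, 0).
Proof.
move=> nD; rewrite /foot; case: xgetP => // p _ /= tp.
by exfalso; apply: nD; exact: (touch_gap_domain oW cW hom cu tp).
Qed.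

Lemma touchsetE (B : set Y) : tset B = gap_domain W u `&` foot @^-1` B.
Proof.
apply/seteqP; split=> [X [y [s [t Bys]]]|X [DX BX]].
  by split; [exact: (touch_gap_domain oW cW hom cu t)|rewrite /preimage /= (footP t)].
have [y [s t]] := touch_exists oW hom Wy0 WM lu DX.
by exists y, s; split=> //; rewrite -(footP t).
Qed.

Lemma open_touchset (B : set Y) :
  (forall y s, B (y, s) -> exists2 e : R, 0 < e & forall y' s',
     `|(y' : 'rV[R]_d) - y| < e -> `|s' - s| < e -> B (y', s')) -> open (tset B).
Proof.
move=> oB; apply: ballP_open => X [y [s [t Bys]]].
have [e e0 he] := oB _ _ Bys.
have [r r0 hr] := touch_continuous oW cW hom Wy0 WM cu lu t e0.
exists r => // Z /hr[DZ hZ].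
have [y' [s' t']] := touch_exists oW hom Wy0 WM lu DZ.
by exists y', s'; split => //; have [? ?] := hZ _ _ t'; exact: he.
Qed.

Lemma gap_domain_borel : measurable (gap_domain W u : set (borelRn R d.+1)).
Proof. by apply: open_borel; exact: (open_gap_domain Wy0 WM). Qed.

Lemma measurable_foot : measurable_fun setT foot.
Proof.
have m1 : measurable_fun setT (fst \o foot : borelRn R d.+1 -> borelRn R d).
  apply: borel_measurable_fun => U oU.
  (* Outside the gap domain [foot] takes its default value, so the preimage gains the complement of
     that domain exactly when [U] contains 0. *)
  have -> : (fst \o foot) @^-1` U = tset (U `*` setT) `|`
      (if `[< U 0 >] then ~` gap_domain W u else set0).
    rewrite touchsetE; apply/seteqP; split => X /=.
      have [DX|nDX] := pselect (gap_domain W u X); first by left.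
      by rewrite foot_out//= => U0; right; case: asboolP.
    case=> [[_ [? _]]//|]; case: asboolP => // U0 nDX.
    by rewrite foot_out.
  apply: measurableU; last by case: ifP => _ //; apply: measurableC; exact: gap_domain_borel.
  apply: open_borel; apply: open_touchset => y s [/= Uy _].
  by have [r r0 hr] := open_ballP oU Uy; exists r => // y' s' h _; split=> //; exact: hr.
have m2 : measurable_fun setT (snd \o foot : borelRn R d.+1 -> measurableTypeR R).
  apply: real_measurable_fun => U oU.
  have -> : (snd \o foot) @^-1` U = tset (setT `*` U) `|`
      (if `[< U 0 >] then ~` gap_domain W u else set0).
    rewrite touchsetE; apply/seteqP; split => X /=.
      have [DX|nDX] := pselect (gap_domain W u X); first by left.
      by rewrite foot_out//= => U0; right; case: asboolP.
    case=> [[_ [_ ?]]//|]; case: asboolP => // U0 nDX.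
    by rewrite foot_out.
  apply: measurableU; last by case: ifP => _ //; apply: measurableC; exact: gap_domain_borel.
  apply: open_borel; apply: open_touchset => y s [/= _ Us].
  have /nbhs_ballP[r /= r0 hr] := open_nbhs_nbhs (conj oU Us).
  by exists r => // y' s' _ h; split=> //; apply: hr; rewrite /ball /= distrC.
have := measurable_fun_pair m1 m2; congr measurable_fun.
by apply/funext => X /=; rewrite -surjective_pairing.
Qed.

Lemma measurable_touchset (B : set Y) : measurable B ->
  measurable (tset B : set (borelRn R d.+1)).
Proof.
move=> mB; rewrite touchsetE; apply: measurableI; first exact: gap_domain_borel.
by rewrite -[X in measurable X]setTI; exact: measurable_foot.
Qed.

Lemma touchset_bigcup (F : nat -> set Y) : tset (\bigcup_k F k) = \bigcup_k tset (F k).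
Proof.
apply/seteqP; split=> [X [y [s [t [k _ Fk]]]]|X [k _ [y [s [t Fk]]]]].
  by exists k => //; exists y, s.
by exists y, s; split => //; exists k.
Qed.

Lemma touchset_disjoint (F : nat -> set Y) : trivIset setT F -> trivIset setT (fun k => tset (F k)).
Proof.
move=> /trivIsetP tF; apply/trivIsetP => i j _ _ ij; apply/seteqP; split => // X.
case=> [[y [s [t Fi]]] [y' [s' [t' Fj]]]].
have [e1 e2] := touch_unique oW cW hom cu t t'; subst y' s'.
by have : (F i `&` F j) (y, s) by []; rewrite tF.
Qed.

(** Disjoint sets of pairs have disjoint touch sets because the pair is unique. *)
Lemma touch_measure_exists : exists mu : {measure set Y -> \bar R},
  forall B, mu B = lebn d.+1 (tset B).
Proof.
apply: measure_exists; [|by move=> A; exact: lebn_ge0|].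
  by rewrite (_ : tset set0 = set0) ?lebn0//; apply/seteqP; split => // X [y [s []]].
move=> F mF tF mUF; rewrite touchset_bigcup.
have mT k := measurable_touchset (mF k).
apply: (@measure_semi_sigma_additive _ _ _ (leb d.+1) (fun k => tset (F k)) mT).
  exact: touchset_disjoint.
exact: bigcupT_measurable.
Qed.

End TouchMeasurable.

(** * The Steiner formula for smooth support functions *)

Section LocalVolume.
Context {R : realType} {m : nat}.
Notation n := m.+1.
Implicit Types (L : 'M[R]_n) (Y Z : 'rV[R]_n).

Lemma sdiff_vector (Psi : 'rV[R]_n -> 'rV[R]_n) L Z0 :
  (forall j, sdiff (fun Z => Psi Z 0 j) (\row_i L i j) Z0) ->
  forall e : R, 0 < e -> exists2 r : R, 0 < r & forall Y Z, `|Y - Z0| < r -> `|Z - Z0| < r ->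
    `|Psi Y - Psi Z - (Y - Z) *m L| <= e * `|Y - Z|.
Proof.
move=> h e e0.
have /choice[ri riP] j : exists r : R, 0 < r /\ forall Y Z, `|Y - Z0| < r -> `|Z - Z0| < r ->
    `|Psi Y 0 j - Psi Z 0 j - dotrv (\row_i L i j) (Y - Z)| <= e * `|Y - Z|.
  by have [r ? ?] := h j _ e0; exists r.
pose r := \big[Num.min/1]_j ri j.
have r_gt0 : 0 < r by apply: lt_bigmin => // i _; case: (riP i).
have rri i : r <= ri i by apply: bigmin_le_cond.
exists r => // Y Z Yr Zr; apply/rv_norm_leP; first by rewrite mulr_ge0// ltW.
move=> j; have [_ hj] := riP j.
have := hj Y Z (lt_le_trans Yr (rri j)) (lt_le_trans Zr (rri j)).
rewrite !mxE; congr (`|_ - _| <= _); rewrite dotrvC; apply: eq_bigr => i _.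
by rewrite !mxE.
Qed.

Lemma expr_near1 k (eta : R) : 0 < eta -> exists2 e : R, 0 < e <= 1 / 2 & (1 + 2 * e) ^+ k <= 1 + eta.
Proof.
move=> eta0; pose p : {poly R} := (1 + 2 *: 'X) ^+ k.
have pE h : p.[h] = (1 + 2 * h) ^+ k by rewrite /p horner_exp !hornerE.
have /cvgr_distC_lt/(_ _ eta0) : p.[h] @[h --> (0:R)] --> p.[0] by exact: continuous_horner.
move=> /nbhs_ballP[d /= d0 dp]; exists (Num.min (1 / 2) (d / 2)).
  by rewrite ge_min lexx lt_min andbT; apply/andP; split; lra.
have : ball 0 d (Num.min (1 / 2) (d / 2)).
  have m0 : 0 < Num.min (1 / 2) (d / 2) by rewrite lt_min; apply/andP; split; lra.
  rewrite /ball /= sub0r normrN gtr0_norm//.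
  by apply: (@le_lt_trans _ _ (d / 2)); [rewrite ge_min lexx orbT|lra].
by move=> /dp /=; rewrite !pE mulr0 addr0 expr1n ltr_norml; lra.
Qed.

(** [Psi] followed by [invmx L] differs from the identity by an [e]-Lipschitz map on a small ball,
    so it is injective there and Lipschitz in both directions with constant [1 + 2 e]; the factor
    [|det L|] comes from [lebn_mulmx_le] for [L] and for its inverse. *)
Lemma local_volume (Psi : 'rV[R]_n -> 'rV[R]_n) L Z0 (eta : R) :
  L \in unitmx -> 0 < eta -> (forall j, sdiff (fun Z => Psi Z 0 j) (\row_i L i j) Z0) ->
  exists2 r : R, 0 < r & forall E : set 'rV[R]_n, (forall Z, E Z -> `|Z - Z0| < r) ->
    (lebn n (Psi @` E) <= ((1 + eta) * `|\det L|)%:E * lebn n E)%E /\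
    (`|\det L|%:E * lebn n E <= (1 + eta)%:E * lebn n (Psi @` E))%E.
Proof.
move=> Lu eta0 hPsi; have [e /andP[e0 e1] eE] := expr_near1 n eta0.
pose c := \sum_i \sum_j `|(invmx L) i j| + 1.
have c0 : 0 < c by rewrite ltr_wpDl// sumr_ge0// => i _; rewrite sumr_ge0.
have hc j : \sum_i `|(invmx L) i j| <= c.
  apply: (@le_trans _ _ (\sum_j \sum_i `|(invmx L) i j|)).
    rewrite [leRHS](bigD1 j)//= lerDl; apply: sumr_ge0 => k _; exact: sumr_ge0.
  by rewrite exchange_big /c lerDl.
have ec : 0 < e / c by rewrite divr_gt0.
have [r r0 hr] := sdiff_vector hPsi ec; exists r => // E Er.
pose T Z := Psi Z *m invmx L.
have TE Y Z : E Y -> E Z -> `|T Y - T Z - (Y - Z)| <= e * `|Y - Z|.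
  move=> EY EZ; have := hr _ _ (Er _ EY) (Er _ EZ).
  have -> : T Y - T Z - (Y - Z) = (Psi Y - Psi Z - (Y - Z) *m L) *m invmx L.
    by rewrite mulmxBl mulmxK// mulmxBl.
  move=> h; apply: le_trans (norm_mulmx_le _ hc) _.
  by rewrite mulrC -ler_pdivlMr//; apply: le_trans h _; rewrite mulrAC.
(* [1 + 2 e] dominates both [1 + e] and [1 / (1 - e)], as [e <= 1 / 2]. *)
pose k := 1 + 2 * e; have k0 : 0 < k by rewrite /k; lra.
have T1 Y Z : E Y -> E Z -> `|T Y - T Z| <= k * `|Y - Z|.
  move=> EY EZ; have := TE _ _ EY EZ; have := ler_normD (T Y - T Z - (Y - Z)) (Y - Z).
  rewrite subrK /k; have : 0 <= e * `|Y - Z| by rewrite mulr_ge0// ltW.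
  by move: (`|Y - Z|) (`|T Y - T Z|) (`|_ - _ - _|) => a b c'; lra.
have T2 Y Z : E Y -> E Z -> `|Y - Z| <= k * `|T Y - T Z|.
  move=> EY EZ; have := TE _ _ EY EZ; have := ler_normB (T Y - T Z) (T Y - T Z - (Y - Z)).
  rewrite opprB addrC subrK /k; move: (normr_ge0 (Y - Z)).
  move: (`|Y - Z|) (`|T Y - T Z|) (`|_ - _ - _|) => a b c' a0 h1 h2.
  have h3 : (1 - e) * a <= b by lra.
  have : (1 + 2 * e) * ((1 - e) * a) <= (1 + 2 * e) * b by rewrite ler_wpM2l//; lra.
  have : 0 <= e * (1 - 2 * e) * a by rewrite !mulr_ge0//; lra.
  by lra.
have PsiT : Psi @` E = mulmx^~ L @` (T @` E).
  apply/seteqP; split=> [_ [Z EZ <-]|_ [_ [Z EZ <-] <-]].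
    by exists (T Z); [exists Z|rewrite /T mulmxKV].
  by exists Z => //; rewrite /T mulmxKV.
have TPsi : T @` E = mulmx^~ (invmx L) @` (Psi @` E).
  by apply/seteqP; split=> [_ [Z EZ <-]|_ [_ [Z EZ <-] <-]]; [exists (Psi Z) => //; exists Z|exists Z].
have kn : k ^+ n <= 1 + eta by [].
have dL : 0 < `|\det L| by rewrite normr_gt0 -unitfE -unitmxE.
split.
  rewrite PsiT; apply: le_trans (lebn_mulmx_le _ Lu) _.
  rewrite [((1 + eta) * _)%R]mulrC EFinM -muleA; apply: lee_wpmul2l; first by rewrite lee_fin.
  apply: le_trans (lebn_lipschitz _ k0 T1) _ => //.
  by apply: lee_wpmul2r; [exact: lebn_ge0|rewrite lee_fin].
have /choice[S SP] : forall Z', exists Z, (T @` E) Z' -> E Z /\ T Z = Z'.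
  move=> Z'; have [[Z EZ <-]|nT] := pselect ((T @` E) Z'); first by exists Z.
  by exists 0.
have ES : E = S @` (T @` E).
  apply/seteqP; split=> [Z EZ|_ [_ [Z EZ <-] <-]].
    have TZ : (T @` E) (T Z) by exists Z.
    have [ESZ TS] := SP _ TZ; exists (T Z) => //; apply/eqP; rewrite -subr_eq0 -normr_le0.
    by apply: le_trans (T2 _ _ ESZ EZ) _; rewrite TS subrr normr0 mulr0.
  have TZ : (T @` E) (T Z) by exists Z.
  by have [] := SP _ TZ.
have S1 y z : (T @` E) y -> (T @` E) z -> `|S y - S z| <= k * `|y - z|.
  by move=> /SP[Ey Ty] /SP[Ez Tz]; rewrite -{2}Ty -{2}Tz; exact: T2.
have dLi : `|\det (invmx L)| = `|\det L|^-1 by rewrite det_inv normfV.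
have LiU : invmx L \in unitmx by rewrite unitmx_inv.
apply: (@le_trans _ _ (`|\det L|%:E * ((k ^+ n)%:E * (`|\det L|^-1%:E * lebn n (Psi @` E))))%E).
  apply: lee_wpmul2l; first by rewrite lee_fin.
  rewrite {1}ES; apply: le_trans (lebn_lipschitz _ k0 S1) _ => //.
  apply: lee_wpmul2l; first by rewrite lee_fin exprn_ge0// ltW.
  by rewrite TPsi -dLi; exact: lebn_mulmx_le.
rewrite !muleA -!EFinM mulrAC divff ?gt_eqF// mul1r.
by apply: lee_wpmul2r; [exact: lebn_ge0|rewrite lee_fin].
Qed.

End LocalVolume.

Section Interpolation.
Context {R : realType}.

(** The inverse of the Vandermonde matrix with nodes [1, ..., n]. The nodes are positive, as are the
    radii at which volumes are known, and coefficients become fixed linear combinations of values,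
    from which they inherit continuity. *)
Lemma interpolation n : exists al : 'M[R]_n, forall c : 'I_n -> R, forall j,
  c j = \sum_(l < n) (\sum_(i < n) c i * l.+1%:R ^+ i) * al l j.
Proof.
pose a : 'rV[R]_n := \row_(l < n) l.+1%:R; pose V : 'M[R]_n := Vandermonde n a.
have Vu : V \in unitmx.
  rewrite unitmxE unitfE det_Vandermonde; apply/prodf_neq0 => i _; apply/prodf_neq0 => j ij.
  rewrite !mxE subr_eq0 eqr_nat; apply: contraTneq ij => /eqP.
  by rewrite eqSS => /eqP ->; rewrite ltnn.
exists (invmx V) => c j; pose r : 'rV[R]_n := \row_i c i.
have : r = r *m V *m invmx V by rewrite mulmxK.
move=> /rowP/(_ j); rewrite mxE [RHS]mxE => ->; apply: eq_bigr => l _; congr (_ * _).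
by rewrite mxE; apply: eq_bigr => i _; rewrite !mxE.
Qed.

End Interpolation.

(** * The polynomial det (A + s B) in s *)

Section Pencil.
Context {R : realType} {d : nat}.
Implicit Types (A B : 'M[R]_d) (v : 'rV[R]_d).

(** The polynomial [det (A + s B)] for invertible [B], expressed through a characteristic polynomial
    so that the degree, the leading coefficient and the roots are at hand. *)
Definition pencil A B : {poly R} := \det B *: char_poly (- (invmx B *m A)).

Lemma pencil_horner A B (s : R) : B \in unitmx -> (pencil A B).[s] = \det (A + s *: B).
Proof.
move=> Bu; rewrite /pencil hornerZ /char_poly -[_.[s]]/(horner_eval s _) -det_map_mx.
rewrite -det_mulmx; congr (\det _).
have -> : map_mx (horner_eval s) (char_poly_mx (- (invmx B *m A))) = s%:M + invmx B *m A.
  apply/matrixP => i j; rewrite !mxE /horner_eval !hornerE.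
  by case: (i == j); rewrite /= ?mulr1n ?mulr0n ?hornerX ?horner0 ?opprK.
by rewrite mulmxDr mulmxA mulmxV// mul1mx mul_mx_scalar addrC.
Qed.

Lemma size_pencil A B : (size (pencil A B) <= d.+1)%N.
Proof. by apply: leq_trans (size_scale_leq _ _) _; rewrite size_char_poly. Qed.

Lemma pencil_top A B : (pencil A B)`_d = \det B.
Proof.
rewrite coefZ; have := char_poly_monic (- (invmx B *m A)).
by rewrite monicE lead_coefE size_char_poly => /eqP ->; rewrite mulr1.
Qed.

Lemma pencil_sum A B (s : R) : B \in unitmx ->
  \det (A + s *: B) = \sum_(j < d.+1) (pencil A B)`_j * s ^+ j.
Proof. by move=> Bu; rewrite -pencil_horner// (horner_coef_wide _ (size_pencil A B)). Qed.

Lemma dotrv_sym A u v : (forall i j, A i j = A j i) -> dotrv u (v *m A) = dotrv v (u *m A).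
Proof.
move=> As; rewrite /dotrv (eq_bigr (fun i => \sum_j v 0 j * u 0 i * A j i)); last first.
  by move=> i _; rewrite mxE mulr_sumr; apply: eq_bigr => j _; ring.
rewrite exchange_big; apply: eq_bigr => j _; rewrite mxE mulr_sumr; apply: eq_bigr => i _.
by rewrite As; ring.
Qed.

(* The eigenvalues of - B^-1 A are real and nonpositive: pair w (A + z B) = 0
   with the conjugate of w. *)
Lemma pencil_coef_ge0 A B j :
  (forall i k, A i k = A k i) -> (forall i k, B i k = B k i) ->
  (forall v, 0 <= dotrv v (v *m A)) -> (forall v, v != 0 -> 0 < dotrv v (v *m B)) ->
  0 < \det B -> 0 <= (pencil A B)`_j.
Proof.
move=> As Bs A0 B0 dB; rewrite coefZ pmulr_rge0//.
have Bu : B \in unitmx by rewrite unitmxE unitfE gt_eqF.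
pose C := (R[i])%C; pose toC : {rmorphism R -> C} := real_complex R.
set M := - _; set p := char_poly M.
have [rs prs] := closed_field_poly_normal (map_poly toC p).
have p1 : lead_coef (map_poly toC p) = 1.
  by rewrite lead_coef_map (monicP (char_poly_monic _)) rmorph1.
rewrite p1 scale1r in prs.
(* A product of factors [X - z] with [- z >= 0] has nonnegative coefficients. *)
suff rs0 z : z \in rs -> 0 <= - z.
  have pos : forall k, 0 <= (map_poly toC p)`_k.
    rewrite prs big_seq; elim/big_ind: _ => [k|q1 q2 h1 h2 k|z /rs0 z0 k].
    - by rewrite coef1 ler0n.
    - by rewrite coefM; apply: sumr_ge0 => i _; rewrite mulr_ge0.
    - case: k => [|[|k]]; rewrite coefB coefX coefC /=.
      + by rewrite sub0r.
      + by rewrite subr0 ler01.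
      + by rewrite subr0.
  have := pos j; rewrite coef_map /toC /=.
  by rewrite lecE /= eqxx.
move=> zrs; have rz : root (map_poly toC p) z.
  by rewrite prs root_prod_XsubC.
move: rz; rewrite map_char_poly -eigenvalue_root_char => /eigenvalueP[v vM v0].
pose BC := map_mx toC B; pose AC := map_mx toC A.
have BCu : BC \in unitmx by rewrite map_unitmx.
pose w := v *m invmx BC; have vw : v = w *m BC by rewrite mulmxKV.
have w0 : w != 0 by apply: contraNneq v0 => w0; rewrite vw w0 mul0mx.
have E : w *m AC = - z *: (w *m BC).
  rewrite -vw scaleNr -vM /M map_mxN map_mxM map_invmx mulmxN mulmxA opprK.
  by rewrite -/BC -/AC -/w.
(* [w = a + i b], and [wc] below is its conjugate. *)
pose a : 'rV[R]_d := map_mx (@complex.Re R) w; pose b : 'rV[R]_d := map_mx (@complex.Im R) w.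
have wE : w = map_mx toC a + (complex.Complex 0 1) *: map_mx toC b.
  apply/rowP => i; rewrite !mxE; case: (w 0 i) => x y /=; rewrite /toC /=.
  by apply/eqP; rewrite eq_complex /= !(mul0r, mul1r, mulr0, add0r, addr0, subr0, sub0r, oppr0) !eqxx.
pose wc := map_mx toC a - (complex.Complex 0 1) *: map_mx toC b.
pose dotC (x y : 'rV[C]_d) := \sum_i x 0 i * y 0 i.
have ii : (complex.Complex 0 1 : C) * complex.Complex 0 1 = -1.
  by apply/eqP; rewrite eq_complex /= !(mul0r, mul1r, mulr0, sub0r, addr0, oppr0) !eqxx.
have dZ x y (t : C) : dotC x (t *: y) = t * dotC x y.
  by rewrite mulr_sumr; apply: eq_bigr => i _; rewrite mxE mulrCA.
(* For symmetric [S] the cross terms cancel, so the pairing is the real number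
   [S(a, a) + S(b, b)]. *)
have dotM (S : 'M[R]_d) : (forall i k, S i k = S k i) ->
    dotC wc (w *m map_mx toC S) = toC (dotrv a (a *m S) + dotrv b (b *m S)).
  move=> Ss; have dE (x y : 'rV[R]_d) : toC (dotrv x (y *m S)) =
      dotC (map_mx toC x) (map_mx toC y *m map_mx toC S).
    rewrite rmorph_sum; apply: eq_bigr => i _; rewrite rmorphM -map_mxM !mxE.
    by [].
  have dD x y z' : dotC x (y + z') = dotC x y + dotC x z'.
    by rewrite -big_split; apply: eq_bigr => i _; rewrite mxE mulrDr.
  have dDl x y z' : dotC (y + z') x = dotC y x + dotC z' x.
    by rewrite -big_split; apply: eq_bigr => i _; rewrite mxE mulrDl.
  have dZl x y (t : C) : dotC (t *: y) x = t * dotC y x.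
    by rewrite mulr_sumr; apply: eq_bigr => i _; rewrite mxE mulrA.
  have dNl x y : dotC (- y) x = - dotC y x by rewrite -scaleN1r dZl mulN1r.
  rewrite wE mulmxDl -scalemxAl dD dZ !dDl !dNl !dZl -!dE (dotrv_sym b a Ss) rmorphD.
  rewrite mulrBr mulrA ii; set q := toC (dotrv a (b *m S)); ring.
have := congr1 (dotC wc) E.
rewrite dZ !dotM//.
have al0 : 0 <= dotrv a (a *m A) + dotrv b (b *m A) by rewrite addr_ge0.
have be0 : 0 < dotrv a (a *m B) + dotrv b (b *m B).
  have Bge v' : 0 <= dotrv v' (v' *m B).
    have [->|/B0/ltW//] := eqVneq v' 0; by rewrite dotrv0l.
  have [a0|/B0 ha] := eqVneq a 0; last by rewrite ltr_wpDr.
  rewrite ltr_wpDl//; apply: B0; apply: contraNneq w0 => b0.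
  by rewrite wE a0 b0 !map_mx0 scaler0 addr0.
move: (dotrv a _ + _) (dotrv a _ + _) al0 be0 => be al al0 be0 Ez.
have tb : toC be != 0 by rewrite fmorph_eq0 gt_eqF.
have -> : - z = toC (al / be) by rewrite fmorph_div Ez mulfK.
by rewrite /toC /= lecE /= eqxx /= divr_ge0// ltW.
Qed.

End Pencil.

Section Continuity.
Context {R : realType} {n : nat}.

Lemma continuous_sum_at (I : Type) (s : seq I) (f : I -> 'rV[R]_n -> R) x :
  (forall i, {for x, continuous (f i)}) ->
  {for x, continuous (fun y => \sum_(i <- s) f i y)}.
Proof.
move=> h; elim: s => [|i s IH].
  by rewrite (_ : (fun y => _) = fun=> 0); [exact: cst_continuous|apply/funext => y; rewrite big_nil].
rewrite (_ : (fun y => _) = fun y => f i y + \sum_(j <- s) f j y).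
  by apply: continuousD.
by apply/funext => y; rewrite big_cons.
Qed.

Lemma continuous_prod_at (I : Type) (s : seq I) (f : I -> 'rV[R]_n -> R) x :
  (forall i, {for x, continuous (f i)}) ->
  {for x, continuous (fun y => \prod_(i <- s) f i y)}.
Proof.
move=> h; elim: s => [|i s IH].
  by rewrite (_ : (fun y => _) = fun=> 1); [exact: cst_continuous|apply/funext => y; rewrite big_nil].
rewrite (_ : (fun y => _) = fun y => f i y * \prod_(j <- s) f j y).
  by apply: continuousM.
by apply/funext => y; rewrite big_cons.
Qed.

Lemma continuous_det_at k (M : 'rV[R]_n -> 'M[R]_k) x :
  (forall i j, {for x, continuous (fun y => M y i j)}) ->
  {for x, continuous (fun y => \det (M y))}.
Proof.
move=> h; apply: continuous_sum_at => s; apply: continuousM; first exact: cst_continuous.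
exact: continuous_prod_at.
Qed.

Lemma measurable_fun_on_open (W : set 'rV[R]_n) (f : 'rV[R]_n -> R) : open W ->
  (forall y, W y -> {for y, continuous f}) ->
  measurable_fun (W : set (borelRn R n)) (f : borelRn R n -> measurableTypeR R).
Proof.
move=> oW fc; apply: (measurability _ (RGenOInfty.measurableE R)) => _ [_ [x ->] <-].
apply: open_borel; apply: ballP_open => y [Wy /=]; rewrite in_itv /= andbT => xy.
have [r0 r00 h0] := open_ballP oW Wy.
have xy0 : 0 < f y - x by rewrite subr_gt0.
have [r1 r10 h1] := continuous_at_rv (fc _ Wy) xy0.
exists (Num.min r0 r1); first by rewrite lt_min r00.
move=> z; rewrite lt_min => /andP[z0 z1]; split; first exact: h0.
by rewrite /= in_itv /= andbT; have := h1 _ z1; rewrite ltr_norml; lra.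
Qed.

End Continuity.

Section SnocCalculus.
Context {R : realType} {d : nat}.

Lemma sdiff_rinit (f : 'rV[R]_d -> R) L (Z0 : 'rV[R]_d.+1) :
  sdiff f L (rinit Z0) -> sdiff (fun Z => f (rinit Z)) (snoc L 0) Z0.
Proof.
move=> fL e e0; have [r r0 rf] := fL e e0; exists r => // Y Z Yr Zr.
have h X : `|X - Z0| < r -> `|rinit X - rinit Z0| < r.
  by rewrite -rinitB; apply: le_lt_trans; exact: rinit_norm_le.
have := rf _ _ (h _ Yr) (h _ Zr); rewrite -rinitB => H.
rewrite -[Y - Z]snoc_rinit dotrv_snoc mul0r addr0 snoc_rinit; apply: le_trans H _.
by rewrite ler_wpM2l ?rinit_norm_le// ltW.
Qed.

Lemma sdiff_rlast (Z0 : 'rV[R]_d.+1) : sdiff (@rlast R d) (snoc 0 1) Z0.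
Proof.
apply: sdiff_linear => Y.
by rewrite -[Y in RHS]snoc_rinit dotrv_snoc dotrv0l add0r mul1r.
Qed.

Lemma sum_lift (F : 'I_d.+1 -> R) : \sum_i F i = \sum_(i < d) F (lift ord_max i) + F ord_max.
Proof. exact: big_lift. Qed.

Lemma snoc_sum (I : Type) (r : seq I) (a : I -> 'rV[R]_d) (b : I -> R) :
  \sum_(k <- r) snoc (a k) (b k) = snoc (\sum_(k <- r) a k) (\sum_(k <- r) b k).
Proof.
elim: r => [|k r IH]; last by rewrite !big_cons IH snocD.
by rewrite !big_nil; apply/rowP => i; rewrite !mxE; case: unlift => // j; rewrite mxE.
Qed.

(** The last column is the combination of the others with coefficients [y], up to [w] in the corner;
    this column operation is the unipotent factor [M2]. *)
Lemma det_bordered (H : 'M[R]_d) (p y : 'rV[R]_d) (w : R) :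
  \det (\matrix_(i, j) (if unlift ord_max j is Some k then snoc (\row_l H l k) (p 0 k) 0 i
     else snoc (\row_l \sum_k H l k * y 0 k) (dotrv p y + w) 0 i)) = w * \det H.
Proof.
pose M1 : 'M[R]_d.+1 := \matrix_(i, j) (if unlift ord_max j is Some k then
  snoc (\row_l H l k) (p 0 k) 0 i else snoc 0 w 0 i).
pose M2 : 'M[R]_d.+1 := \matrix_(i, j) (if unlift ord_max j is Some k then (i == j)%:R
  else snoc y 1 0 i).
rewrite (_ : \matrix_(i, j) _ = M1 *m M2); last first.
  apply/matrixP => i j; rewrite mxE [RHS]mxE.
  case: (unliftP ord_max j) => [k|] ->; rewrite sum_lift.
    rewrite (bigD1 k)//= big1 ?addr0.
      rewrite [M2 ord_max _]mxE liftK [M2 _ _]mxE liftK eqxx mulr1.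
      by rewrite (negbTE (neq_lift _ _)) mulr0 addr0 [M1 _ _]mxE liftK.
    by move=> l lk; rewrite [M2 _ _]mxE liftK (inj_eq lift_inj) (negbTE lk) mulr0.
  rewrite [M2 ord_max _]mxE unlift_none snoc_max mulr1 [M1 _ ord_max]mxE unlift_none.
  case: (unliftP ord_max i) => [l|] ->.
    rewrite !snoc_lift !mxE addr0; apply: eq_bigr => k _.
    by rewrite [M1 _ _]mxE [M2 _ _]mxE liftK unlift_none !snoc_lift mxE.
  rewrite !snoc_max; congr (_ + _); apply: eq_bigr => k _.
  by rewrite [M1 _ _]mxE [M2 _ _]mxE liftK unlift_none snoc_max snoc_lift.
rewrite det_mulmx; have -> : \det M2 = 1.
  rewrite -det_tr det_trig.
    apply: big1 => i _; rewrite mxE [M2 _ _]mxE.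
    by case: (unliftP ord_max i) => [k Ei|->]; rewrite ?eqxx ?snoc_max.
  apply/is_trig_mxP => i j ij; rewrite !mxE.
  case: (unliftP ord_max i) => [k|] Ei; last first.
    by move: ij; rewrite Ei ltnNge -ltnS ltn_ord.
  by rewrite (_ : (j == i) = false)//; apply/negbTE; apply: contraTneq ij => ->; rewrite ltnn.
rewrite mulr1 (expand_det_col M1 ord_max) sum_lift big1 ?add0r; last first.
  by move=> k _; rewrite mxE unlift_none snoc_lift mxE mul0r.
rewrite mxE unlift_none snoc_max; congr (_ * _).
rewrite /cofactor -signr_odd addnn odd_double expr0 mul1r; congr (\det _).
by apply/matrixP => i j; rewrite !mxE liftK mxE liftK mxE.
Qed.

End SnocCalculus.

(** * Touching pairs of a smooth function *)

Section SmoothPotential.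
Context {R : realType} {d : nat}.
Variables (W : set 'rV[R]_d) (om : 'rV[R]_d -> R).
Hypotheses (oW : open W) (cW : convex_set W) (hom : cheng_yau W om).
Variables (u : 'rV[R]_d -> R) (g : 'rV[R]_d -> 'rV[R]_d) (A : 'rV[R]_d -> 'M[R]_d).
Hypothesis u_conv : forall y z, W y -> W z -> u y + dotrv (g y) (z - y) <= u z.
Hypothesis u_sd : forall y, W y -> sdiff u (g y) y.
Hypothesis g_sd : forall y j, W y -> sdiff (fun z => g z 0 j) (\row_i A y i j) y.

Lemma smooth_convex_on : convex_on W u.
Proof.
move=> x y t t01 Wx Wy; have Wm := convex_setP cW t01 Wx Wy.
set m := t *: x + _ in Wm *.
have := u_conv Wm Wx; have := u_conv Wm Wy.
have -> : x - m = (1 - t) *: (x - y) by apply/rowP => i; rewrite !mxE; ring.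
have -> : y - m = - t *: (x - y) by apply/rowP => i; rewrite !mxE; ring.
rewrite !dotrvZr; move/andP: t01 => [t0 t1]; move: (dotrv _ _) => D h1 h2.
have t1' : 0 <= 1 - t by lra.
have := ler_wpM2l t0 h2; have := ler_wpM2l t1' h1; lra.
Qed.

Lemma smooth_lsc_on : lsc_on W u.
Proof.
move=> y e Wy e0; have [r r0 h] := sdiff_near (u_sd Wy) e0; exists r => // z _ zy.
by have := h _ zy; rewrite ltr_norml; lra.
Qed.

(** With [f = u + s om]: the gradient of [f] at [y] followed by its Legendre transform, so that
    [lform _ (Psi Z)] is the tangent of [f] at [y]. *)
Definition Psi (Z : 'rV[R]_d.+1) : 'rV[R]_d.+1 :=
  let y := rinit Z in let s := rlast Z in let G := g y + s *: grad om y in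
  snoc G (dotrv G y - (u y + s * om y)).

(** [rinit p] is a subgradient of [u] at [y] and [u] is differentiable there; the test direction [v]
    is the difference between [rinit p] and the gradient. *)
Lemma contact_gradient y p : contact W u y p -> p = snoc (g y) (dotrv (g y) y - u y).
Proof.
move=> [Wy [E h]]; have pg : rinit p = g y.
  apply/eqP; rewrite -subr_eq0; apply/eqP; apply: dotrv_self_eq0; apply/eqP.
  rewrite eq_le dotrv_ge0 andbT; set v := rinit p - g y.
  apply: (@le0_of_small _ _ `|v|) => // e e0.
  have [r r0 rf] := u_sd Wy e0; have [r1 r10 rW] := open_ballP oW Wy.
  have v0 := normr_ge0 v; pose q := Num.min r r1.
  have q0 : 0 < q by rewrite lt_min r0.
  pose t := q / (`|v| + 1); have t0 : 0 < t by rewrite divr_gt0//; lra.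
  have tq : t * `|v| < q.
    by rewrite /t mulrAC ltr_pdivrMr ?ltr_pM2l//; lra.
  have tv : `|y + t *: v - y| = t * `|v| by rewrite addrAC subrr add0r normrZ gtr0_norm.
  have tr : t * `|v| < r by apply: lt_le_trans tq _; rewrite ge_min lexx.
  have tr1 : t * `|v| < r1 by apply: lt_le_trans tq _; rewrite ge_min lexx orbT.
  have Wt : W (y + t *: v) by apply: rW; rewrite tv.
  have := h _ Wt; move: E; rewrite /gap => E; have := lformBl (y + t *: v) y p.
  have := rf (y + t *: v) y; rewrite tv subrr normr0 => /(_ tr r0).
  rewrite [y + t *: v - y]addrAC subrr add0r dotrvZr dotrvZl ler_norml => /andP[_].
  have vE : dotrv v v = dotrv v (rinit p) - dotrv (g y) v by rewrite (dotrvC (g y)) -dotrvBr.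
  rewrite vE.
  move: E; move: (lform _ _) (lform _ _) (u _) (u _) (dotrv _ _) (dotrv _ _).
  by move=> a b c' a' D1 D2 h1 h2 h3 h4; rewrite -(ler_pM2l t0); lra.
rewrite -[LHS]snoc_rinit pg; congr snoc.
by move: E; rewrite /gap /lform pg dotrvC; lra.
Qed.

Lemma touch_Psi X y s : touch W om u X y s <-> [/\ W y, 0 < s & X = Psi (snoc y s)].
Proof.
have PE : Psi (snoc y s) = snoc (g y) (dotrv (g y) y - u y) + s *: nsphere om y.
  rewrite /Psi rinit_snoc rlast_snoc snocZ snocD; congr snoc.
  by rewrite dotrvDl dotrvZl; ring.
split=> [t|[Wy s0 ->]].
  have [Wy s0 _ _] := t; split => //; rewrite PE.
  have := contact_gradient (touch_contact oW cW hom smooth_convex_on t) => <-.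
  by rewrite subrK.
rewrite PE; apply: (contact_touch oW hom s0); split => //; split.
  by rewrite /gap /lform rinit_snoc rlast_snoc dotrvC; ring.
move=> z Wz; rewrite /gap /lform rinit_snoc rlast_snoc.
by have := u_conv Wy Wz; rewrite dotrvBr (dotrvC z); lra.
Qed.

Lemma touchset_Psi (B : set ('rV[R]_d * R)) :
  touchset W om u B = Psi @` [set Z | [/\ B (rinit Z, rlast Z), W (rinit Z) & 0 < rlast Z]].
Proof.
apply/seteqP; split=> [X [y [s [/touch_Psi[Wy s0 ->] Bys]]]|_ [Z [BZ WZ s0] <-]].
  by exists (snoc y s) => //=; rewrite rinit_snoc rlast_snoc.
by exists (rinit Z), (rlast Z); split => //; apply/touch_Psi; rewrite snoc_rinit.
Qed.

Definition jacdet (y : 'rV[R]_d) (s : R) : R := - om y * \det (A y + s *: hess om y).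

Definition Psi_mx (y : 'rV[R]_d) (s : R) : 'M[R]_d.+1 :=
  let H := A y + s *: hess om y in
  \matrix_(i, j) (if unlift ord_max j is Some k then snoc (\row_l H l k) (grad om y 0 k) 0 i
     else snoc (\row_l \sum_k H l k * y 0 k) (dotrv (grad om y) y + - om y) 0 i).

Lemma det_Psi_mx y s : \det (Psi_mx y s) = jacdet y s.
Proof. exact: det_bordered. Qed.

(** When [G . y - (u + s om)] is differentiated in [y], the terms [G] and [- grad (u + s om)] cancel
    and only [H y] remains; this gives [Psi_mx] the shape treated by [det_bordered]. *)
Lemma Psi_sdiff y s j : W y ->
  sdiff (fun Z => Psi Z 0 j) (\row_i Psi_mx y s i j) (snoc y s).
Proof.
move=> Wy.
pose H := A y + s *: hess om y.
have comp k : sdiff (fun Z => g (rinit Z) 0 k + rlast Z * grad om (rinit Z) 0 k)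
    (snoc (\row_l H l k) (grad om y 0 k)) (snoc y s).
  have e1 : sdiff (fun Z => g (rinit Z) 0 k) (snoc (\row_i A y i k) 0) (snoc y s).
    by apply: (@sdiff_rinit R d (fun z => g z 0 k)); rewrite rinit_snoc; exact: g_sd.
  have e2 : sdiff (fun Z => grad om (rinit Z) 0 k) (snoc (\row_i hess om y i k) 0) (snoc y s).
    apply: (@sdiff_rinit R d (fun z => grad om z 0 k)); rewrite rinit_snoc.
    rewrite (_ : (fun z => _) = partials [:: k] om); first exact: (dom_sdiff oW hom).
    by apply/funext => z; rewrite gradE.
  have := sdiffD e1 (sdiffM (@sdiff_rlast R d (snoc y s)) e2).
  congr sdiff; rewrite rinit_snoc rlast_snoc !snocZ !snocD; congr snoc.
    by apply/rowP => l; rewrite !mxE; ring.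
  by ring.
case: (unliftP ord_max j) => [k|] ->.
  have := comp k; congr sdiff.
    by apply/funext => Z; rewrite /Psi snoc_lift !mxE.
  by apply/rowP => i; rewrite [RHS]mxE [RHS]mxE liftK.
have e3 k : sdiff (fun Z => rinit Z 0 k) (snoc (delta_mx 0 k) 0) (snoc y s).
  apply: (@sdiff_rinit R d (fun z => z 0 k)); apply: sdiff_linear => z.
  by rewrite dotrv_delta.
have e4 : sdiff (fun Z => u (rinit Z)) (snoc (g y) 0) (snoc y s).
  by apply: sdiff_rinit; rewrite rinit_snoc; exact: u_sd.
have e5 : sdiff (fun Z => om (rinit Z)) (snoc (grad om y) 0) (snoc y s).
  by apply: sdiff_rinit; rewrite rinit_snoc; exact: (om_sdiff oW hom).
have e6 := sdiffM (@sdiff_rlast R d (snoc y s)) e5.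
have e7 := @sdiff_sum R d.+1 _ (index_enum 'I_d) _ _ (snoc y s) (fun k => sdiffM (comp k) (e3 k)).
have := sdiffD e7 (sdiffN (sdiffD e4 e6)); congr sdiff.
  apply/funext => Z; rewrite /Psi snoc_max; congr (_ - _).
  by apply: eq_bigr => k _; rewrite !mxE.
rewrite rinit_snoc rlast_snoc.
have -> : \row_i Psi_mx y s i ord_max =
    snoc (\row_l \sum_k H l k * y 0 k) (dotrv (grad om y) y + - om y).
  by apply/rowP => i; rewrite mxE [LHS]mxE unlift_none.
rewrite (eq_bigr (fun k => snoc (y 0 k *: \row_l H l k + (g y 0 k + s * grad om y 0 k) *: delta_mx 0 k)
   (y 0 k * grad om y 0 k))); last first.
  by move=> k _; rewrite !snocZ snocD mulr0 addr0.
rewrite snoc_sum !snocZ !snocD snocB; congr snoc.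
  apply/rowP => l; rewrite !mxE summxE.
  rewrite (eq_bigr (fun k => H l k * y 0 k + (g y 0 k + s * grad om y 0 k) * (l == k)%:R)); last first.
    by move=> k _; rewrite !mxE eqxx /=; ring.
  have D : \sum_k (g y 0 k + s * grad om y 0 k) * (l == k)%:R = g y 0 l + s * grad om y 0 l.
    rewrite (bigD1 l)//= eqxx mulr1 big1 ?addr0// => k kl.
    by rewrite eq_sym (negbTE kl) mulr0.
  have gE : 'D_(delta_mx 0 l) om y = grad om y 0 l by rewrite mxE.
  by rewrite big_split /= D gE; ring.
rewrite (_ : \sum_k _ = dotrv (grad om y) y); last by apply: eq_bigr => k _; rewrite mulrC.
by ring.
Qed.

End SmoothPotential.

Section Density.
Context {d : measure_display} {T : measurableType d} {R : realType}.
Variable m : {measure set T -> \bar R}.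

Lemma density_exists (J : T -> \bar R) : measurable_fun setT J -> (forall p, 0 <= J p)%E ->
  exists rho : {measure set T -> \bar R}, forall B, rho B = (\int[m]_(p in B) J p)%E.
Proof.
move=> mJ J0; apply: measure_exists.
- exact: integral_set0.
- by move=> A; exact: integral_ge0.
move=> F mF tF mUF.
rewrite (ge0_integral_bigcup m mF (measurable_funTS mJ))//.
rewrite (_ : (fun n => _) = (fun n => \sum_(0 <= i < n) \int[m]_(p in F i) J p)%E); last first.
  by apply/funext => n; rewrite big_mkord.
by apply: is_cvg_nneseries => k _ _; exact: integral_ge0.
Qed.

End Density.

Lemma le_of_near1 {R : realType} (x y : \bar R) : (0 <= y)%E ->
  (forall k : R, 1 < k -> (x <= k%:E * y)%E) -> (x <= y)%E.
Proof.
move=> y0 h; case: y y0 h => [r r0 h|_ _|//]; last by rewrite leey.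
rewrite lee_fin in r0; apply/lee_addgt0Pr => e e0.
have k1 : 1 < 1 + e / (r + 1) by rewrite ltrDl divr_gt0//; lra.
apply: le_trans (h _ k1) _; rewrite -EFinM -EFinD lee_fin mulrDl mul1r lerD2l.
by rewrite mulrAC ler_pdivrMr ?ler_pM2l//; lra.
Qed.

Lemma integral_pow {R : realType} (e : R) j : 0 < e ->
  (\int[@lebesgue_measure R]_(s in `]0%R, e[) (s ^+ j)%:E = (e ^+ j.+1 / j.+1%:R)%:E)%E.
Proof.
move=> e0; have cX : continuous (fun s : R => s ^+ j) by exact: exprn_continuous.
have mX (D : set (measurableTypeR R)) : measurable_fun D (fun s : R => (s ^+ j)%:E).
  by apply/measurable_EFinP; exact: exprn_measurable.
have -> : (\int[@lebesgue_measure R]_(s in `]0%R, e[) (s ^+ j)%:E =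
   \int[@lebesgue_measure R]_(s in `[0%R, e]) (s ^+ j)%:E)%E.
  rewrite integral_itv_obnd_cbnd ?integral_itv_bndo_bndc//; exact: mX.
pose p : {poly R} := j.+1%:R^-1 *: 'X^(j.+1).
have pE s : p.[s] = s ^+ j.+1 / j.+1%:R by rewrite /p hornerZ hornerXn mulrC.
have p'E s : p^`().[s] = s ^+ j.
  rewrite /p derivZ derivXn /= hornerZ hornerMn hornerXn -(mulr_natr (s ^+ j)) mulrCA mulVf ?mulr1//.
rewrite (@continuous_FTC2 R _ (horner p) 0 e e0).
- by rewrite -EFinB !pE expr0n /= mul0r subr0.
- by apply: continuous_subspaceT.
- split; first by move=> s _; exact: derivable_horner.
  + by apply: cvg_at_right_filter; exact: continuous_horner.
  + by apply: cvg_at_left_filter; exact: continuous_horner.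
- by move=> s _; rewrite -derivE p'E.
Qed.

Section LocalToGlobal.
Context {R : realType} {d : nat}.
Notation Y := (borelRn R d * measurableTypeR R)%type.

Definition sbox k : set Y := [set p | qbox k (snoc p.1 p.2 : 'rV[R]_d.+1)].

Lemma measurable_sbox k : measurable (sbox k).
Proof.
rewrite /sbox /qbox; case: unpickle => [c|]; last first.
  by rewrite (_ : [set p | _] = set0)//; exact: measurable0.
pose a : 'rV[R]_d.+1 := map_mx ratr c.1; pose b : 'rV[R]_d.+1 := map_mx ratr c.2.
rewrite (_ : [set p | _] = (fun p : Y => snoc p.1 p.2 : borelRn R d.+1) @^-1` box (a, b))//.
have -> : (fun p : Y => snoc p.1 p.2 : borelRn R d.+1) @^-1` box (a, b) =
   (box (rinit a, rinit b) : set (borelRn R d)) `*` `](rlast a), (rlast b)]%classic.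
  apply/seteqP; split=> -[y s] /=.
    move=> h; split; last by rewrite in_itv /=; have := h ord_max; rewrite snoc_max.
    by move=> i; have := h (lift ord_max i); rewrite snoc_lift !mxE.
  rewrite in_itv /= => -[h hs] i; case: (unliftP ord_max i) => [l|] ->.
    by have := h l; rewrite snoc_lift !mxE.
  by rewrite snoc_max.
apply: measurableX; last exact: measurable_itv.
have -> : box (rinit a, rinit b) = qbox (pickle (\row_i c.1 0 (lift ord_max i), \row_i c.2 0 (lift ord_max i))).
  rewrite /qbox pickleK; congr box; congr pair; apply/rowP => i; by rewrite !mxE.
exact: qbox_borel.
Qed.

(** The countably many rational boxes on which the inequality holds are made disjoint, and both
    measures are summed over the resulting partition. *)
Lemma local_to_global (mu nu : {measure set Y -> \bar R}) (D : set Y) (k : R) : 0 <= k ->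
  (forall p, D p -> exists2 i, sbox i p &
     forall B, measurable B -> B `<=` sbox i -> (mu B <= k%:E * nu B)%E) ->
  forall B, measurable B -> B `<=` D -> (mu B <= k%:E * nu B)%E.
Proof.
move=> k0 loc B mB BD.
pose good i := forall B, measurable B -> B `<=` sbox i -> (mu B <= k%:E * nu B)%E.
pose G i := if `[< good i >] then sbox i else set0.
have mG i : measurable (G i) by rewrite /G; case: ifP => _ //; exact: measurable_sbox.
have mS i : measurable (seqDU G i).
  by apply: measurableD => //; apply: bigsetU_measurable => l _.
have BE : B = \bigcup_i (B `&` seqDU G i).
  rewrite -setI_bigcupr -seqDU_bigcup_eq; apply/seteqP; split => [p Bp|p []//].
  split => //; have [i pi hi] := loc _ (BD _ Bp); exists i => //.
  by rewrite /G; case: asboolP.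
have tB : trivIset setT (fun i => B `&` seqDU G i) by apply: trivIset_setIl; exact: trivIset_seqDU.
have mBi i : measurable (B `&` seqDU G i) by exact: measurableI.
rewrite BE !measure_bigcup// -nneseriesZl; last by move=> *; exact: measure_ge0.
apply: lee_nneseries => [i _ _|i _]; first exact: measure_ge0.
have sub : B `&` seqDU G i `<=` G i by move=> p [_ []].
have [gi|ni] := pselect (good i).
  have GE : G i = sbox i by rewrite /G; case: asboolP.
  by apply: gi => //; rewrite -GE.
have GE : G i = set0 by rewrite /G; case: asboolP.
have -> : B `&` seqDU G i = set0.
  by apply/seteqP; split => // p /sub; rewrite GE.
by rewrite !measure0 mule0.
Qed.

End LocalToGlobal.

(** * The Steiner formula by change of variables *)

Section SmoothSteiner.
Context {R : realType} {d : nat}.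
Hypothesis d0 : (0 < d)%N.
Variables (W : set 'rV[R]_d) (om : 'rV[R]_d -> R) (y0 : 'rV[R]_d) (MW : R).
Hypotheses (oW : open W) (cW : convex_set W) (hom : cheng_yau W om).
Hypotheses (Wy0 : W y0) (WM : forall y, W y -> `|y| <= MW).
Variables (u : 'rV[R]_d -> R) (g : 'rV[R]_d -> 'rV[R]_d) (A : 'rV[R]_d -> 'M[R]_d).
Hypothesis u_conv : forall y z, W y -> W z -> u y + dotrv (g y) (z - y) <= u z.
Hypothesis u_sd : forall y, W y -> sdiff u (g y) y.
Hypothesis g_sd : forall y j, W y -> sdiff (fun z => g z 0 j) (\row_i A y i j) y.
Hypothesis A_sym : forall y i j, W y -> A y i j = A y j i.
Hypothesis A_psd : forall y v, W y -> 0 <= dotrv v (v *m A y).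
Hypothesis A_cont : forall y i j, W y -> {for y, continuous (fun z => A z i j)}.
Notation Y := (borelRn R d * measurableTypeR R)%type.
Notation lam := (@lebesgue_measure R).
Notation B := (hess om).
Variable al : 'M[R]_d.+1.
Hypothesis hal : forall c : 'I_d.+1 -> R, forall j,
  c j = \sum_(l < d.+1) (\sum_(i < d.+1) c i * l.+1%:R ^+ i) * al l j.

Lemma det_hess_gt0 y : W y -> 0 < \det (B y).
Proof.
move=> Wy; case: hom => _ _ _ /(_ _ Wy) -> _.
by rewrite invr_gt0 exprn_gt0// oppr_gt0 (om_lt0 hom).
Qed.

Lemma hess_unit y : W y -> B y \in unitmx.
Proof. by move=> Wy; rewrite unitmxE unitfE gt_eqF// det_hess_gt0. Qed.

(* The coefficient of s^j in the Jacobian - om det(A + s B), written by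
   interpolation so that its continuity is apparent. *)
Definition jcoef (j : 'I_d.+1) (y : 'rV[R]_d) : R :=
  - om y * \sum_(l < d.+1) \det (A y + l.+1%:R *: B y) * al l j.

Lemma jcoefE j y : W y -> jcoef j y = - om y * (pencil (A y) (B y))`_j.
Proof.
move=> Wy; rewrite /jcoef; congr (_ * _).
rewrite (hal (fun j : 'I_d.+1 => (pencil (A y) (B y))`_j) j); apply: eq_bigr => l _.
by rewrite (pencil_sum _ _ (hess_unit Wy)).
Qed.

Lemma jcoef_ge0 j y : W y -> 0 <= jcoef j y.
Proof.
move=> Wy; rewrite jcoefE//; apply: mulr_ge0.
  by rewrite oppr_ge0 ltW// (om_lt0 hom).
apply: pencil_coef_ge0.
- by move=> i k; exact: A_sym.
- by move=> i k; exact: (hess_sym oW hom).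
- by move=> v; exact: A_psd.
- by move=> v; exact: (hess_pos oW hom).
- exact: det_hess_gt0.
Qed.

(** The pencil has leading coefficient [det (hess om)], so the Monge-Ampere equation evaluates this
    coefficient whatever [A] is; it is the density of the polar affine sphere. *)
Lemma jcoef_max y : W y -> jcoef ord_max y = (- om y) ^- d.+1.
Proof.
move=> Wy; rewrite jcoefE// pencil_top; case: hom => _ _ _ /(_ _ Wy) -> _.
have o0 : - om y != 0 by rewrite oppr_eq0 lt_eqF// (om_lt0 hom).
by rewrite exprS invfM mulrA divff// mul1r.
Qed.

Lemma hess_continuous y i j : W y -> {for y, continuous (fun z => B z i j)}.
Proof.
move=> Wy; case: hom => sm _ _ _ _; have [+ _] := sm [:: i; j] y Wy.
rewrite (_ : (fun z => B z i j) = partials [:: i; j] om)//.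
by apply/funext => z; rewrite mxE.
Qed.

Lemma om_continuous y : W y -> {for y, continuous om}.
Proof. by move=> Wy; case: hom => sm _ _ _ _; have [+ _] := sm [::] y Wy. Qed.

Lemma jcoef_continuous j y : W y -> {for y, continuous (jcoef j)}.
Proof.
move=> Wy; apply: continuousM.
  by apply: continuousN; exact: om_continuous.
apply: continuous_sum_at => l; apply: continuousM; last exact: cst_continuous.
apply: continuous_det_at => i k.
rewrite (_ : (fun z => _) = fun z => A z i k + l.+1%:R * B z i k); last first.
  by apply/funext => z; rewrite !mxE.
apply: continuousD; first exact: A_cont.
by apply: continuousM; [exact: cst_continuous|exact: hess_continuous].
Qed.

Lemma jacdet_sum y s : W y -> jacdet om A y s = \sum_(j < d.+1) jcoef j y * s ^+ j.
Proof.
move=> Wy; rewrite /jacdet pencil_sum ?hess_unit// mulr_sumr; apply: eq_bigr => j _.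
by rewrite jcoefE// mulrA.
Qed.

Lemma jacdet_gt0 y s : W y -> 0 < s -> 0 < jacdet om A y s.
Proof.
move=> Wy s0; rewrite jacdet_sum// big_ord_recr /=; apply: ltr_wpDl.
  by apply: sumr_ge0 => j _; rewrite mulr_ge0 ?jcoef_ge0// exprn_ge0// ltW.
rewrite mulr_gt0 ?exprn_gt0//.
by rewrite jcoef_max// invr_gt0 exprn_gt0// oppr_gt0 (om_lt0 hom).
Qed.

Definition jac (Z : 'rV[R]_d.+1) : R := \sum_(j < d.+1) jcoef j (rinit Z) * rlast Z ^+ j.

Lemma jac_continuous Z : W (rinit Z) -> {for Z, continuous jac}.
Proof.
move=> WZ; apply: continuous_sum_at => j; apply: continuousM.
  by apply: (@continuous_comp _ _ _ (@rinit R d) (jcoef j)); [exact: rinit_continuous|exact: jcoef_continuous].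
apply: (@continuous_comp _ _ _ (@rlast R d) (fun s => s ^+ j)); [exact: rlast_continuous|exact: exprn_continuous].
Qed.

Definition acoef (j : 'I_d.+1) : borelRn R d -> measurableTypeR R := jcoef j \_ W.

Lemma acoefE j y : W y -> acoef j y = jcoef j y.
Proof. by move=> Wy; rewrite /acoef patchE mem_set. Qed.

Lemma acoef_ge0 j y : 0 <= acoef j y.
Proof. by rewrite /acoef patchE; case: ifPn => // /set_mem; exact: jcoef_ge0. Qed.

Lemma measurable_acoef j : measurable_fun setT (acoef j).
Proof.
apply/(measurable_restrictT (jcoef j : borelRn R d -> measurableTypeR R)).
  exact: open_borel.
by apply: measurable_fun_on_open => // y Wy; exact: jcoef_continuous.
Qed.

(** The Jacobian on [W] times the positive half-line; truncating [s] at 0 keeps it nonnegative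
    everywhere, as a density must be. *)
Definition Jfun (p : Y) : \bar R :=
  (\sum_(j < d.+1) acoef j p.1 * (Num.max (p.2 : R) 0) ^+ j)%:E.

Lemma Jfun_ge0 p : (0 <= Jfun p)%E.
Proof.
rewrite lee_fin; apply: sumr_ge0 => j _; rewrite mulr_ge0 ?acoef_ge0// exprn_ge0//.
by rewrite le_max lexx orbT.
Qed.

Lemma measurable_Jfun : measurable_fun setT Jfun.
Proof.
apply/measurable_EFinP; apply: measurable_sum => j; apply: measurable_funM.
  exact: (measurableT_comp (measurable_acoef j) measurable_fst).
apply: measurable_funX; apply: measurable_maxr => //.
Qed.

(** On a small box the Jacobian is constant up to a factor [1 + eta], and [local_volume] costs
    another such factor; [eta] is chosen with [(1 + eta)^2 <= k]. *)
Lemma smooth_local (nu rho : {measure set Y -> \bar R}) y s (k : R) :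
  (forall E, nu E = lebn d.+1 (touchset W om u E)) ->
  (forall E, rho E = \int[(leb d \x lam)%E]_(p in E) Jfun p)%E ->
  W y -> 0 < s -> 1 < k -> exists2 i, sbox i (y, s) & forall E, measurable E -> E `<=` sbox i ->
    (nu E <= k%:E * rho E /\ rho E <= k%:E * nu E)%E.
Proof.
move=> nuE rhoE Wy s0 k1.
have k10 : 0 < k - 1 by lra.
have [e /andP[e0 e1]] := expr_near1 2 k10; rewrite [1 + (k - 1)]addrC subrK => ek.
pose eta := 2 * e; have eta0 : 0 < eta by rewrite mulr_gt0.
have eta1 : 0 < 1 + eta by lra.
pose J0 := jacdet om A y s; have J00 : 0 < J0 by exact: jacdet_gt0.
have Lu : Psi_mx om A y s \in unitmx by rewrite unitmxE unitfE det_Psi_mx gt_eqF.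
have [r1 r10 h1] := local_volume Lu eta0 (fun j => Psi_sdiff oW hom u_sd g_sd s j Wy).
have jc : {for snoc y s, continuous jac} by apply: jac_continuous; rewrite rinit_snoc.
have jJ0 : jac (snoc y s) = J0 by rewrite /jac rinit_snoc rlast_snoc /J0 jacdet_sum.
(* This tolerance puts the Jacobian between [J0 / (1 + eta)] and [(1 + eta) J0]. *)
have e'0 : 0 < J0 * (eta / (1 + eta)) by rewrite mulr_gt0 ?divr_gt0.
have [r2 r20 h2] := continuous_at_rv jc e'0; rewrite jJ0 in h2.
have [r3 r30 h3] := open_ballP oW Wy.
(* Including [s] in the minimum keeps the last coordinate positive. *)
pose r := Num.min (Num.min r1 r2) (Num.min r3 s).
have r0 : 0 < r by rewrite !lt_min r10 r20 r30.
pose U : set 'rV[R]_d.+1 := [set Z | `|Z - snoc y s| < r].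
have oU : open U.
  apply: ballP_open => Z ZU; exists (r - `|Z - snoc y s|); first by rewrite subr_gt0.
  move=> Z' Z'Z; rewrite /U /=; have := ler_normD (Z' - Z) (Z - snoc y s).
  by rewrite addrA subrK; lra.
have Uys : U (snoc y s) by rewrite /U /= subrr normr0.
have [i iys iU] := qbox_basis oU Uys; exists i => // E mE Ei.
have EU Z : E (snoc_split Z) -> U Z.
  by move=> EZ; apply: iU; have := Ei _ EZ; rewrite /sbox /= snoc_rinit.
have Up Z : U Z -> [/\ `|Z - snoc y s| < r1, `|jac Z - J0| < J0 * (eta / (1 + eta)),
    W (rinit Z) & 0 < rlast Z].
  rewrite /U /= !lt_min => /andP[/andP[Z1 Z2] /andP[Z3 Z4]]; split => //.
  - by rewrite distrC; exact: h2.
  - apply: h3; apply: le_lt_trans Z3.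
    have -> : rinit Z - y = rinit (Z - snoc y s) by rewrite rinitB rinit_snoc.
    exact: rinit_norm_le.
  - have := le_lt_trans (rlast_norm_le _) Z4; rewrite rlastB rlast_snoc ltr_norml; lra.
pose S := [set Z : 'rV[R]_d.+1 | E (snoc_split Z)].
have [v1 v2] := h1 S (fun Z EZ => let: And4 a _ _ _ := Up Z (EU Z EZ) in a).
have PS : Psi om u g @` S = touchset W om u E.
  rewrite (touchset_Psi oW cW hom u_conv u_sd); congr (_ @` _).
  apply/seteqP; split=> Z; last by case.
  by move=> SZ; have [_ _ ? ?] := Up Z (EU Z SZ).
rewrite PS -nuE det_Psi_mx -/J0 (gtr0_norm J00) in v1 v2.
pose m : {measure set Y -> \bar R} := (leb d \x lam)%E.
have SE : lebn d.+1 S = m E by rewrite /S lebn_productE.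
rewrite SE in v1 v2.
have Jb p : E p -> (J0 / (1 + eta) <= \sum_(j < d.+1) acoef j p.1 * (Num.max (p.2 : R) 0) ^+ j) /\
    (\sum_(j < d.+1) acoef j p.1 * (Num.max (p.2 : R) 0) ^+ j <= (1 + eta) * J0).
  case: p => y' s' Ep; have ES : E (snoc_split (snoc y' s')) by rewrite /snoc_split rinit_snoc rlast_snoc.
  have [_ h _ _] := Up _ (EU _ ES); have [_ _ Wy' s'0] := Up _ (EU _ ES).
  rewrite rinit_snoc in Wy'; rewrite rlast_snoc in s'0.
  rewrite /= (eq_bigr (fun j => jcoef j y' * s' ^+ j)); last first.
    by move=> j _; rewrite acoefE// max_l// ltW.
  have jE : jac (snoc y' s') = \sum_(j < d.+1) jcoef j y' * s' ^+ j.
    by rewrite /jac rinit_snoc rlast_snoc.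
  rewrite jE in h; move: h; move: (\sum_(j < d.+1) _) => q; rewrite ltr_norml => /andP[q1 q2].
  have E1 : J0 / (1 + eta) = J0 - J0 * (eta / (1 + eta)) by field; rewrite gt_eqF.
  have E2 : J0 * (eta / (1 + eta)) <= J0 * eta.
    by rewrite ler_pM2l// ler_pdivrMr// mulrDr mulr1 lerDl mulr_ge0// ltW.
  split; first by rewrite E1 addrC -lerBrDr ltW.
  by rewrite mulrDl mul1r addrC -lerBlDr [eta * _]mulrC; exact: le_trans (ltW q2) E2.
have mJE : measurable_fun E Jfun by apply: measurable_funTS; exact: measurable_Jfun.
have w1 : (rho E <= ((1 + eta) * J0)%:E * m E)%E.
  rewrite rhoE -integral_cst//; apply: ge0_le_integral => //.
  - by move=> p _; exact: Jfun_ge0.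
  - by move=> p Ep; rewrite lee_fin; case: (Jb p Ep).
have w2 : ((J0 / (1 + eta))%:E * m E <= rho E)%E.
  rewrite rhoE -integral_cst//; apply: ge0_le_integral => //.
  - by move=> p _; rewrite lee_fin divr_ge0// ltW.
  - by move=> p Ep; rewrite lee_fin; case: (Jb p Ep).
have kk : (1 + eta) * (1 + eta) <= k by rewrite -expr2.
have ke (x : \bar R) : (0 <= x -> ((1 + eta) * (1 + eta))%:E * x <= k%:E * x)%E.
  by move=> x0; apply: lee_wpmul2r => //; rewrite lee_fin.
have ep : (0 <= (1 + eta)%:E)%E by rewrite lee_fin ltW.
split.
  apply: le_trans v1 _; apply: le_trans (ke _ (measure_ge0 _ _)).
  have -> : (((1 + eta) * J0)%:E * m E = ((1 + eta) * (1 + eta))%:E * ((J0 / (1 + eta))%:E * m E))%E.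
    by rewrite muleA -EFinM; congr (_%:E * _)%E; field; rewrite gt_eqF.
  by apply: lee_wpmul2l => //; rewrite lee_fin mulr_ge0// ltW.
apply: le_trans w1 _; apply: le_trans (ke _ (measure_ge0 _ _)).
by rewrite (EFinM (1 + eta) J0) (EFinM (1 + eta) (1 + eta)) -!muleA; apply: lee_wpmul2l.
Qed.

Lemma smooth_density (nu rho : {measure set Y -> \bar R}) :
  (forall E, nu E = lebn d.+1 (touchset W om u E)) ->
  (forall E, rho E = \int[(leb d \x lam)%E]_(p in E) Jfun p)%E ->
  forall E : set Y, measurable E -> (forall p, E p -> W p.1 /\ (0 < p.2 :> R)) -> nu E = rho E.
Proof.
move=> nuE rhoE E mE EW; apply/eqP; rewrite eq_le; apply/andP; split;
    apply: le_of_near1 => // k k1; have k0 : 0 <= k by lra.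
- apply: (local_to_global k0 _ mE EW) => -[y s] [/= Wy s0].
  have [i iys h] := smooth_local nuE rhoE Wy s0 k1; exists i => // E' mE' E'i.
  by have [] := h _ mE' E'i.
- apply: (local_to_global k0 _ mE EW) => -[y s] [/= Wy s0].
  have [i iys h] := smooth_local nuE rhoE Wy s0 k1; exists i => // E' mE' E'i.
  by have [] := h _ mE' E'i.
Qed.

Lemma smooth_steiner (b : set (borelRn R d)) (e : R) : measurable b -> b `<=` W -> 0 < e ->
  lebn d.+1 (touchset W om u (b `*` `]0%R, e[%classic)) =
  (\sum_(j < d.+1) (e ^+ j.+1 / j.+1%:R)%:E * \int[leb d]_(y in b) (acoef j y)%:E)%E.
Proof.
move=> mb bW e0.
have [nu nuE] := touch_measure_exists oW cW hom Wy0 WM (smooth_convex_on cW u_conv) (smooth_lsc_on u_sd).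
have [rho rhoE] := density_exists (leb d \x lam)%E measurable_Jfun Jfun_ge0.
pose I : set (measurableTypeR R) := `]0%R, e[%classic.
have mI : measurable I by exact: measurable_itv.
have mbI : measurable (b `*` I) by exact: measurableX.
rewrite -nuE (smooth_density nuE rhoE mbI); last first.
  by move=> [y s] [/= /bW Wy]; rewrite /I /= in_itv /= => /andP[s0 _]; split.
rewrite rhoE integral_mkcond fubini_tonelli1; first last.
- by move=> p; rewrite patchE; case: ifP => // _; exact: Jfun_ge0.
- apply/(measurable_restrictT Jfun mbI); apply: measurable_funTS; exact: measurable_Jfun.
have mac j : measurable_fun b (fun y => (acoef j y)%:E).
  by apply/measurable_EFinP; apply: measurable_funTS; exact: measurable_acoef.
transitivity (\int[leb d]_(y in b) (\sum_(j < d.+1) (e ^+ j.+1 / j.+1%:R)%:E * (acoef j y)%:E))%E.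
  rewrite [RHS]integral_mkcond; apply: eq_integral => y _; rewrite /fubini_F patchE.
  case: ifPn => [/set_mem yb|/negP yb]; last first.
    apply: integral0_eq => s _; rewrite patchE; case: ifPn => // /set_mem[/= by' _].
    by exfalso; apply: yb; exact: mem_set.
  transitivity (\int[lam]_(s in I) (\sum_(j < d.+1) (acoef j y)%:E * (s ^+ j)%:E))%E.
    rewrite [RHS]integral_mkcond; apply: eq_integral => s _; rewrite !patchE.
    have -> : ((y, s) \in b `*` I) = (s \in I).
      by apply/idP/idP => /set_mem => [[_ ?]|?]; apply: mem_set => //; split.
    case: ifPn => // /set_mem; rewrite /I /= in_itv /= => /andP[s0 _].
    rewrite /Jfun /= -sumEFin; apply: eq_bigr => j _.
    by rewrite max_l ?EFinM// ltW.
  have mX j : measurable_fun I (fun s : R => (s ^+ j)%:E).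
    by apply/measurable_EFinP; exact: exprn_measurable.
  have X0 j (s : R) : I s -> (0 <= (s ^+ j)%:E)%E.
    by rewrite /I /= in_itv /= => /andP[s0 _]; rewrite lee_fin exprn_ge0// ltW.
  rewrite ge0_integral_sum//.
  - apply: eq_bigr => j _; rewrite ge0_integralZl//; last by rewrite lee_fin acoef_ge0.
      by rewrite integral_pow// muleC.
    exact: X0.
  - by move=> j; apply: emeasurable_funM => //; exact: measurable_cst.
  - by move=> j s Is; apply: mule_ge0; [rewrite lee_fin acoef_ge0|exact: X0].
rewrite ge0_integral_sum//.
- apply: eq_bigr => j _; rewrite ge0_integralZl//.
  + by move=> y _; rewrite lee_fin acoef_ge0.
  + by rewrite lee_fin divr_ge0// exprn_ge0// ltW.
- by move=> j; apply: emeasurable_funM => //; exact: measurable_cst.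
- move=> j y _; apply: mule_ge0; last by rewrite lee_fin acoef_ge0.
  by rewrite lee_fin divr_ge0// exprn_ge0// ltW.
Qed.

End SmoothSteiner.

(** * Soft maxima *)

(** By convexity the chord slope between [a] and [b] lies between [expR a] and [expR b], which are
    both close to [expR x]. *)
Lemma expR_strict {R : realType} (x e : R) : 0 < e -> exists2 r : R, 0 < r &
  forall a b, `|a - x| < r -> `|b - x| < r -> `|expR a - expR b - expR x * (a - b)| <= e * `|a - b|.
Proof.
move=> e0; have /cvgrPdist_lt/(_ _ e0) := @continuous_expR R x.
move=> /nbhs_ballP[r /= r0 rh]; exists r => // a b ar br.
have ha : `|expR a - expR x| <= e by rewrite distrC ltW// rh// /ball /= distrC.
have hb : `|expR b - expR x| <= e by rewrite distrC ltW// rh// /ball /= distrC.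
have sub (s t : R) : expR s * (t - s) <= expR t - expR s.
  have : expR s * (1 + (t - s)) <= expR s * expR (t - s).
    by rewrite ler_pM2l ?expR_gt0// expR_ge1Dx.
  by rewrite -expRD [s + (t - s)]addrC subrK; lra.
have sab := sub a b; have sba := sub b a.
have ca : `|(expR a - expR x) * (a - b)| <= e * `|a - b| by rewrite normrM ler_wpM2r.
have cb : `|(expR b - expR x) * (a - b)| <= e * `|a - b| by rewrite normrM ler_wpM2r.
move: ca cb sab sba; move: (expR a) (expR b) (expR x) `|a - b| => p q s t.
rewrite !ler_norml; lra.
Qed.

Lemma coordB {R : realType} n (x y : 'rV[R]_n) j : (x - y) 0 j = x 0 j - y 0 j.
Proof. by rewrite !mxE. Qed.

(** Subgradients at both ends enclose [f z - f t] between [dotrv (g t) (z - t)] and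
    [dotrv (g z) (z - t)], and both are close to [dotrv (g y) (z - t)]. *)
Lemma sdiff_of_subgrad {R : realType} n (f : 'rV[R]_n -> R) (g : 'rV[R]_n -> 'rV[R]_n) y :
  (forall x z, f x + dotrv (g x) (z - x) <= f z) ->
  (forall j, {for y, continuous (fun x => g x 0 j)}) -> sdiff f (g y) y.
Proof.
move=> f_conv gc.
move=> e e0; pose e' := e / n.+1%:R.
have e'0 : 0 < e' by rewrite divr_gt0.
have /choice[r hr] (j : 'I_n) : exists r : R, 0 < r /\
    forall z, `|z - y| < r -> `|g z 0 j - g y 0 j| < e'.
  have [r r0 rh] := continuous_at_rv (gc j) e'0.
  by exists r; split; [exact: r0|move=> z zy; rewrite distrC; exact: (rh z zy)].
pose r0 := \big[Num.min/1]_j r j.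
have r00 : 0 < r0.
  by rewrite /r0; elim/big_ind: _ => // [a b a0 b0|j _]; [rewrite lt_min a0|case: (hr j)].
exists r0 => // z t zr tr.
have key w v : `|w - y| < r0 -> `|dotrv (g w) v - dotrv (g y) v| <= e * `|v|.
  move=> wr; rewrite -dotrvBl; apply: le_trans (dotrv_le _ _) _; apply: ler_wpM2r => //.
  apply: le_trans (_ : \sum_(j < n) e' <= _).
    apply: ler_sum => j _; rewrite coordB ltW//.
    case: (hr j) => _; apply; apply: lt_le_trans wr _.
    by rewrite /r0 (bigD1 j)//= ge_min lexx.
  rewrite sumr_const card_ord -mulr_natl /e' mulrCA; apply: ler_piMr; first exact: ltW.
  by rewrite ler_pdivrMr// mul1r ler_nat.
have := key z (z - t) zr; have := key t (z - t) tr.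
have := f_conv t z; have := f_conv z t.
have -> : dotrv (g z) (t - z) = - dotrv (g z) (z - t) by rewrite -dotrvNr opprB.
move: (dotrv (g z) _) (dotrv (g t) _) (dotrv (g y) _) `|z - t| (f z) (f t) => p q s N a b.
rewrite !ler_norml; lra.
Qed.

Lemma coordZ {R : realType} n (a : R) (x : 'rV[R]_n) j : (a *: x) 0 j = a * x 0 j.
Proof. by rewrite mxE. Qed.

Section Softmax.
Context {R : realType} {d : nat} (n : nat).
Variables (X : 'I_n.+1 -> 'rV[R]_d.+1) (beta : R).
Hypothesis beta0 : 0 < beta.
Implicit Types (y z v : 'rV[R]_d).

Definition smsum y : R := \sum_i expR (beta * lform y (X i)).

(* the soft maximum of the affine functions lform _ (X i), shifted below
   their maximum *)
Definition softmax y : R := beta^-1 * ln (smsum y) - beta^-1 * ln n.+1%:R.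

(** The usual quotient of exponentials, see [smweightE], but written through [softmax] so that its
    derivative comes from those of [expR] and [softmax]. *)
Definition smweight i y : R :=
  expR (beta * (lform y (X i) - softmax y) - ln n.+1%:R).

Definition smgrad y : 'rV[R]_d := \sum_i smweight i y *: rinit (X i).

(** [beta] times the covariance matrix of the vectors [rinit (X i)] under the weights. *)
Definition smhess y : 'M[R]_d := \matrix_(j, k) (beta *
  \sum_i smweight i y * ((rinit (X i) - smgrad y) 0 j * (rinit (X i) - smgrad y) 0 k)).

Lemma smsum_gt0 y : 0 < smsum y.
Proof.
rewrite /smsum big_ord_recl; apply: ltr_pwDl; first exact: expR_gt0.
by apply: sumr_ge0 => i _; exact: expR_ge0.
Qed.

Lemma smweightE i y : smweight i y = expR (beta * lform y (X i)) / smsum y.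
Proof.
rewrite /smweight /softmax.
have -> : beta * (lform y (X i) - (beta^-1 * ln (smsum y) - beta^-1 * ln n.+1%:R)) - ln n.+1%:R
  = beta * lform y (X i) - ln (smsum y) by field; rewrite gt_eqF.
by rewrite expRB lnK// posrE smsum_gt0.
Qed.

Lemma smweight_ge0 i y : 0 <= smweight i y. Proof. exact: expR_ge0. Qed.

Lemma smweight_sum y : \sum_i smweight i y = 1.
Proof.
under eq_bigr do rewrite smweightE.
by rewrite -mulr_suml divff// gt_eqF// smsum_gt0.
Qed.

Lemma dotrv_smgrad y v : dotrv v (smgrad y) = \sum_i smweight i y * dotrv v (rinit (X i)).
Proof.
rewrite /smgrad; elim/big_rec2: _ => [|i a b _ <-]; first by rewrite dotrv0r.
by rewrite dotrvDr dotrvZr.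
Qed.

Lemma softmax_ge i y : lform y (X i) - beta^-1 * ln n.+1%:R <= softmax y.
Proof.
rewrite /softmax lerD2r -ler_pdivrMl ?invr_gt0// invrK.
rewrite -ler_expR lnK ?posrE ?smsum_gt0// /smsum (bigD1 i)//= lerDl.
by apply: sumr_ge0 => j _; exact: expR_ge0.
Qed.

Lemma softmax_le y (m : R) : (forall i, lform y (X i) <= m) -> softmax y <= m.
Proof.
move=> hm; rewrite /softmax lerBlDr -ler_pdivlMl ?invr_gt0// invrK mulrDr mulVKf ?gt_eqF//.
rewrite -ler_expR expRD !lnK ?posrE ?smsum_gt0 ?ltr0Sn//.
apply: le_trans (_ : \sum_(i < n.+1) expR (beta * m) <= _); last first.
  by rewrite sumr_const card_ord mulr_natr.
by apply: ler_sum => i _; rewrite ler_expR ler_pM2l.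
Qed.

(* Jensen, through expR t >= expR a * (1 + t - a) *)
Lemma softmax_conv y z : softmax y + dotrv (smgrad y) (z - y) <= softmax z.
Proof.
set a := beta * dotrv (smgrad y) (z - y).
suff h : ln (smsum y) + a <= ln (smsum z).
  rewrite /softmax -subr_ge0.
  have -> : beta^-1 * ln (smsum z) - beta^-1 * ln n.+1%:R -
    (beta^-1 * ln (smsum y) - beta^-1 * ln n.+1%:R + dotrv (smgrad y) (z - y)) =
    beta^-1 * (ln (smsum z) - (ln (smsum y) + a)) by rewrite /a; field; rewrite gt_eqF.
  by apply: mulr_ge0; [rewrite invr_ge0 ltW|rewrite subr_ge0].
rewrite -ler_expR expRD !lnK ?posrE ?smsum_gt0//.
have aE : a = \sum_i smweight i y * (beta * dotrv (z - y) (rinit (X i))).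
  rewrite /a dotrvC dotrv_smgrad mulr_sumr; apply: eq_bigr => i _; by ring.
have -> : smsum z = smsum y * \sum_i smweight i y * expR (beta * dotrv (z - y) (rinit (X i))).
  rewrite mulr_sumr; apply: eq_bigr => i _; rewrite smweightE -lformBl.
  have : expR (beta * lform z (X i)) =
    expR (beta * lform y (X i)) * expR (beta * (lform z (X i) - lform y (X i))).
    by rewrite -expRD; congr expR; ring.
  by move=> ->; field; rewrite gt_eqF// smsum_gt0.
rewrite ler_pM2l ?smsum_gt0//.
have -> : expR a = \sum_i smweight i y * (expR a * (1 + (beta * dotrv (z - y) (rinit (X i)) - a))).
  transitivity (expR a * (\sum_i smweight i y * (1 - a) +
    \sum_i smweight i y * (beta * dotrv (z - y) (rinit (X i))))).
    by rewrite -mulr_suml smweight_sum -aE; ring.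
  by rewrite -big_split mulr_sumr; apply: eq_bigr => i _ /=; ring.
apply: ler_sum => i _; apply: ler_wpM2l; first exact: smweight_ge0.
set t := beta * _.
have : expR a * (1 + (t - a)) <= expR a * expR (t - a).
  by rewrite ler_pM2l ?expR_gt0// expR_ge1Dx.
by rewrite -expRD [a + _]addrC subrK.
Qed.

Lemma lform_sdiff (Y : 'rV[R]_d.+1) y : sdiff (fun z => lform z Y) (rinit Y) y.
Proof.
rewrite -[rinit Y]addr0; apply: sdiffD; last exact: sdiff_cst.
by apply: sdiff_linear => z; rewrite dotrvC.
Qed.

Lemma smsum_continuous : continuous smsum.
Proof.
move=> y; apply: continuous_sum_at => i; apply: continuous_comp; last exact: continuous_expR.
by apply: continuousM; [exact: cst_continuous|exact: sdiff_continuous (lform_sdiff _ _)].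
Qed.

Lemma smweight_continuous i : continuous (smweight i).
Proof.
move=> y; rewrite (_ : smweight i = fun y => expR (beta * lform y (X i)) * (smsum y)^-1); last first.
  by apply/funext => z; rewrite smweightE.
apply: (@continuousM _ _ (fun y => expR (beta * lform y (X i))) (fun y => (smsum y)^-1)).
  apply: continuous_comp; last exact: continuous_expR.
  by apply: continuousM; [exact: cst_continuous|exact: sdiff_continuous (lform_sdiff _ _)].
by apply: continuousV; [rewrite gt_eqF// smsum_gt0|exact: smsum_continuous].
Qed.

Lemma smgrad_coord j y : smgrad y 0 j = \sum_i smweight i y * rinit (X i) 0 j.
Proof. by rewrite summxE; apply: eq_bigr => i _; rewrite [LHS]mxE. Qed.

Lemma smgrad_coord_continuous j : continuous (fun y => smgrad y 0 j).
Proof.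
move=> y; rewrite (_ : (fun y => _) = fun y => \sum_i smweight i y * rinit (X i) 0 j); last first.
  by apply/funext => z; exact: smgrad_coord.
apply: continuous_sum_at => i; apply: continuousM; last exact: cst_continuous.
exact: smweight_continuous.
Qed.

Lemma softmax_sdiff y : sdiff softmax (smgrad y) y.
Proof.
apply: sdiff_of_subgrad; first exact: softmax_conv.
by move=> j; exact: smgrad_coord_continuous.
Qed.

Lemma smweight_sdiff i y :
  sdiff (smweight i) (smweight i y *: (beta *: (rinit (X i) - smgrad y))) y.
Proof.
apply: (@sdiff_comp _ _ (fun y => beta * (lform y (X i) - softmax y) - ln n.+1%:R) _ _ expR); last first.
  exact: expR_strict.
rewrite -[_ *: _]addr0; apply: sdiffD; last exact: sdiff_cst.
apply: sdiffZ; apply: sdiffD; first exact: lform_sdiff.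
by apply: sdiffN; exact: softmax_sdiff.
Qed.

Lemma smgrad_sdiff j y : sdiff (fun z => smgrad z 0 j) (\row_k smhess y k j) y.
Proof.
rewrite (_ : (fun y => _) = fun y => \sum_i rinit (X i) 0 j * smweight i y); last first.
  by apply/funext => z; rewrite smgrad_coord; apply: eq_bigr => i _; rewrite mulrC.
have -> : \row_k smhess y k j = \sum_i rinit (X i) 0 j *: (smweight i y *: (beta *: (rinit (X i) - smgrad y))).
  apply/rowP => k; rewrite [LHS]mxE [LHS]mxE summxE mulr_sumr.
  (* Deviations from the mean have weighted sum 0, so subtracting [smgrad y 0 j] in one factor does
     not change the covariance. *)
  have z0 : \sum_i smweight i y * (rinit (X i) - smgrad y) 0 k = 0.
    rewrite (eq_bigr (fun i => smweight i y * rinit (X i) 0 k - smweight i y * smgrad y 0 k)).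
      by rewrite big_split /= sumrN -mulr_suml smweight_sum mul1r -smgrad_coord subrr.
    by move=> i _; rewrite coordB mulrBr.
  apply/eqP; rewrite -subr_eq0 -sumrB.
  rewrite (eq_bigr (fun i => (- beta * smgrad y 0 j) * (smweight i y * (rinit (X i) - smgrad y) 0 k))).
    by rewrite -mulr_sumr z0 mulr0.
  move=> i _; rewrite !coordZ.
  rewrite (coordB _ _ j); ring.
by apply: sdiff_sum => i; apply: sdiffZ; exact: smweight_sdiff.
Qed.

Lemma smhess_sym y j k : smhess y j k = smhess y k j.
Proof.
rewrite [LHS]mxE [RHS]mxE; congr (_ * _); apply: eq_bigr => i _.
by rewrite [X in _ * X]mulrC.
Qed.

Lemma smhess_psd y v : 0 <= dotrv v (v *m smhess y).
Proof.
have -> : dotrv v (v *m smhess y) =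
    beta * \sum_i smweight i y * (dotrv v (rinit (X i) - smgrad y)) ^+ 2.
  transitivity (\sum_j \sum_k \sum_i beta * (smweight i y *
    (v 0 j * v 0 k * ((rinit (X i) - smgrad y) 0 j * (rinit (X i) - smgrad y) 0 k)))).
    apply: eq_bigr => k _; rewrite mxE mulr_sumr; apply: eq_bigr => j _.
    by rewrite [smhess y j k]mxE mulrA mulrCA mulr_sumr mulr_sumr; apply: eq_bigr => i _; ring.
  rewrite mulr_sumr; under eq_bigr do rewrite exchange_big.
  rewrite exchange_big; apply: eq_bigr => i _ /=.
  rewrite expr2 /dotrv mulr_suml !mulr_sumr; apply: eq_bigr => j _.
  by rewrite !mulr_sumr; apply: eq_bigr => k _; ring.
apply: mulr_ge0; first exact: ltW.
by apply: sumr_ge0 => i _; rewrite mulr_ge0 ?smweight_ge0// sqr_ge0.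
Qed.

Lemma smhess_continuous j k : continuous (fun y => smhess y j k).
Proof.
move=> y; rewrite (_ : (fun y => _) = fun y => beta * \sum_i smweight i y *
    ((rinit (X i) 0 j - smgrad y 0 j) * (rinit (X i) 0 k - smgrad y 0 k))); last first.
  apply/funext => z; rewrite [LHS]mxE; congr (_ * _); apply: eq_bigr => i _.
  by rewrite !coordB.
have c i l : {for y, continuous (fun y => rinit (X i) 0 l - smgrad y 0 l)}.
  by apply: continuousB; [exact: cst_continuous|exact: smgrad_coord_continuous].
apply: continuousM; first exact: cst_continuous.
apply: continuous_sum_at => i; apply: continuousM; first exact: smweight_continuous.
by apply: continuousM; exact: c.
Qed.

End Softmax.

(** * Stability of touching pairs under soft maxima *)

Section Approximation.
Context {R : realType} {d : nat}.
Hypothesis d0 : (0 < d)%N.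
Variables (W : set 'rV[R]_d) (om : 'rV[R]_d -> R) (y0 : 'rV[R]_d) (MW : R).
Hypotheses (oW : open W) (cW : convex_set W) (hom : cheng_yau W om).
Hypotheses (Wy0 : W y0) (WM : forall y, W y -> `|y| <= MW).
Variables (u : 'rV[R]_d -> R) (Xs : nat -> 'rV[R]_d.+1).
Hypotheses (cu : convex_on W u) (lu : lsc_on W u).
Hypothesis Xs_le : forall i y, W y -> lform y (Xs i) <= u y.
Hypothesis Xs_sup : forall y (e : R), W y -> 0 < e -> exists i, u y - e < lform y (Xs i).
Hypothesis Xs_dense : forall p, gap_domain W u p -> exists i, exists2 c : R, 0 < c &
  forall y, W y -> c <= lform y (Xs i) - lform y p.

Lemma invS_small (e : R) : 0 < e -> exists N, forall k, (N <= k)%N -> k.+1%:R^-1 < e :> R.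
Proof.
move=> e0; exists (Num.truncn e^-1) => k Nk.
rewrite invf_plt ?posrE//; have e1 : 0 <= e^-1 by rewrite invr_ge0 ltW.
have /andP[_ h] := truncn_itv e1; apply: lt_le_trans h _.
by rewrite ler_nat ltnS.
Qed.

(** Quadratic growth makes the defect [ln (k + 1) / beta] of the soft maximum at most
    [1 / (k + 1)]. *)
Definition smpar k : R := k.+1%:R ^+ 2.

Lemma smpar_gt0 k : 0 < smpar k. Proof. by rewrite exprn_gt0. Qed.

Definition smapprox k : 'rV[R]_d -> R := softmax (fun i : 'I_k.+1 => Xs i) (smpar k).

Lemma smapprox_le k y : W y -> smapprox k y <= u y.
Proof. by move=> Wy; apply: softmax_le; [exact: smpar_gt0|move=> i; exact: Xs_le]. Qed.

Lemma smapprox_ge i k y : (i <= k)%N -> lform y (Xs i) - k.+1%:R^-1 <= smapprox k y.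
Proof.
rewrite -ltnS => ik.
have := softmax_ge (fun i : 'I_k.+1 => Xs i) (smpar_gt0 k) (Ordinal ik) y.
apply: le_trans; rewrite /= lerD2l lerN2 /smpar.
rewrite ler_pdivrMl ?exprn_gt0// expr2 -mulrA divff ?pnatr_eq0// mulr1.
by rewrite ltW// ln_sublinear.
Qed.

Lemma smapprox_gap_domain k : gap_domain W (smapprox k) `<=` gap_domain W u.
Proof.
move=> p [c c0 h]; exists c => // y Wy; apply: le_trans (h _ Wy) _.
by rewrite /gap lerD2r; exact: smapprox_le.
Qed.

Lemma smapprox_conv k : convex_on W (smapprox k).
Proof. by apply: smooth_convex_on => // y z _ _; apply: softmax_conv; exact: smpar_gt0. Qed.

Lemma smapprox_sdiff k y : sdiff (smapprox k) (smgrad (fun i : 'I_k.+1 => Xs i) (smpar k) y) y.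
Proof. by apply: softmax_sdiff; exact: smpar_gt0. Qed.

Lemma smapprox_lsc k : lsc_on W (smapprox k).
Proof. by apply: smooth_lsc_on => y _; exact: smapprox_sdiff. Qed.

Lemma smapprox_steiner k : exists a : 'I_d.+1 -> borelRn R d -> measurableTypeR R,
  [/\ forall j, measurable_fun setT (a j), forall j y, 0 <= a j y,
    forall y, W y -> a ord_max y = (- om y) ^- d.+1 &
    forall (b : set (borelRn R d)) (e : R), measurable b -> b `<=` W -> 0 < e ->
      lebn d.+1 (touchset W om (smapprox k) (b `*` `]0%R, e[%classic)) =
      (\sum_(j < d.+1) (e ^+ j.+1 / j.+1%:R)%:E * \int[leb d]_(y in b) (a j y)%:E)%E].
Proof.
have [al hal] := @interpolation R d.+1.
pose X := fun i : 'I_k.+1 => Xs i; have bk := smpar_gt0 k.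
pose g := smgrad X (smpar k); pose A := smhess X (smpar k).
have A_sym y i j : W y -> A y i j = A y j i by move=> _; exact: smhess_sym.
have A_psd y v : W y -> 0 <= dotrv v (v *m A y) by move=> _; exact: smhess_psd.
have A_cont y i j : W y -> {for y, continuous (fun z => A z i j)}.
  by move=> _; exact: smhess_continuous.
have u_conv y z : W y -> W z -> smapprox k y + dotrv (g y) (z - y) <= smapprox k z.
  by move=> _ _; exact: softmax_conv.
have u_sd y : W y -> sdiff (smapprox k) (g y) y by move=> _; exact: softmax_sdiff.
have g_sd y j : W y -> sdiff (fun z => g z 0 j) (\row_i A y i j) y.
  by move=> _; exact: smgrad_sdiff.
exists (acoef W om A al); split.
- by move=> j; apply: measurable_acoef.
- by move=> j y; apply: (acoef_ge0 oW hom A_sym A_psd hal).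
- by move=> y Wy; rewrite acoefE// (jcoef_max hom A hal).
- move=> b e mb bW e0.
  exact: (smooth_steiner d0 oW cW hom Wy0 WM u_conv u_sd g_sd A_sym A_psd A_cont hal).
Qed.

(** One point [Xs i] with [lform z (Xs i)] above [lform z X] by [c] for all [z] gives the
    approximations, from some index on, gaps of at least [c / 2] at [X]; this is the uniform bound
    that [touch_cvg] requires. *)
Lemma smapprox_foot X y s : touch W om u X y s -> forall e : R, 0 < e -> exists N,
  forall k, (N <= k)%N -> exists y' s', touch W om (smapprox k) X y' s' /\
    `|y' - y| < e /\ `|s' - s| < e.
Proof.
move=> t e e0; have DX := touch_gap_domain oW cW hom cu t.
have [i [c c0 hc]] := Xs_dense DX.
have c20 : 0 < c / 2 by rewrite divr_gt0.
have [N1 hN1] := invS_small c20; pose N0 := maxn i N1.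
have gap_ge k z : (N0 <= k)%N -> W z -> c / 2 <= gap (smapprox k) z X.
  rewrite geq_max => /andP[ik Nk] Wz; have := smapprox_ge z ik.
  by have := hc _ Wz; have := hN1 _ Nk; rewrite /gap; move: (_^-1) => q; lra.
have /choice[p pP] k : exists p : 'rV[R]_d * R,
    (N0 <= k)%N -> touch W om (smapprox k) X p.1 p.2.
  case: (leqP N0 k) => [Nk|_]; last by exists (0, 0).
  have [|y' [s' t']] := @touch_exists R d W om y0 MW oW hom Wy0 WM (smapprox k) X (@smapprox_lsc k).
    by exists (c / 2) => // z Wz; exact: gap_ge.
  by exists (y', s').
have [|||||||||N hN] := @touch_cvg R d W om y0 MW oW cW hom Wy0 WM u X smapprox (fun=> X)
   (fun k => (p k).1) (fun k => (p k).2) (fun=> 0) _ _ _ _ (c / 2) N0 c20 _ _ _ _ _ y s cu t e e0.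
- by move=> z e' Wz e'0; exists 0%N => k _; have := smapprox_le k Wz; lra.
- move=> z e' Wz e'0; have e30 : 0 < e' / 3 by rewrite divr_gt0.
  have [j hj] := Xs_sup Wz e30; have [r r0 hr] := sdiff_near (lform_sdiff (Xs j) z) e30.
  have [N2 hN2] := invS_small e30.
  exists r => //; exists (maxn j N2) => k w; rewrite geq_max => /andP[jk Nk] Ww wz.
  have := smapprox_ge w jk; have := hN2 _ Nk; have := hr _ wz.
  by rewrite /= ltr_norml => /andP[]; move: hj; move: (k.+1%:R^-1) => q; lra.
- by move=> e' e'0; exists 0%N => k _; rewrite subrr normr0.
- by move=> e' e'0; exists 0%N.
- by move=> k z Nk Wz; exact: gap_ge.
- by move=> k Nk; have [] := pP k Nk.
- by move=> k Nk; have [] := pP k Nk.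
- by move=> k z Nk Wz; have [_ _ _] := pP k Nk; apply.
- by move=> k Nk; have [_ _ ->] := pP k Nk.
exists (maxn N0 N) => k; rewrite geq_max => /andP[N0k Nk].
by exists (p k).1, (p k).2; split; [exact: pP|exact: hN].
Qed.

(** Pointwise input for [measure_eventually_gt]. *)
Lemma smapprox_foot_open (B : set ('rV[R]_d * R)) X :
  (forall y s, B (y, s) -> exists2 e : R, 0 < e & forall y' s',
     `|(y' : 'rV[R]_d) - y| < e -> `|s' - s| < e -> B (y', s')) ->
  touchset W om u B X -> exists N, forall k, (N <= k)%N -> touchset W om (smapprox k) B X.
Proof.
move=> oB [y [s [t Bys]]]; have [e e0 he] := oB _ _ Bys.
have [N hN] := smapprox_foot t e0; exists N => k /hN[y' [s' [t' [h1 h2]]]].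
by exists y', s'; split => //; exact: he.
Qed.

(** Pointwise input for [measure_eventually_lt]; the enlargement by [r] absorbs the distance between
    approximate and limit pairs. *)
Lemma smapprox_foot_near (B' B : set ('rV[R]_d * R)) (r : R) X : 0 < r ->
  (forall y s y' s', B' (y', s') -> W y -> 0 < s -> `|(y' : 'rV[R]_d) - y| < r -> `|s' - s| < r -> B (y, s)) ->
  (forall N, exists2 k, (N <= k)%N & touchset W om (smapprox k) B' X) -> touchset W om u B X.
Proof.
move=> r0 BB h; have DX : gap_domain W u X.
  have [k _ [y [s [t _]]]] := h 0%N; apply: (@smapprox_gap_domain k).
  exact: (touch_gap_domain oW cW hom (@smapprox_conv k) t).
have [y [s t]] := touch_exists oW hom Wy0 WM lu DX.
have [N hN] := smapprox_foot t r0; have [k Nk [y1 [s1 [t1 B1]]]] := h N.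
have [y2 [s2 [t2 [h1 h2]]]] := hN _ Nk.
have [e1 e2] := touch_unique oW cW hom (@smapprox_conv k) t1 t2.
subst y2 s2; exists y, s; split=> //; have [Wy s0 _ _] := t; exact: BB B1 Wy s0 h1 h2.
Qed.

End Approximation.

(** * Passage to the limit *)

Section MeasureLimits.
Context {dsp : measure_display} {T : measurableType dsp} {R : realType}.
Variable mu : {measure set T -> \bar R}.

Lemma measure_increasing_gt (F : nat -> set T) (c : \bar R) : (forall k, measurable (F k)) ->
  nondecreasing_seq F -> (c < mu (\bigcup_k F k))%E -> exists N, (c < mu (F N))%E.
Proof.
move=> mF ndF cE.
have mU : measurable (\bigcup_k F k) by exact: bigcup_measurable.
have nd : nondecreasing_seq (mu \o F).
  by move=> i j ij /=; apply: le_measure; rewrite ?inE//; apply/subsetPset; exact: ndF.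
have h1 := @nondecreasing_cvg_mu _ _ _ mu F mF mU ndF; have h2 := ereal_nondecreasing_cvgn nd.
move: cE; rewrite (cvg_unique _ h1 h2)// => /ereal_sup_gt[_ [N _ <-]] h.
by exists N.
Qed.

Lemma measure_decreasing_lt (F : nat -> set T) (c : \bar R) : (forall k, measurable (F k)) ->
  (mu (F 0%N) < +oo)%E -> nonincreasing_seq F -> (mu (\bigcap_k F k) < c)%E ->
  exists N, (mu (F N) < c)%E.
Proof.
move=> mF Foo niF cE.
have mI : measurable (\bigcap_k F k) by exact: bigcap_measurable.
have ni : nonincreasing_seq (mu \o F).
  by move=> i j ij /=; apply: le_measure; rewrite ?inE//; apply/subsetPset; exact: niF.
have h1 := nonincreasing_cvg_mu Foo mF mI niF; have h2 := ereal_nonincreasing_cvgn ni.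
move: cE; rewrite (cvg_unique _ h1 h2)// => /ereal_inf_lt[_ [N _ <-]] h.
by exists N.
Qed.

(** Fatou's lemma for sets: [E] is contained in the lower limit of [F]. *)
Lemma measure_eventually_gt (E : set T) (F : nat -> set T) (c : \bar R) :
  measurable E -> (forall k, measurable (F k)) ->
  (forall x, E x -> exists N, forall k, (N <= k)%N -> F k x) -> (c < mu E)%E ->
  exists N, forall k, (N <= k)%N -> (c < mu (F k))%E.
Proof.
move=> mE mF h cE; pose G N := E `&` \bigcap_(k in [set k | (N <= k)%N]) F k.
have mG N : measurable (G N) by apply: measurableI => //; exact: bigcap_measurableType.
have EG : \bigcup_N G N = E.
  apply/seteqP; split=> x; first by case=> N _ [].
  by move=> Ex; have [N hN] := h _ Ex; exists N.
have ndG : nondecreasing_seq G.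
  move=> i j ij; apply/subsetPset => x [Ex hx]; split=> // k /= jk; apply: hx => /=.
  exact: leq_trans jk.
rewrite -EG in cE; have [N hN] := measure_increasing_gt mG ndG cE.
exists N => k Nk; apply: lt_le_trans hN _; apply: le_measure; rewrite ?inE// => x [_]; exact.
Qed.

(** The reverse Fatou lemma for sets: the upper limit of [F] is contained in [E], and [D] of finite
    measure dominates. *)
Lemma measure_eventually_lt (E D : set T) (F : nat -> set T) (c : \bar R) :
  measurable E -> measurable D -> (forall k, measurable (F k)) -> (mu D < +oo)%E ->
  (forall k, F k `<=` D) ->
  (forall x, (forall N, exists2 k, (N <= k)%N & F k x) -> E x) -> (mu E < c)%E ->
  exists N, forall k, (N <= k)%N -> (mu (F k) < c)%E.
Proof.
move=> mE mD mF Doo FD h cE; pose G N := \bigcup_(k in [set k | (N <= k)%N]) F k.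
have mG N : measurable (G N) by exact: bigcup_measurable.
have Goo : (mu (G 0%N) < +oo)%E.
  by apply: le_lt_trans Doo; apply: le_measure; rewrite ?inE// => x [k _ /FD].
have niG : nonincreasing_seq G.
  by move=> i j ij; apply/subsetPset => x [k /= jk Fx]; exists k => //=; exact: leq_trans jk.
have [|N hN] := measure_decreasing_lt mG Goo niG (c := c).
  apply: le_lt_trans cE; apply: le_measure; rewrite ?inE//; first exact: bigcap_measurable.
  by move=> x hx; apply: h => N; have [k] := hx N I; exists k.
exists N => k Nk; apply: le_lt_trans hN; apply: le_measure; rewrite ?inE// => x Fx.
by exists k.
Qed.

End MeasureLimits.

(** * Outer regularity of finite Borel measures *)

Section Regularity.
Context {R : realType} {n : nat}.
Variable mu : {measure set (borelRn R n) -> \bar R}.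
Hypothesis mu_fin : (mu setT < +oo)%E.
Implicit Types (U b : set 'rV[R]_n).

Definition erode U (r : R) : set 'rV[R]_n := [set x | forall y, `|y - x| < r -> U y].

Lemma erode_subset U r : 0 < r -> erode U r `<=` U.
Proof. by move=> r0 x; apply; rewrite subrr normr0. Qed.

Lemma closed_erode U r : closed (erode U r).
Proof.
rewrite -[erode U r]setCK; apply: open_closedC; apply: ballP_open => x /existsNP[y /not_implyP[yx Uy]].
exists (r - `|y - x|); first by rewrite subr_gt0.
move=> z zx; apply/existsNP; exists y; apply/not_implyP; split=> //.
by have := ler_distD x y z; rewrite (distrC x z); lra.
Qed.

Lemma erode_mono U r r' : r' <= r -> erode U r `<=` erode U r'.
Proof. by move=> rr x h y yx; apply: h; exact: lt_le_trans yx rr. Qed.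

Lemma erode_near U x : open U -> U x -> exists N, forall k, (N <= k)%N -> erode U k.+1%:R^-1 x.
Proof.
move=> oU Ux; have [r r0 h] := open_ballP oU Ux; have [N hN] := invS_small r0.
by exists N => k Nk y yx; apply: h; apply: lt_trans yx (hN _ Nk).
Qed.

(** Inner and outer approximation are recorded together because complements exchange them. *)
Definition squeezed b := forall e : R, 0 < e -> exists F U,
  [/\ closed F, open U, F `<=` b, b `<=` U &
      (mu ((U : set (borelRn R n)) `\` F) <= e%:E)%E].

Let fin b : measurable (b : set (borelRn R n)) -> (mu b < +oo)%E.
Proof. by move=> mb; apply: le_lt_trans mu_fin; apply: le_measure; rewrite ?inE. Qed.

Lemma squeezed_open U : open U -> squeezed U.
Proof.
move=> oU e e0; pose F k : set (borelRn R n) := (U : set (borelRn R n)) `\` erode U k.+1%:R^-1.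
have mF k : measurable (F k).
  by apply: measurableD; [exact: open_borel|apply: closed_borel; exact: closed_erode].
have [||N hN] := @measure_decreasing_lt _ _ _ mu F e%:E mF (fin (mF 0%N)).
- move=> i j ij; apply/subsetPset => x [Ux nx]; split=> // h; apply: nx.
  by apply: erode_mono h; rewrite lef_pV2 ?posrE// ler_nat.
- rewrite (_ : \bigcap_k F k = set0) ?measure0 ?lte_fin//.
  rewrite -subset0 => x hx; have [Ux _] := hx 0%N I; have [N hN] := erode_near oU Ux.
  by have [_] := hx N I; apply; exact: hN.
exists (erode U N.+1%:R^-1), U; split=> //; first exact: closed_erode.
- by apply: erode_subset; rewrite invr_gt0.
- exact: ltW.
Qed.

Lemma squeezed_setC b : squeezed b -> squeezed (setT `\` b).
Proof.
move=> h e /h[F [U [cF oU Fb bU m]]]; exists (~` U), (~` F); split.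
- exact: open_closedC.
- exact: closed_openC.
- by move=> x Ux; split=> // /bU.
- by move=> x [_ bx] /Fb.
- by rewrite setDE setCK setIC -setDE.
Qed.

Lemma squeezed_bigcup (b : nat -> set 'rV[R]_n) : (forall i, squeezed (b i)) ->
  squeezed (\bigcup_i b i).
Proof.
move=> h e e0; have e20 : 0 < e / 2 by rewrite divr_gt0.
have /choice[p pP] i : exists p : set 'rV[R]_n * set 'rV[R]_n, [/\ closed p.1, open p.2,
    p.1 `<=` b i, b i `<=` p.2 &
    (mu ((p.2 : set (borelRn R n)) `\` p.1) <= (e / 2 / (2 ^ i.+1)%:R)%:E)%E].
  have [|F [U ?]] := h i (e / 2 / (2 ^ i.+1)%:R); last by exists (F, U).
  by rewrite divr_gt0// ltr0n expn_gt0.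
pose F i : set (borelRn R n) := (p i).1; pose U i : set (borelRn R n) := (p i).2.
have mF i : measurable (F i) by apply: closed_borel; case: (pP i).
have mU i : measurable (U i) by apply: open_borel; case: (pP i).
have mUF i : measurable (U i `\` F i) by exact: measurableD.
pose FU : set (borelRn R n) := \bigcup_i F i; pose UU : set (borelRn R n) := \bigcup_i U i.
have mFU : measurable FU by exact: bigcup_measurable.
have mUU : measurable UU by exact: bigcup_measurable.
(* An infinite union of closed sets need not be closed, so only finitely many are kept; the rest
   costs at most [e / 2]. *)
pose G k : set (borelRn R n) := \big[setU/set0]_(i < k) F i.
have mG k : measurable (G k) by apply: bigsetU_measurable => i _; exact: mF.
pose D k : set (borelRn R n) := FU `\` G k.
have mD k : measurable (D k) by exact: measurableD.
have [||N hN] := @measure_decreasing_lt _ _ _ mu D (e / 2)%:E mD (fin (mD 0%N)).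
- move=> i j ij; apply/subsetPset => x [? nx]; split=> // h'; apply: nx.
  by move: h'; rewrite /G -!bigcup_mkord => -[l /= li Fx]; exists l => //=; exact: leq_trans ij.
- rewrite (_ : \bigcap_k D k = set0) ?measure0 ?lte_fin//.
  rewrite -subset0 => x hx; have [[i _ Fx] _] := hx 0%N I; have [_] := hx i.+1 I; apply.
  by rewrite /G -bigcup_mkord; exists i => //=.
exists (G N), UU; split.
- rewrite /G; apply: closed_bigsetU => i _; by case: (pP i).
- by apply: bigcup_open => i _; case: (pP i).
- by rewrite /G -bigcup_mkord => x [i _ Fx]; exists i => //; case: (pP i) => _ _ + _ _; exact.
- by move=> x [i _ bx]; exists i => //; case: (pP i) => _ _ _ + _; exact.
have sub : UU `\` G N `<=` (UU `\` FU) `|` D N.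
  move=> x [Ux Gx]; have [Fx|Fx] := pselect (FU x); [by right|by left].
have mUD : measurable (UU `\` FU) by exact: measurableD.
apply: le_trans (_ : mu (UU `\` FU) + mu (D N) <= _)%E.
  apply: le_trans (measureU2 _ mUD (mD N)); apply: le_measure; rewrite ?inE//.
  - exact: measurableD.
  - exact: measurableU.
have -> : e%:E = ((e / 2)%:E + (e / 2)%:E)%E by rewrite -EFinD; congr EFin; field.
apply: leeD; last exact: ltW.
apply: le_trans (_ : \sum_(i <oo) mu (U i `\` F i) <= _)%E.
  apply: measure_sigma_subadditive => // x [[i _ Ux] Fx]; exists i => //; split=> // Fi.
  by apply: Fx; exists i.
apply: le_trans (epsilon_trick0 xpredT (ltW e20)).
by apply: lee_nneseries => i _ //; case: (pP i).
Qed.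

Lemma borel_outer_regular (b : set (borelRn R n)) (e : R) : measurable b -> 0 < e ->
  exists U : set 'rV[R]_n, [/\ open U, b `<=` U & (mu ((U : set (borelRn R n)) `\` b) <= e%:E)%E].
Proof.
move=> mb e0; have : squeezed b.
  move: b mb; apply: smallest_sub; last exact: squeezed_open.
  split.
  - exact/squeezed_open/open0.
  - exact: squeezed_setC.
  - exact: squeezed_bigcup.
move=> /(_ _ e0)[F [U [cF oU Fb bU m]]]; exists U; split=> //.
apply: le_trans m; apply: le_measure; rewrite ?inE.
- by apply: measurableD => //; exact: open_borel.
- by apply: measurableD; [exact: open_borel|exact: closed_borel].
- by move=> x [Ux bx]; split=> // /Fb.
Qed.

End Regularity.

Section SteinerPolynomials.
Context {R : realType} {d : nat}.
Implicit Types (c q : 'rV[R]_d.+1).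

(** Volumes are polynomials without constant term in the radius [e], hence the shift between index
    and exponent. *)
Definition spoly c (e : R) : R := \sum_(j < d.+1) c 0 j * e ^+ j.+1.

Lemma spoly_near c q (e r : R) : 0 <= e -> `|c - q| <= r ->
  `|spoly c e - spoly q e| <= r * \sum_(j < d.+1) e ^+ j.+1.
Proof.
move=> e0 cq; rewrite /spoly -sumrB mulr_sumr.
apply: le_trans (ler_norm_sum _ _ _) _; apply: ler_sum => j _.
rewrite -mulrBl normrM [X in _ * X]ger0_norm ?exprn_ge0//; apply: ler_wpM2r; first exact: exprn_ge0.
by rewrite -coordB; apply: le_trans cq; exact: rv_coord_le.
Qed.

Lemma spoly_continuous c : continuous (spoly c).
Proof.
rewrite (_ : spoly c = horner (\sum_(j < d.+1) c 0 j *: 'X^(j.+1))); first exact: continuous_horner.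
apply/funext => e; rewrite horner_sum; apply: eq_bigr => j _.
by rewrite hornerZ hornerXn.
Qed.

(** Nonnegative coefficients are bounded by the value at 1, so the coefficient vectors have a
    cluster point, and the values at every [e] follow. *)
Lemma spoly_cluster (c : nat -> 'rV[R]_d.+1) (M : R) :
  (forall k j, 0 <= c k 0 j) -> (forall k, spoly (c k) 1 <= M) ->
  exists q, [/\ forall j, 0 <= q 0 j,
    forall (e r : R) N, 0 <= e -> 0 < r -> exists2 k, (N <= k)%N & `|spoly (c k) e - spoly q e| < r &
    forall j (r : R) N, 0 < r -> exists2 k, (N <= k)%N & `|c k 0 j - q 0 j| < r].
Proof.
move=> c0 cM.
have [|k _|q hq] := @bounded_cluster R d.+1 c setT `|M|.
- by move=> N; exists N.
- apply/rv_norm_leP => // j; rewrite ger0_norm//; apply: le_trans (ler_norm M).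
  apply: le_trans (cM k); rewrite /spoly (bigD1 j)//= expr1n mulr1 lerDl.
  by apply: sumr_ge0 => i _; rewrite expr1n mulr1.
have near j r N : 0 < r -> exists2 k, (N <= k)%N & `|c k 0 j - q 0 j| < r.
  move=> r0; have [k [Nk _ h]] := hq r N r0; exists k => //.
  by rewrite -coordB; apply: le_lt_trans h; exact: rv_coord_le.
exists q; split=> //.
- move=> j; rewrite leNgt; apply/negP => q0.
  have [|k _] := near j (- q 0 j) 0%N; first by rewrite oppr_gt0.
  by have := c0 k j; rewrite ltr_norml => ? /andP[]; lra.
move=> e r N e0 r0; set S := \sum_(j < d.+1) e ^+ j.+1.
have S0 : 0 <= S by apply: sumr_ge0 => j _; exact: exprn_ge0.
have r'0 : 0 < r / (S + 1) by rewrite divr_gt0//; lra.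
have [k [Nk _ h]] := hq _ N r'0; exists k => //.
apply: le_lt_trans (spoly_near e0 (ltW h)) _; rewrite -/S mulrAC ltr_pdivrMr ?ltr_pM2l//; lra.
Qed.

End SteinerPolynomials.

(** * Local bounds for touching points *)

Section ContactBound.
Context {R : realType} {d : nat}.
Hypothesis d0 : (0 < d)%N.
Variables (W : set 'rV[R]_d) (om : 'rV[R]_d -> R) (y0 : 'rV[R]_d) (MW : R).
Hypotheses (oW : open W) (cW : convex_set W) (hom : cheng_yau W om).
Hypotheses (Wy0 : W y0) (WM : forall y, W y -> `|y| <= MW).
Variables (u : 'rV[R]_d -> R) (Xs : nat -> 'rV[R]_d.+1).

Lemma nsphere_bounded y1 : W y1 -> exists2 r : R, 0 < r &
  exists M : R, forall y, W y -> `|y - y1| < r -> `|nsphere om y| <= M.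
Proof.
move=> Wy1; have /choice[r hr] i : exists r : R, 0 < r /\
    forall y, `|y - y1| < r -> `|partials [:: i] om y - partials [:: i] om y1| < 1.
  by have [r r0 h] := sdiff_near (dom_sdiff oW hom i Wy1) ltr01; exists r.
pose r0 := \big[Num.min/1]_i r i.
exists r0.
  by rewrite /r0; elim/big_ind: _ => // [a b a0 b0|j _]; [rewrite lt_min a0|case: (hr j)].
have [K K0 hK] := om_ge oW hom Wy0 WM.
have MW0 := le_trans (normr_ge0 _) (WM Wy0).
pose G := `|grad om y1| + 1; have G0 : 0 <= G by rewrite addr_ge0.
have d0r : 0 <= d%:R :> R by [].
exists (G + (d%:R * G * MW + K)) => y Wy yr.
have gG : `|grad om y| <= G.
  apply/rv_norm_leP => // i; rewrite gradE.
  have : `|y - y1| < r i by apply: lt_le_trans yr _; rewrite /r0 (bigD1 i)//= ge_min lexx.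
  case: (hr i) => _ /[apply]; have := rv_coord_le (grad om y1) i; rewrite gradE /G.
  have := ler_normD (partials [:: i] om y - partials [:: i] om y1) (partials [:: i] om y1).
  by rewrite subrK; lra.
have P0 : 0 <= d%:R * G * MW by rewrite !mulr_ge0.
rewrite snoc_norm_le; last by rewrite !addr_ge0// ltW.
apply/andP; split; first by apply: le_trans gG _; rewrite lerDl addr_ge0// ltW.
have h1 : `|dotrv (grad om y) y| <= d%:R * G * MW.
  apply: le_trans (dotrv_le _ _) _; apply: ler_pM => //; [exact: l1norm_ge0| |exact: WM].
  by apply: le_trans (l1norm_le _) _; exact: ler_wpM2l.
have := hK _ Wy; have := om_lt0 hom Wy.
by move: h1; rewrite !ler_norml; lra.
Qed.

(* A point of contact has its horizontal part in the subdifferential of v,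
   which is bounded near y1 in terms of v at the points y1 +- r e_i. *)
Lemma touch_bounded y1 : W y1 -> exists2 r : R, 0 < r &
  (forall y, `|y - y1| < r -> W y) /\ forall e : R, exists M : R, forall v,
    convex_on W v -> (forall y, W y -> lform y (Xs 0%N) - 1 <= v y <= u y) ->
    forall X y s, touch W om v X y s -> `|y - y1| < r -> s < e -> `|X| <= M.
Proof.
move=> Wy1; have [r1 r10 [N hN]] := nsphere_bounded Wy1.
have [r2 r20 hr2] := open_ballP oW Wy1; pose p := r2 / 2.
have p0 : 0 < p by rewrite divr_gt0.
have dn : 0 < d%:R :> R by rewrite ltr0n.
(* The bound [p / (2 d)] makes [l1norm (y1 - y)] at most [p / 2]. *)
pose r := Num.min (Num.min r1 r2) (p / (2 * d%:R)).
exists r; first by rewrite !lt_min r10 r20 divr_gt0// mulr_gt0.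
have rW y : `|y - y1| < r -> W y by rewrite !lt_min => /andP[/andP[_ h] _]; exact: hr2.
split=> // e; have MW0 := le_trans (normr_ge0 _) (WM Wy0).
pose zp i : 'rV[R]_d := y1 + p *: delta_mx 0 i; pose zm i : 'rV[R]_d := y1 - p *: delta_mx 0 i.
have nd i : `|p *: delta_mx 0 i : 'rV[R]_d| < r2.
  apply/rv_norm_ltP => // j; rewrite coordZ mxE eqxx /= normrM (gtr0_norm p0).
  by case: (j == i); rewrite ?normr1 ?normr0 ?mulr1 ?mulr0// /p; lra.
have Wp i : W (zp i) by apply: hr2; rewrite addrC addKr.
have Wm i : W (zm i) by apply: hr2; rewrite addrC addKr normrN.
pose C := (d%:R * MW + 1) * `|Xs 0%N| + 1.
have C0 : 0 <= C by rewrite addr_ge0// mulr_ge0// addr_ge0// mulr_ge0.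
have lC y : W y -> - C <= lform y (Xs 0%N) - 1.
  move=> Wy; have : `|lform y (Xs 0%N)| <= (d%:R * MW + 1) * `|Xs 0%N|.
    apply: le_trans (lform_le _ _) _; apply: ler_wpM2r => //; rewrite lerD2r.
    by apply: le_trans (l1norm_le _) _; apply: ler_wpM2l => //; exact: WM.
  by rewrite /C ler_norml; lra.
pose M1 := \sum_i (`|u (zp i)| + `|u (zm i)|) + C.
have M1E i : `|u (zp i)| + `|u (zm i)| + C <= M1.
  by rewrite /M1 lerD2r (bigD1 i)//= lerDl; apply: sumr_ge0 => j _; rewrite addr_ge0.
have M10 : 0 <= M1 by rewrite addr_ge0// sumr_ge0// => i _; rewrite addr_ge0.
pose B := 2 * M1 / p; have B0 : 0 <= B by rewrite divr_ge0 ?mulr_ge0// ltW.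
pose T := d%:R * MW * B + `|u y1| + p / 2 * B + C.
have p20 : 0 <= p / 2 by rewrite divr_ge0// ltW.
have T1 : 0 <= d%:R * MW * B by apply: mulr_ge0 => //; apply: mulr_ge0 => //; exact: ltW.
have T2 : 0 <= p / 2 * B by exact: mulr_ge0.
have T0 : 0 <= T by rewrite /T; have := normr_ge0 (u y1); lra.
exists (B + T + `|e| * `|N|) => v cv hv X y s t yr se.
have Wy := rW _ yr; have s0 : 0 < s by case: t.
have [_ [E h]] := touch_contact oW cW hom cv t.
move: E h; set P := X - _; set x := rinit P => E h.
have yd : l1norm (y1 - y) <= p / 2.
  apply: le_trans (l1norm_le _) _; rewrite distrC -ler_pdivlMl//.
  apply: ltW; apply: lt_le_trans yr _; rewrite /r ge_min; apply/orP; right.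
  by rewrite (_ : p / (2 * d%:R) = d%:R^-1 * (p / 2))//; field; rewrite gt_eqF.
have dy : `|dotrv (y1 - y) x| <= p / 2 * `|x|.
  by apply: le_trans (dotrv_le _ _) _; exact: ler_wpM2r.
have sub z : W z -> dotrv (z - y) x <= v z - v y.
  by move=> /h; rewrite -lformBl; move: E; rewrite /gap; lra.
have vl := hv _ Wy; have Cl := lC _ Wy.
have xB : `|x| <= B.
  (* Comparing [y] with [y1 +- p e_i] bounds [p |x_i|] by [M1] plus half of [p |x|]; the latter is
     absorbed, which explains [B = 2 M1 / p]. *)
  have h1 : `|x| <= (M1 + p / 2 * `|x|) / p.
    apply/rv_norm_leP => [|i]; first by apply: divr_ge0; [rewrite addr_ge0// mulr_ge0|exact: ltW].
    rewrite ler_pdivlMr//.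
    suff : `|p * x 0 i| <= M1 + p / 2 * `|x| by rewrite normrM (gtr0_norm p0) mulrC.
    have := sub _ (Wp i); have := sub _ (Wm i).
    have -> : zp i - y = (y1 - y) + p *: delta_mx 0 i by rewrite /zp addrAC.
    have -> : zm i - y = (y1 - y) - p *: delta_mx 0 i by rewrite /zm addrAC.
    rewrite (dotrvBl _ (y1 - y)) (dotrvDl _ (y1 - y)) !dotrvZl !dotrv_delta.
    have /andP[_] := hv _ (Wp i); have /andP[_] := hv _ (Wm i).
    have := M1E i; have := ler_norm (u (zp i)); have := ler_norm (u (zm i)).
    have := normr_ge0 (u (zp i)); have := normr_ge0 (u (zm i)).
    move: dy vl Cl; move: (dotrv _ _) (p / 2 * _) (p * x 0 i) => D Q S.
    clear - B0; rewrite !ler_norml => /andP[? ?] /andP[? ?] *.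
    by apply/andP; split; lra.
  move: h1; rewrite ler_pdivlMr// /B ler_pdivlMr//; lra.
have xB' : p / 2 * `|x| <= p / 2 * B by apply: ler_wpM2l => //; rewrite divr_ge0// ltW.
have PT : `|P| <= B + T.
  rewrite -(snoc_rinit P) snoc_norm_le; last exact: addr_ge0.
  rewrite -/x (le_trans xB) ?lerDl//=.
  have rE : rlast P = dotrv y x - v y by move: E; rewrite /gap /lform -/x; lra.
  have hx : `|dotrv y x| <= d%:R * MW * B.
    apply: le_trans (dotrv_le _ _) _; apply: ler_pM => //; first exact: l1norm_ge0.
    by apply: le_trans (l1norm_le _) _; apply: ler_wpM2l => //; exact: WM.
  have := sub _ Wy1; have /andP[_] := hv _ Wy1; have := ler_norm (u y1).
  move: dy hx vl Cl xB' B0 C0; rewrite rE /T.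
  have := normr_ge0 (u y1); have : 0 <= p / 2 * `|x| by rewrite mulr_ge0// divr_ge0// ltW.
  move: (dotrv _ _) (dotrv y _) (p / 2 * _) (p / 2 * _) (d%:R * MW * B) `|u y1| => a1 a2 a3 a4 a5 a6.
  clear -R; rewrite !ler_norml => ? ? /andP[? ?] /andP[? ?] /andP[? ?] *.
  by apply/andP; split; lra.
have -> : X = P + s *: nsphere om y by rewrite /P subrK.
apply: le_trans (ler_normD _ _) _; apply: lerD => //; rewrite normrZ.
apply: ler_pM => //; first by rewrite gtr0_norm//; apply: le_trans (ltW se) (ler_norm _).
apply: le_trans (hN _ Wy _) (ler_norm _).
by move: yr; rewrite !lt_min => /andP[/andP[]].
Qed.

End ContactBound.

Definition clusters {R : realType} (x : nat -> R) (z : R) :=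
  forall (r : R) N, 0 < r -> exists2 k, (N <= k)%N & `|x k - z| < r.

Lemma clusters_le {R : realType} (x : nat -> R) (z v : R) : clusters x z ->
  (forall k, x k <= v) -> z <= v.
Proof.
move=> cz h; rewrite leNgt; apply/negP => vz; have [|k _] := cz (z - v) 0%N; first by rewrite subr_gt0.
by have := h k; rewrite ltr_norml => ? /andP[]; lra.
Qed.

Lemma clusters_ge {R : realType} (x : nat -> R) (z v : R) : clusters x z ->
  (forall c : R, c < v -> exists N, forall k, (N <= k)%N -> c < x k) -> v <= z.
Proof.
move=> cz h; rewrite leNgt; apply/negP => zv.
have [|N hN] := h ((z + v) / 2); first by lra.
have [|k Nk] := cz ((v - z) / 2) N; first by lra.
by have := hN k Nk; rewrite ltr_norml => ? /andP[]; lra.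
Qed.

Lemma clusters_lt {R : realType} (x : nat -> R) (z v : R) : clusters x z ->
  (forall c : R, v < c -> exists N, forall k, (N <= k)%N -> x k < c) -> z <= v.
Proof.
move=> cz h; rewrite leNgt; apply/negP => zv.
have [|N hN] := h ((z + v) / 2); first by lra.
have [|k Nk] := cz ((z - v) / 2) N; first by lra.
by have := hN k Nk; rewrite ltr_norml => ? /andP[]; lra.
Qed.

(** * Steiner polynomials over small Borel sets *)

Section LocalSteiner.
Context {R : realType} {d : nat}.
Hypothesis d0 : (0 < d)%N.
Variables (W : set 'rV[R]_d) (om : 'rV[R]_d -> R) (y0 : 'rV[R]_d) (MW : R).
Hypotheses (oW : open W) (cW : convex_set W) (hom : cheng_yau W om).
Hypotheses (Wy0 : W y0) (WM : forall y, W y -> `|y| <= MW).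
Variables (u : 'rV[R]_d -> R) (Xs : nat -> 'rV[R]_d.+1).
Hypotheses (cu : convex_on W u) (lu : lsc_on W u).
Hypothesis Xs_le : forall i y, W y -> lform y (Xs i) <= u y.
Hypothesis Xs_sup : forall y (e : R), W y -> 0 < e -> exists i, u y - e < lform y (Xs i).
Hypothesis Xs_dense : forall p, gap_domain W u p -> exists i, exists2 c : R, 0 < c &
  forall y, W y -> c <= lform y (Xs i) - lform y p.
Notation Y := (borelRn R d * measurableTypeR R)%type.
Notation uk := (smapprox Xs).

(** For a support function [v], the parallel neighbourhood in coordinates: see
    [frame_preimage_parallel]. *)
Definition sweep v (e : R) (b : set 'rV[R]_d) : set (borelRn R d.+1) :=
  touchset W om v (b `*` `]0%R, e[%classic).

Lemma measurable_slab (b : set (borelRn R d)) (e : R) : measurable b ->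
  measurable (b `*` `]0%R, e[%classic : set Y).
Proof. by move=> mb; apply: measurableX => //; exact: measurable_itv. Qed.

Lemma measurable_sweep e (b : set (borelRn R d)) : measurable b -> measurable (sweep u e b).
Proof.
by move=> mb; apply: (measurable_touchset oW cW hom Wy0 WM cu lu); exact: measurable_slab.
Qed.

Lemma measurable_sweep_approx k e (b : set (borelRn R d)) : measurable b ->
  measurable (sweep (uk k) e b).
Proof.
move=> mb; apply: (measurable_touchset oW cW hom Wy0 WM); first exact: smapprox_conv.
  exact: smapprox_lsc.
exact: measurable_slab.
Qed.

Lemma sweep_mono v e e' b b' : e <= e' -> b `<=` b' -> sweep v e b `<=` sweep v e' b'.
Proof.
move=> ee bb X [y [s [t [by_ /=]]]]; rewrite in_itv /= => /andP[s0 se].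
by exists y, s; split=> //; split; [exact: bb|rewrite /= in_itv /= s0 (lt_le_trans se)].
Qed.

Lemma smapprox_band k y : W y -> lform y (Xs 0%N) - 1 <= uk k y <= u y.
Proof.
move=> Wy; rewrite (smapprox_le Xs_le)// andbT; apply: le_trans (smapprox_ge Xs y (leq0n k)).
by rewrite lerD2l lerN2 invf_le1// ler1n.
Qed.

Lemma u_band y : W y -> lform y (Xs 0%N) - 1 <= u y <= u y.
Proof. by move=> Wy; rewrite lexx andbT; have := Xs_le 0%N Wy; lra. Qed.

(** * An open set of directions with bounded swept sets *)

Section Near.
Variable G : set 'rV[R]_d.
Hypotheses (oG : open G) (GW : G `<=` W).
Variable M : R -> R.
Hypothesis GM : forall e v, convex_on W v -> (forall y, W y -> lform y (Xs 0%N) - 1 <= v y <= u y) ->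
  forall X y s, touch W om v X y s -> G y -> s < e -> `|X| <= M e.

Let D e : set (borelRn R d.+1) := [set X | `|X| <= M e].

Let mD e : measurable (D e).
Proof.
apply: closed_borel; have /continuous_closedP h : continuous (fun x : 'rV[R]_d.+1 => `|x|) by exact: norm_continuous.
exact: (h _ (@closed_le R (M e))).
Qed.

Let D_fin e : (leb d.+1 (D e) < +oo)%E.
Proof. by apply: (@lebn_bounded _ _ _ (M e)). Qed.

Lemma sweep_bound e b : b `<=` G -> sweep u e b `<=` D e.
Proof.
move=> bG X [y [s [t [by_ /=]]]]; rewrite in_itv /= => /andP[_ se].
by apply: (GM cu u_band t) => //; exact: bG.
Qed.

Lemma sweep_approx_bound k e b : b `<=` G -> sweep (uk k) e b `<=` D e.
Proof.
move=> bG X [y [s [t [by_ /=]]]]; rewrite in_itv /= => /andP[_ se].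
by apply: (GM (smapprox_conv cW Xs k) (smapprox_band k) t) => //; exact: bG.
Qed.

Lemma sweep_fin e (b : set (borelRn R d)) : measurable b -> b `<=` G ->
  leb d.+1 (sweep u e b) \is a fin_num.
Proof.
move=> mb bG; rewrite ge0_fin_numE//; apply: le_lt_trans (D_fin e).
by apply: le_measure; rewrite ?inE//; [exact: measurable_sweep|exact: sweep_bound].
Qed.

Definition sphvol (b : set 'rV[R]_d) : \bar R :=
  (\int[leb d]_(y in (b : set (borelRn R d))) ((- om y) ^- d.+1)%:E)%E.

(** The factor [d + 1] undoes the integration of [s^d], which gives [e^(d+1) / (d + 1)]. *)
Definition steiner_vec (b : set 'rV[R]_d) (q : 'rV[R]_d.+1) :=
  (forall j, 0 <= q 0 j) /\ sphvol b = (q 0 ord_max * d.+1%:R)%:E.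

Lemma approx_coef k (b : set (borelRn R d)) : measurable b -> b `<=` G -> exists c,
  steiner_vec b c /\ forall e : R, 0 < e -> leb d.+1 (sweep (uk k) e b) = (spoly c e)%:E.
Proof.
move=> mb bG; have bW : b `<=` W by move=> y /bG /GW.
have [a [ma a0 amax aE]] := smapprox_steiner d0 oW cW hom Wy0 WM Xs k.
pose I j := (\int[leb d]_(y in b) (a j y)%:E)%E.
have I0 j : (0 <= I j)%E by apply: integral_ge0 => y _; rewrite lee_fin.
have sfin : (leb d.+1 (sweep (uk k) 1 b) < +oo)%E.
  apply: le_lt_trans (D_fin 1); apply: le_measure; rewrite ?inE//.
  - exact: measurable_sweep_approx.
  - exact: sweep_approx_bound.
(* An infinite coefficient would give the bounded sweep of radius 1 infinite volume. *)
have Ifin j : I j \is a fin_num.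
  rewrite ge0_fin_numE// ltey; apply/negP => /eqP Ij.
  move: sfin; rewrite /leb /sweep aE// (bigD1 j)//= -/(I j) Ij expr1n.
  rewrite gt0_muley ?lte_fin ?invr_gt0// addye ?ltxx//.
  rewrite gt_eqF//; apply: lt_le_trans (ltNyr 0) _; apply: sume_ge0 => i _.
  by apply: mule_ge0; [rewrite lee_fin expr1n|exact: I0].
exists (\row_j (fine (I j) / j.+1%:R)); split; first split.
- by move=> j; rewrite mxE divr_ge0// fine_ge0.
- rewrite mxE mulfVK ?pnatr_eq0// fineK//; apply: eq_integral => y /set_mem /bW Wy.
  by rewrite amax.
move=> e e0; rewrite /leb /sweep aE// /spoly -sumEFin; apply: eq_bigr => j _.
by rewrite mxE -[X in (_ * X)%E]/(I j) -(fineK (Ifin j)) -EFinM; congr EFin; ring.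
Qed.

(** [q] is a cluster point of the coefficients of the approximations over [O1]. A point swept out by
    [u] over the open set [O1] is eventually swept out by the approximations; conversely, for a
    point swept out infinitely often, the limit pair lies within [r] of [O1] and its radius is below
    [e']. *)
Lemma sandwich (O1 U : set 'rV[R]_d) (r : R) : open O1 -> open U -> U `<=` G -> 0 < r ->
  O1 `<=` erode U r -> exists q, [/\ steiner_vec O1 q,
    forall e : R, 0 < e -> (leb d.+1 (sweep u e O1) <= (spoly q e)%:E)%E &
    forall e e' : R, 0 < e -> e < e' -> ((spoly q e)%:E <= leb d.+1 (sweep u e' U))%E].
Proof.
move=> oO oU UG r0 O1U; have O1G : O1 `<=` G by move=> y /O1U /(erode_subset r0) /UG.
have mO : measurable (O1 : set (borelRn R d)) by exact: open_borel.
have mU : measurable (U : set (borelRn R d)) by exact: open_borel.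
have /choice[c hc] k := approx_coef k mO O1G.
have c0 k j : 0 <= c k 0 j by have [[+ _] _] := hc k.
have cE k e : 0 < e -> leb d.+1 (sweep (uk k) e O1) = (spoly (c k) e)%:E by have [_] := hc k; apply.
have cm k e : 0 < e -> spoly (c k) e <= fine (leb d.+1 (D e)).
  move=> e0; have Df := D_fin e; rewrite -lee_fin -cE// fineK ?ge0_fin_numE//.
  apply: le_measure; rewrite ?inE//; first exact: measurable_sweep_approx.
  exact: sweep_approx_bound.
have [q [q0 qe qj]] := spoly_cluster c0 (fun k => cm k 1 ltr01).
have qc e : 0 < e -> clusters (fun k => spoly (c k) e) (spoly q e).
  by move=> e0 t N; exact/qe/ltW.
exists q; split.
- split=> //; have [[_ ->] _] := hc 0%N; congr EFin; congr (_ * _).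
  (* The top coefficient is fixed by [sphvol O1], hence the same for all [k]. *)
  have ctop k : c k 0 ord_max = c 0%N 0 ord_max.
    have [[_ e1] _] := hc k; have [[_ e2] _] := hc 0%N; move: e2; rewrite e1 => -[].
    by apply: mulIf; rewrite pnatr_eq0.
  apply/eqP; rewrite eq_le; apply/andP; split; last first.
    by apply: clusters_le (qj ord_max) _ => k; rewrite ctop.
  by apply: clusters_ge (qj ord_max) _ => v vc; exists 0%N => k _; rewrite ctop.
- move=> e e0; have vf := sweep_fin e mO O1G; rewrite -(fineK vf) lee_fin.
  apply: (clusters_ge (qc e e0)) => v vc.
  have [||||N hN] := @measure_eventually_gt _ _ _ (leb d.+1) (sweep u e O1) (fun k => sweep (uk k) e O1) v%:E.
  + exact: measurable_sweep.
  + by move=> k; exact: measurable_sweep_approx.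
  + move=> X; apply: (smapprox_foot_open oW cW hom Wy0 WM cu Xs_le Xs_sup Xs_dense) => y s [Oy /=].
    rewrite in_itv /= => /andP[s0 se]; have [t t0 ht] := open_ballP oO Oy.
    exists (Num.min t (Num.min s (e - s))); first by rewrite !lt_min t0 s0 subr_gt0.
    move=> y' s'; rewrite !lt_min => /and3P[h1 _ _] /and3P[_ h2 h3]; split; first exact: ht.
    by rewrite /= in_itv /=; move: h2 h3; rewrite !ltr_norml => /andP[? ?] /andP[? ?]; apply/andP; split; lra.
  + by move: vc; rewrite -lte_fin (fineK vf).
  by exists N => k Nk; rewrite -lte_fin -cE//; exact: hN.
- move=> e e' e0 ee; have vf := sweep_fin e' mU UG; rewrite -(fineK vf) lee_fin.
  apply: (clusters_lt (qc e e0)) => v vc.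
  have [|||||||N hN] := @measure_eventually_lt _ _ _ (leb d.+1) (sweep u e' U) (D e)
    (fun k => sweep (uk k) e O1) v%:E.
  + exact: measurable_sweep.
  + exact: mD.
  + by move=> k; exact: measurable_sweep_approx.
  + exact: D_fin.
  + by move=> k; exact: sweep_approx_bound.
  + move=> X hX; have t0 : 0 < Num.min r (e' - e) by rewrite lt_min r0 subr_gt0.
    apply: (smapprox_foot_near oW cW hom Wy0 WM cu lu Xs_le Xs_sup Xs_dense t0 _ hX).
    move=> y s y' s' [Oy' /=]; rewrite in_itv /= => /andP[_ se] Wy s0.
    rewrite !lt_min => /andP[h1 _] /andP[_ h2]; split.
      by apply: (O1U _ Oy'); rewrite distrC.
    by rewrite /= in_itv /= s0; move: h2; rewrite ltr_norml => /andP[]; lra.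
  + by move: vc; rewrite -lte_fin (fineK vf).
  by exists N => k Nk; rewrite -lte_fin -cE//; exact: hN.
Qed.

Lemma sphvol_measure : exists rho : {measure set (borelRn R d) -> \bar R},
  forall b : set (borelRn R d), measurable b -> b `<=` W -> rho b = sphvol b.
Proof.
have [a [ma a0 amax _]] := smapprox_steiner d0 oW cW hom Wy0 WM Xs 0.
have [||rho hrho] := @density_exists _ _ _ (leb d) (fun y => (a ord_max y)%:E).
- by apply/measurable_EFinP; exact: ma.
- by move=> y; rewrite lee_fin.
exists rho => b mb bW; rewrite hrho; apply: eq_integral => y /set_mem /bW Wy.
by rewrite amax.
Qed.

Lemma spoly_left (q : 'rV[R]_d.+1) (e v : R) : 0 < e ->
  (forall e' : R, 0 < e' -> e' < e -> spoly q e' <= v) -> spoly q e <= v.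
Proof.
move=> e0 h; rewrite leNgt; apply/negP => ve.
have ve0 : 0 < spoly q e - v by rewrite subr_gt0.
have /cvgrPdist_lt/(_ _ ve0) := @spoly_continuous R d q e.
move=> /nbhs_ballP[r /= r0 rh].
have t0 : 0 < Num.min (r / 2) (e / 2) by rewrite lt_min !divr_gt0.
set t := Num.min _ _ in t0.
have tr : t <= r / 2 by rewrite ge_min lexx.
have te : t <= e / 2 by rewrite ge_min lexx orbT.
have := h (e - t); have := rh (e - t); rewrite /ball /= opprB addrC subrK (gtr0_norm t0).
have tr' : t < r by lra.
move=> /(_ tr') h1 h2; have {}h2 : spoly q (e - t) <= v by apply: h2; lra.
by move: h1; rewrite ltr_norml => /andP[]; lra.
Qed.

Lemma spoly1_ge (q : 'rV[R]_d.+1) j : (forall i, 0 <= q 0 i) -> q 0 j <= spoly q 1.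
Proof.
move=> q0; rewrite /spoly (bigD1 j)//= expr1n mulr1 lerDl.
by apply: sumr_ge0 => i _; rewrite expr1n mulr1.
Qed.

(** [U] is exhausted by the sets [On n], to which [sandwich] applies with margin [1 / (n + 1)]. Its
    upper bound at [e] only controls the polynomials at radii [e' < e]; continuity from the left
    removes this loss. *)
Lemma open_steiner (U : set 'rV[R]_d) : open U -> U `<=` G -> exists q, steiner_vec U q /\
  forall e : R, 0 < e -> leb d.+1 (sweep u e U) = (spoly q e)%:E.
Proof.
(* [erode U t] is closed, but its union over [t > 1 / (n + 1)] is open. *)
move=> oU UG; pose On n : set 'rV[R]_d := [set x | exists2 t : R, n.+1%:R^-1 < t & erode U t x].
have mU : measurable (U : set (borelRn R d)) by exact: open_borel.
have inv0 n : 0 < n.+1%:R^-1 :> R by rewrite invr_gt0.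
have OnU n : On n `<=` erode U n.+1%:R^-1 by move=> x [t nt]; apply: erode_mono; exact: ltW.
have OU n : On n `<=` U by move=> x /OnU; exact: erode_subset.
have oO n : open (On n).
  apply: ballP_open => x [t nt xt]; exists ((t - n.+1%:R^-1) / 2); first by rewrite divr_gt0// subr_gt0.
  move=> y yx; exists ((t + n.+1%:R^-1) / 2); first by move: nt; move: (n.+1%:R^-1) => v; lra.
  move=> z zy; apply: xt; have := ler_distD y z x; move: yx zy nt; move: (n.+1%:R^-1) => v; lra.
have Onear x : U x -> exists N, forall n, (N <= n)%N -> On n x.
  move=> Ux; have [r r0 h] := open_ballP oU Ux; have [N hN] := invS_small r0.
  by exists N => n Nn; exists r; [exact: hN|move=> y yx; exact: h].
have mO n : measurable (On n : set (borelRn R d)) by exact: open_borel.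
have /choice[c hc] n := sandwich (oO n) oU UG (inv0 n) (@OnU n).
have c0 n j : 0 <= c n 0 j by have [[+ _] _ _] := hc n.
have UW : U `<=` W by move=> y /UG /GW.
(* Radius 2, because [sandwich] bounds the value at 1 only by volumes of larger radius. *)
pose M1 := fine (leb d.+1 (sweep u 2 U)).
have c1 n : spoly (c n) 1 <= M1.
  have [_ _ h] := hc n; rewrite -lee_fin fineK; last exact: sweep_fin.
  by apply: h => //; lra.
have [q [q0 qe qj]] := spoly_cluster c0 c1; exists q.
have qc e : 0 < e -> clusters (fun n => spoly (c n) e) (spoly q e).
  by move=> e0 t N; exact/qe/ltW.
split; first split=> //.
- have [rho hrho] := sphvol_measure; rewrite -hrho//.
  have rO n : rho (On n) = (c n 0 ord_max * d.+1%:R)%:E.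
    by have [[_ h] _ _] := hc n; rewrite hrho// => y /OU /UW.
  have rgt v : (v%:E < rho U)%E -> exists N, forall n, (N <= n)%N -> v < c n 0 ord_max * d.+1%:R.
    move=> vU; have [|N hN] := measure_eventually_gt mU mO _ vU; first exact: Onear.
    by exists N => n Nn; rewrite -lte_fin -rO; exact: hN.
  have cM n : c n 0 ord_max * d.+1%:R <= M1 * d.+1%:R.
    by apply: ler_wpM2r => //; apply: le_trans (c1 n); exact: spoly1_ge.
  have rfin : rho U \is a fin_num.
    rewrite ge0_fin_numE//; apply: le_lt_trans (ltry (M1 * d.+1%:R)).
    rewrite leNgt; apply/negP => /rgt[N /(_ N (leqnn N))]; by rewrite ltNge cM.
  rewrite -(fineK rfin); congr EFin.
  have qm : clusters (fun n => c n 0 ord_max * d.+1%:R) (q 0 ord_max * d.+1%:R).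
    move=> r N r0; have r'0 : 0 < r / d.+1%:R by rewrite divr_gt0.
    have [n Nn h] := qj ord_max _ N r'0; exists n => //.
    by rewrite -mulrBl normrM [X in _ * X]ger0_norm// -ltr_pdivlMr.
  apply/eqP; rewrite eq_le; apply/andP; split.
    apply: (clusters_ge qm) => v vc; apply: rgt; by rewrite -(fineK rfin) lte_fin.
  apply: (clusters_le qm) => n; rewrite -lee_fin (fineK rfin) -rO.
  by apply: le_measure; rewrite ?inE.
move=> e e0; have vf := sweep_fin e mU UG; rewrite -(fineK vf); congr EFin.
apply/eqP; rewrite eq_le; apply/andP; split.
  apply: (clusters_ge (qc e e0)) => v vc.
  have [||||N hN] := @measure_eventually_gt _ _ _ (leb d.+1) (sweep u e U) (fun n => sweep u e (On n)) v%:E.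
  - exact: measurable_sweep.
  - by move=> n; exact: measurable_sweep.
  - move=> X [y [s [t [Uy se]]]]; have [N hN] := Onear _ Uy.
    by exists N => n Nn; exists y, s; split=> //; split=> //; exact: hN.
  - by move: vc; rewrite -lte_fin (fineK vf).
  exists N => n Nn; rewrite -lte_fin; apply: lt_le_trans (hN n Nn) _.
  by have [_ h _] := hc n; exact: h.
apply: spoly_left => // e' e'0 ee; apply: (clusters_le (qc e' e'0)) => n.
by rewrite -lee_fin (fineK vf); have [_ _ h] := hc n; exact: h.
Qed.

(** Outer regularity is applied at once to the sphere volume and, for radius [n + 1], to the volume
    swept out; for any fixed [e] the sets [U n] with [n + 1 >= e] then approximate [b] with error
    [1 / (n + 1)] in both. *)
Lemma borel_steiner (b : set (borelRn R d)) : measurable b -> b `<=` G -> exists q, steiner_vec b q /\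
  forall e : R, 0 < e -> leb d.+1 (sweep u e b) = (spoly q e)%:E.
Proof.
move=> mb bG; have mG : measurable (G : set (borelRn R d)) by exact: open_borel.
have [rho hrho] := sphvol_measure.
have [nu hnu] := touch_measure_exists oW cW hom Wy0 WM cu lu.
have nuE e b' : leb d.+1 (sweep u e b') = nu (b' `*` `]0%R, e[%classic) by rewrite hnu.
have [qG [[_ rG] _]] := open_steiner oG (fun y => id).
pose rhoG : {measure set (borelRn R d) -> \bar R} := mrestr rho mG.
(* The volume swept out at radius [e] over [G], as a finite Borel measure of the directions. *)
pose nuG_ e : {measure set (borelRn R d) -> \bar R} :=
  pushforward (mrestr nu (measurable_slab e mG)) (@fst (borelRn R d) (measurableTypeR R)).
pose nuG := nuG_ measurable_fst.
have nuGE e (b' : set (borelRn R d)) : nuG e b' = leb d.+1 (sweep u e (b' `&` G)).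
  rewrite nuE /nuG /nuG_ /= /pushforward /mrestr; congr (nu _).
  by apply/seteqP; split=> -[y s] /=; [case=> ? [? ?]|case=> -[? ?] ?].
have rhoGfin : (rhoG setT < +oo)%E.
  by rewrite /rhoG /= /mrestr setTI hrho// rG ltry.
have nuGfin e : (nuG e setT < +oo)%E.
  by rewrite nuGE setTI -ge0_fin_numE//; exact: sweep_fin.
have /choice[U hU] (n : nat) : exists U : set 'rV[R]_d, [/\ open U, b `<=` U, U `<=` G,
    (rho ((U : set (borelRn R d)) `\` b) <= n.+1%:R^-1%:E)%E &
    (leb d.+1 (sweep u n.+1%:R (U `\` b)) <= n.+1%:R^-1%:E)%E].
  have n0 : 0 < n.+1%:R^-1 :> R by rewrite invr_gt0.
  have [U1 [oU1 bU1 m1]] := borel_outer_regular rhoGfin mb n0.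
  have [U2 [oU2 bU2 m2]] := borel_outer_regular (nuGfin n.+1%:R) mb n0.
  have mU1 : measurable (U1 : set (borelRn R d)) by exact: open_borel.
  have mU2 : measurable (U2 : set (borelRn R d)) by exact: open_borel.
  have mU : measurable (U1 `&` U2 `&` G : set (borelRn R d)) by apply: measurableI => //; exact: measurableI.
  exists (U1 `&` U2 `&` G); split.
  - by apply: openI => //; exact: openI.
  - by move=> y by_; split; [split; [exact: bU1|exact: bU2]|exact: bG].
  - by move=> y [].
  - apply: le_trans m1; apply: le_measure; rewrite ?inE.
    + exact: measurableD.
    + by apply: measurableI => //; exact: measurableD.
    + by move=> y [[[? ?] ?] ?].
  - apply: le_trans m2; rewrite nuGE; apply: le_measure; rewrite ?inE.
    + by apply: measurable_sweep; exact: measurableD.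
    + by apply: measurable_sweep; apply: measurableI => //; exact: measurableD.
    + by apply: sweep_mono => // y [[[? ?] ?] ?].
have oU n : open (U n) by case: (hU n).
have UG n : U n `<=` G by case: (hU n).
have bU n : b `<=` U n by case: (hU n).
have mU n : measurable (U n : set (borelRn R d)) by exact: open_borel.
have /choice[c hc] n := open_steiner (oU n) (@UG n).
have c0 n j : 0 <= c n 0 j by have [[+ _] _] := hc n.
have bW : b `<=` W by move=> y /bG /GW.
have UW n : U n `<=` W by move=> y /UG /GW.
have c1 n : spoly (c n) 1 <= fine (leb d.+1 (sweep u 1 G)).
  have [_ h] := hc n; rewrite -lee_fin -h// fineK; last exact: sweep_fin.
  apply: le_measure; rewrite ?inE; [exact: measurable_sweep|exact: measurable_sweep|].
  by apply: sweep_mono.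
have [q [q0 qe qj]] := spoly_cluster c0 c1; exists q.
have split_ e n : (leb d.+1 (sweep u e (U n)) =
    leb d.+1 (sweep u e (U n `\` b)) + leb d.+1 (sweep u e b))%E.
  have mUb : measurable (U n `\` b : set (borelRn R d)) by exact: measurableD.
  rewrite !nuE -measureU; [|exact: measurable_slab|exact: measurable_slab|].
    congr (nu _); apply/seteqP; split=> -[y s] /=.
      by move=> [? ?]; case: (pselect (b y)) => ?; [right|left].
    by case=> [[[? ?] ?]|[? ?]]; split=> //; exact: (@bU n).
  by apply/seteqP; split=> -[y s] //= [[[_ nb] _] [/nb]].
split; first split=> //.
- have rG' : (rho G < +oo)%E by rewrite hrho// rG ltry.
  have rfin (b' : set (borelRn R d)) : measurable b' -> b' `<=` G -> rho b' \is a fin_num.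
    by move=> mb' b'G; rewrite ge0_fin_numE//; apply: le_lt_trans rG'; apply: le_measure; rewrite ?inE.
  rewrite -hrho// -(fineK (rfin b mb bG)); congr EFin.
  have rU n : fine (rho (U n)) = c n 0 ord_max * d.+1%:R.
    by have [[_ h] _] := hc n; rewrite hrho ?h.
  have qm : clusters (fun n => c n 0 ord_max * d.+1%:R) (q 0 ord_max * d.+1%:R).
    move=> r N r0; have r'0 : 0 < r / d.+1%:R by rewrite divr_gt0.
    have [n Nn h] := qj ord_max _ N r'0; exists n => //.
    by rewrite -mulrBl normrM [X in _ * X]ger0_norm// -ltr_pdivlMr.
  have lb n : fine (rho b) <= fine (rho (U n)).
    apply: fine_le; [exact: rfin|exact: rfin|apply: le_measure; rewrite ?inE//].
  have ub n : fine (rho (U n)) <= fine (rho b) + n.+1%:R^-1.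
    have mUb : measurable (U n `\` b : set (borelRn R d)) by exact: measurableD.
    have : (rho (U n) <= rho b + n.+1%:R^-1%:E)%E.
      have -> : rho (U n) = (rho b + rho (U n `\` b))%E.
        rewrite -measureU//; last by rewrite setDE setICA setICr setI0.
        congr (rho _); apply/seteqP; split=> [y Uy|y [/bU|[]]//].
        by have [?|?] := pselect (b y); [left|right].
      by apply: leeD => //; case: (hU n).
    by rewrite -lee_fin EFinD !fineK// rfin.
  apply/eqP; rewrite eq_le; apply/andP; split.
    apply: (clusters_ge qm) => v vc; exists 0%N => n _; rewrite -rU.
    exact: lt_le_trans vc (lb n).
  apply: (clusters_lt qm) => v vc; have v0 : 0 < v - fine (rho b) by rewrite subr_gt0.
  have [N hN] := invS_small v0; exists N => n Nn; rewrite -rU; apply: le_lt_trans (ub n) _.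
  by have := hN n Nn; move: (n.+1%:R^-1) => w; lra.
move=> e e0; have vf := sweep_fin e mb bG; rewrite -(fineK vf); congr EFin.
have qc : clusters (fun n => spoly (c n) e) (spoly q e).
  by move=> t N; exact/qe/ltW.
have cE n : spoly (c n) e = fine (leb d.+1 (sweep u e (U n))).
  by have [_ h] := hc n; rewrite h.
have mUb n : measurable (U n `\` b : set (borelRn R d)) by exact: measurableD.
have UbG n : U n `\` b `<=` G by move=> y [/UG].
have cS n : spoly (c n) e = fine (leb d.+1 (sweep u e (U n `\` b))) + fine (leb d.+1 (sweep u e b)).
  by rewrite cE split_ fineD//; exact: sweep_fin.
have [N1 hN1] : exists N1, e <= N1.+1%:R.
  by exists (Num.truncn e); have /andP[_ /ltW] := truncn_itv (ltW e0).
apply/eqP; rewrite eq_le; apply/andP; split.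
  apply: (clusters_ge qc) => v vc; exists 0%N => n _; rewrite cS.
  by apply: lt_le_trans vc _; rewrite lerDr fine_ge0.
apply: (clusters_lt qc) => v vc; have v0 : 0 < v - fine (leb d.+1 (sweep u e b)) by rewrite subr_gt0.
have [N hN] := invS_small v0; exists (maxn N N1) => n; rewrite geq_max => /andP[Nn N1n].
rewrite cS; have := hN n Nn; suff : fine (leb d.+1 (sweep u e (U n `\` b))) <= n.+1%:R^-1.
  by move: (n.+1%:R^-1) => w; lra.
rewrite -lee_fin fineK; last exact: sweep_fin.
have [_ _ _ _ h] := hU n; apply: le_trans h; apply: le_measure; rewrite ?inE; try exact: measurable_sweep.
by apply: sweep_mono => //; apply: le_trans hN1 _; rewrite ler_nat.
Qed.

End Near.

End LocalSteiner.

(** * Additive functions dominated by a finite measure *)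

Section DominatedMeasure.
Context {dsp : measure_display} {T : measurableType dsp} {R : realType}.
Variables (mu : {measure set T -> \bar R}) (f : set T -> R).
Hypothesis mu_fin : (mu setT < +oo)%E.
Hypothesis f_bound : forall A, measurable A -> (0 <= f A) /\ ((f A)%:E <= mu A)%E.
Hypothesis f_add : forall A B, measurable A -> measurable B -> A `&` B = set0 ->
  f (A `|` B) = f A + f B.

(** The remainder of a countable disjoint union after [n] terms decreases to the empty set, so its
    measure under [mu], and with it its value under [f], tends to 0. *)
Lemma dominated_measure : exists nu : {measure set T -> \bar R},
  forall A, measurable A -> nu A = (f A)%:E.
Proof.
(* The maximum makes the value nonnegative on sets that are not measurable as well. *)
pose g A := (Num.max 0 (f A))%:E.
have gE A : measurable A -> g A = (f A)%:E.
  by move=> mA; rewrite /g max_r//; case: (f_bound mA).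
have f0 : f set0 = 0.
  have := f_add (@measurable0 _ T) (@measurable0 _ T) (set0I _); rewrite setU0; lra.
have [|||nu nuE] := @measure_exists _ T R g.
- by rewrite gE// f0.
- by move=> A; rewrite lee_fin le_max lexx.
- move=> F mF tF mUF.
  pose H n := \big[setU/set0]_(i < n) F i.
  have mH n : measurable (H n) by apply: bigsetU_measurable => i _; exact: mF.
  have fH n : f (H n) = \sum_(i < n) f (F i).
    elim: n => [|n IH]; first by rewrite /H !big_ord0.
    have dis : H n `&` F n = set0.
      rewrite /H -subset0 -bigcup_mkord => x [[i /= ni Fi] Fn].
      by have /= ? := tF i n I I (ex_intro _ x (conj Fi Fn)); subst i; rewrite ltnn in ni.
    by rewrite {1}/H !big_ord_recr /= (f_add (mH n) (mF n) dis) IH.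
  pose U := \bigcup_n F n; pose D n := U `\` H n.
  have HU n : H n `<=` U by rewrite /H -bigcup_mkord => x [i _ Fx]; exists i.
  have mD n : measurable (D n) by exact: measurableD.
  have fU n : f U = \sum_(i < n) f (F i) + f (D n).
    rewrite -fH -f_add//; last by rewrite /D setDE setICA setICr setI0.
    congr f; apply/seteqP; split=> [x Ux|x [/HU|[]]//].
    by have [?|?] := pselect (H n x); [left|right].
  rewrite gE// -/U.
  rewrite (_ : (fun n => _) = EFin \o (fun n => \sum_(i < n) f (F i))); last first.
    by apply/funext => n; rewrite /= big_mkord -sumEFin; apply: eq_bigr => i _; rewrite gE.
  apply/fine_cvgP; split; first exact: nearW.
  apply/cvgrPdist_lt => e e0.
  have D0 : (mu (D 0%N) < +oo)%E.
    by apply: le_lt_trans mu_fin; apply: le_measure; rewrite ?inE.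
  have [||N hN] := @measure_decreasing_lt _ _ _ mu D e%:E mD D0.
  + move=> i j ij; apply/subsetPset => x [Ux nx]; split=> // h; apply: nx.
    by move: h; rewrite /H -!bigcup_mkord => -[k /= ki Fx]; exists k => //=; exact: leq_trans ij.
  + rewrite (_ : \bigcap_n D n = set0) ?measure0 ?lte_fin//.
    rewrite -subset0 => x hx; have [[i _ Fx] _] := hx 0%N I; have [_] := hx i.+1 I; apply.
    by rewrite /H -bigcup_mkord; exists i => /=.
  exists N => // n /= Nn; rewrite (fU n) addrC addKr ger0_norm; last by case: (f_bound (mD n)).
  rewrite -lte_fin; have [_ h] := f_bound (mD n); apply: le_lt_trans h _; apply: le_lt_trans hN.
  apply: le_measure; rewrite ?inE// => x [Ux nx]; split=> // h; apply: nx.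
  by move: h; rewrite /H -!bigcup_mkord => -[k /= ki Fx]; exists k => //=; exact: leq_trans Nn.
by exists nu => A mA; rewrite nuE gE.
Qed.

End DominatedMeasure.

Lemma measure_bigcupT dsp (T : measurableType dsp) (R : realType)
  (mu : {measure set T -> \bar R}) (F : nat -> set T) : (forall i, measurable (F i)) ->
  trivIset setT F -> mu (\bigcup_i F i) = (\sum_(i <oo) mu (F i))%E.
Proof. by move=> mF tF; rewrite measure_semi_bigcup//; exact: bigcup_measurable. Qed.

Section SpolyUnique.
Context {R : realType} {d : nat}.
Implicit Types q : 'rV[R]_d.+1.

(** Interpolation at [1, ..., d + 1], after division by [e]. *)
Lemma spoly_inj q q' : (forall e : R, 0 < e -> spoly q e = spoly q' e) -> q = q'.
Proof.
move=> h; have [al hal] := @interpolation R d.+1.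
apply/rowP => j; rewrite (hal (fun j => q 0 j)) (hal (fun j => q' 0 j)); apply: eq_bigr => l _.
congr (_ * _); have l0 : 0 < l.+1%:R :> R by [].
have := h _ l0; rewrite /spoly => E; apply: (mulfI (lt0r_neq0 l0)).
rewrite !mulr_sumr; move: E; congr (_ = _); apply: eq_bigr => i _; rewrite exprS; ring.
Qed.

Lemma spolyD q q' e : spoly (q + q') e = spoly q e + spoly q' e.
Proof. by rewrite /spoly -big_split; apply: eq_bigr => j _; rewrite mxE mulrDl. Qed.

(** The value at [e = 1] is a sum of nonnegative terms, so every [x j] is finite and [spoly_inj]
    applies. *)
Lemma ereal_spoly_unique q (x : 'I_d.+1 -> \bar R) : (forall j, (0 <= x j)%E) ->
  (forall e : R, 0 < e -> (spoly q e)%:E = (\sum_(j < d.+1) (e ^+ j.+1)%:E * x j)%E) ->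
  forall j, x j = (q 0 j)%:E.
Proof.
move=> x0 h.
have xf j : x j \is a fin_num.
  rewrite ge0_fin_numE//; apply: le_lt_trans (ltry (spoly q 1)).
  rewrite h// (bigD1 j)//= expr1n mul1e leeDl//; apply: sume_ge0 => i _.
  by rewrite expr1n mul1e.
pose q' : 'rV[R]_d.+1 := \row_j fine (x j).
suff -> : q = q' by move=> j; rewrite mxE fineK.
apply: spoly_inj => e e0; apply: EFin_inj; rewrite h// /spoly -sumEFin; apply: eq_bigr => j _.
by rewrite mxE EFinM fineK// muleC.
Qed.

End SpolyUnique.

(** * Gluing the coefficient measures *)

Section GlobalSteiner.
Context {R : realType} {d : nat}.
Hypothesis d0 : (0 < d)%N.
Variables (W : set 'rV[R]_d) (om : 'rV[R]_d -> R) (y0 : 'rV[R]_d) (MW : R).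
Hypotheses (oW : open W) (cW : convex_set W) (hom : cheng_yau W om).
Hypotheses (Wy0 : W y0) (WM : forall y, W y -> `|y| <= MW).
Variables (u : 'rV[R]_d -> R) (Xs : nat -> 'rV[R]_d.+1).
Hypotheses (cu : convex_on W u) (lu : lsc_on W u).
Hypothesis Xs_le : forall i y, W y -> lform y (Xs i) <= u y.
Hypothesis Xs_sup : forall y (e : R), W y -> 0 < e -> exists i, u y - e < lform y (Xs i).
Hypothesis Xs_dense : forall p, gap_domain W u p -> exists i, exists2 c : R, 0 < c &
  forall y, W y -> c <= lform y (Xs i) - lform y p.
Notation Y := (borelRn R d * measurableTypeR R)%type.

Definition steiner_good (b : set 'rV[R]_d) q := steiner_vec om b q /\
  forall e : R, 0 < e -> leb d.+1 (sweep W om u e b) = (spoly q e)%:E.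

Lemma local_steiner y1 : W y1 -> exists2 r : R, 0 < r & (forall y, `|y - y1| < r -> W y) /\
  forall b : set (borelRn R d), measurable b -> (forall y, b y -> `|y - y1| < r) ->
    exists q, steiner_good b q.
Proof.
move=> Wy1; have [r r0 [rW h]] := touch_bounded d0 oW cW hom Wy0 WM u Xs Wy1.
exists r => //; split=> // b mb br; have /choice[M hM] := h.
have oG : open [set y : 'rV[R]_d | `|y - y1| < r].
  apply: ballP_open => y /= yr; exists (r - `|y - y1|); first by rewrite subr_gt0.
  by move=> z zy; have := ler_distD y z y1; lra.
apply: (borel_steiner d0 oW cW hom Wy0 WM cu lu Xs_le Xs_sup Xs_dense oG rW _ mb br (M := M)).
by move=> e v cv hv X y s t Gy se; exact: hM t Gy se.
Qed.

Definition good_box i := qbox i `<=` W /\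
  forall b : set (borelRn R d), measurable b -> b `<=` qbox i -> exists q, steiner_good b q.

(** Empty unless box [i] is good, so that the sequence covers exactly [W]. *)
Definition gbox i : set (borelRn R d) := [set y | good_box i /\ qbox i y].

Lemma measurable_gbox i : measurable (gbox i).
Proof.
have [g|ng] := pselect (good_box i).
  by rewrite (_ : gbox i = qbox i); [exact: qbox_borel|apply/seteqP; split=> y // []].
by rewrite (_ : gbox i = set0); [exact: measurable0|apply/seteqP; split=> y // []].
Qed.

Definition piece i : set (borelRn R d) := seqDU gbox i.

Lemma measurable_piece i : measurable (piece i).
Proof.
apply: measurableD; first exact: measurable_gbox.
by apply: bigsetU_measurable => j _; exact: measurable_gbox.
Qed.

Lemma trivIset_piece : trivIset setT piece. Proof. exact: trivIset_seqDU. Qed.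

Lemma bigcup_piece : \bigcup_i piece i = W.
Proof.
rewrite /piece -seqDU_bigcup_eq; apply/seteqP; split=> y; first by case=> i _ [[gW _] qy]; exact: gW.
move=> Wy; have [r r0 [rW h]] := local_steiner Wy.
have oG : open [set z : 'rV[R]_d | `|z - y| < r].
  apply: ballP_open => x /= yr; exists (r - `|x - y|); first by rewrite subr_gt0.
  by move=> z zy; have := ler_distD x z y; lra.
have [|i iy iG] := qbox_basis oG (x := y); first by rewrite /= subrr normr0.
exists i => //; split=> //; split; first by move=> z /iG /rW.
by move=> b mb bi; apply: h => // z /bi /iG.
Qed.

Lemma piece_good i (b : set (borelRn R d)) : measurable b -> exists q, steiner_good (b `&` piece i) q.
Proof.
move=> mb; have mp := measurable_piece i.
have [[_ g]|ng] := pselect (good_box i).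
  by apply: g; [exact: measurableI|move=> y [_ [[]]]].
have -> : b `&` piece i = set0.
  by rewrite -subset0 => y [_ [[/ng]]].
exists 0; split; first split.
- by move=> j; rewrite mxE.
- by rewrite /sphvol integral_set0 mxE mul0r.
move=> e _; rewrite (_ : sweep _ _ _ _ _ = set0).
  by rewrite measure0 /spoly big1// => j _; rewrite mxE mul0r.
by rewrite -subset0 => X [y [s [_ []]]].
Qed.

Lemma steiner_good_unique (b : set 'rV[R]_d) q q' : steiner_good b q -> steiner_good b q' -> q = q'.
Proof. by move=> [_ h] [_ h']; apply: spoly_inj => e e0; apply: EFin_inj; rewrite -h// -h'. Qed.

Lemma sweep_measure_exists : exists nu : {measure set Y -> \bar R},
  forall e b, leb d.+1 (sweep W om u e b) = nu (b `*` `]0%R, e[%classic).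
Proof.
have [nu hnu] := touch_measure_exists oW cW hom Wy0 WM cu lu.
by exists nu => e b; rewrite hnu.
Qed.

Lemma sweep_bigcup e (F : nat -> set (borelRn R d)) : (forall i, measurable (F i)) ->
  trivIset setT F ->
  leb d.+1 (sweep W om u e (\bigcup_i F i)) = (\sum_(i <oo) leb d.+1 (sweep W om u e (F i)))%E.
Proof.
move=> mF tF; have [nu hnu] := sweep_measure_exists; rewrite hnu.
have mFs i : measurable (F i `*` `]0%R, e[%classic : set Y) by exact: measurable_slab.
have -> : (\bigcup_i F i) `*` `]0%R, e[%classic = \bigcup_i (F i `*` `]0%R, e[%classic).
  apply/seteqP; split=> -[y s] /=; first by case=> -[i _ Fy] Is; exists i.
  by case=> i _ [Fy Is]; split=> //; exists i.
rewrite measure_bigcupT//; first by apply: eq_eseriesr => i _; rewrite hnu.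
by move=> i j _ _ [[y s] [[Fi _] [Fj _]]]; apply: tF => //; exists y.
Qed.

Lemma steiner_good_add (b b' : set (borelRn R d)) q q' q'' : measurable b -> measurable b' ->
  b `&` b' = set0 -> steiner_good b q -> steiner_good b' q' -> steiner_good (b `|` b') q'' ->
  q'' = q + q'.
Proof.
move=> mb mb' bb [_ h] [_ h'] [_ h'']; apply: spoly_inj => e e0; rewrite spolyD.
apply: EFin_inj; rewrite EFinD -h// -h'// -h''//.
have [nu hnu] := sweep_measure_exists; rewrite !hnu.
have -> : (b `|` b') `*` `]0%R, e[%classic = b `*` `]0%R, e[%classic `|` b' `*` `]0%R, e[%classic.
  by apply/seteqP; split=> -[y s] /=; tauto.
rewrite measureU//; [exact: measurable_slab|exact: measurable_slab|].
rewrite -subset0 => -[y s] [[/= ? _] [/= ? _]].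
by have : set0 y by rewrite -bb; split.
Qed.

(** On a piece the coefficient is additive by uniqueness of the polynomial and bounded by the volume
    at radius 1; [dominated_measure] then gives countable additivity. *)
Lemma piece_measure i j : exists nu : {measure set (borelRn R d) -> \bar R},
  forall b q, measurable b -> steiner_good (b `&` piece i) q -> nu b = (q 0 j)%:E.
Proof.
have /choice[q hq] (b : set (borelRn R d)) : exists q, measurable b -> steiner_good (b `&` piece i) q.
  by have [mb|nb] := pselect (measurable b); [have [q ?] := piece_good i mb; exists q|exists 0].
have [mu hmu] := sweep_measure_exists.
have mp := measurable_piece i.
pose nuG_ : {measure set (borelRn R d) -> \bar R} :=
  pushforward (mrestr mu (measurable_slab 1 mp)) (@fst (borelRn R d) (measurableTypeR R)).
pose nuG := nuG_ measurable_fst.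
have nuGE (b' : set (borelRn R d)) : nuG b' = leb d.+1 (sweep W om u 1 (b' `&` piece i)).
  rewrite hmu /nuG /nuG_ /= /pushforward /mrestr; congr (mu _).
  by apply/seteqP; split=> -[y s] /=; [case=> ? [? ?]|case=> -[? ?] ?].
have [|||nu hnu] := @dominated_measure _ _ _ nuG (fun b => q b 0 j).
- by rewrite nuGE; have [_ ->//] := hq setT measurableT; rewrite ltry.
- move=> A mA; have [[h _] hs] := hq A mA; split=> //.
  by rewrite nuGE hs// lee_fin; exact: spoly1_ge.
- move=> A B mA mB AB; suff -> : q (A `|` B) = q A + q B by rewrite mxE.
  have mAp : measurable (A `&` piece i) by exact: measurableI.
  have mBp : measurable (B `&` piece i) by exact: measurableI.
  apply: (steiner_good_add mAp mBp _ (hq A mA) (hq B mB)).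
    by rewrite setIACA AB set0I.
  by rewrite -setIUl; apply: hq; exact: measurableU.
exists nu => b q' mb gq'; rewrite hnu//.
by rewrite (steiner_good_unique (hq b mb) gq').
Qed.

(** Volumes over all of [W] may be infinite, so existence and uniqueness are both read off on the
    pieces, where the coefficients are finite, and then summed. *)
Lemma global_steiner : exists S : 'I_d.+1 -> {measure set (borelRn R d) -> \bar R},
  [/\ forall j, S j (~` W) = 0%E,
      forall (b : set (borelRn R d)) (e : R), measurable b -> b `<=` W -> 0 < e ->
        leb d.+1 (sweep W om u e b) = (\sum_(j < d.+1) (e ^+ j.+1)%:E * S j b)%E,
      forall b : set (borelRn R d), measurable b -> b `<=` W ->
        (d.+1%:R%:E * S ord_max b)%E = sphvol om b &
      forall S' : 'I_d.+1 -> {measure set (borelRn R d) -> \bar R},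
        (forall j, S' j (~` W) = 0%E) ->
        (forall (b : set (borelRn R d)) (e : R), measurable b -> b `<=` W -> 0 < e ->
           leb d.+1 (sweep W om u e b) = (\sum_(j < d.+1) (e ^+ j.+1)%:E * S' j b)%E) ->
        forall j b, measurable b -> S' j b = S j b].
Proof.
have /choice[nu_ hnu_] (i : nat * 'I_d.+1) := piece_measure i.1 i.2.
pose nu i j := nu_ (i, j).
have hnu i j : forall b q, measurable b -> steiner_good (b `&` piece i) q -> nu i j b = (q 0 j)%:E.
  exact: (hnu_ (i, j)).
have mp := measurable_piece.
have nu_piece j b i : measurable b -> nu i j b = nu i j (b `&` piece i).
  move=> mb; have [q gq] := piece_good i mb; rewrite (hnu i j _ _ mb gq).
  by rewrite (hnu i j _ q)//; [exact: measurableI|rewrite -setIA setIid].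
have bU (b : set (borelRn R d)) : b `<=` W -> b = \bigcup_i (b `&` piece i).
  by move=> bW; rewrite -setI_bigcupr bigcup_piece setIidl.
have tb (b : set (borelRn R d)) : trivIset setT (fun i => b `&` piece i).
  by move=> i j _ _ [x [[_ xi] [_ xj]]]; apply: trivIset_piece => //; exists x.
have mbp (b : set (borelRn R d)) i : measurable b -> measurable (b `&` piece i).
  by move=> mb; exact: measurableI.
pose S j : {measure set (borelRn R d) -> \bar R} := mseries (fun i => nu i j) 0.
have SE j b : S j b = (\sum_(i <oo) nu i j b)%E by [].
exists S; split.
- move=> j; have mW : measurable (~` W : set (borelRn R d)) by apply: measurableC; exact: open_borel.
  rewrite SE; apply: eseries0 => i _ _; rewrite nu_piece//.
  rewrite (_ : _ `&` _ = set0) ?measure0// -subset0 => x [nW px]; apply: nW.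
  by rewrite -bigcup_piece; exists i.
- move=> b e mb bW e0; rewrite {1}(bU b bW) sweep_bigcup//; last by move=> i; exact: mbp.
  transitivity (\sum_(i <oo) \sum_(j < d.+1) (e ^+ j.+1)%:E * nu i j b)%E.
    apply: eq_eseriesr => i _; have [q gq] := piece_good i mb.
    have [_ h] := gq; rewrite h// /spoly -sumEFin; apply: eq_bigr => j _.
    by rewrite (hnu i j _ _ mb gq) -EFinM mulrC.
  have e1 (j : 'I_d.+1) : 0 <= e ^+ j.+1 by rewrite exprn_ge0// ltW.
  rewrite nneseries_sum; last by move=> j i _; rewrite mule_ge0// lee_fin.
  by apply: eq_bigr => j _; rewrite SE nneseriesZl.
- move=> b mb bW; have [rho hrho] := sphvol_measure d0 oW cW hom Wy0 WM Xs.
  rewrite -hrho// {2}(bU b bW) measure_bigcupT//; last by move=> i; exact: mbp.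
  rewrite SE -nneseriesZl//; apply: eq_eseriesr => i _.
  have [q gq] := piece_good i mb; rewrite (hnu i _ _ _ mb gq) hrho//; last by move=> y [/bW].
    by have [[_ ->] _] := gq; rewrite -EFinM mulrC.
  exact: mbp.
- move=> S' S'W hS' j b mb.
  have mW : measurable (W : set (borelRn R d)) by exact: open_borel.
  have -> : S' j b = S' j (b `&` W).
    rewrite (measureDI _ mb mW) -[RHS]add0e; congr (_ + _)%E.
    apply/eqP; rewrite eq_le measure_ge0 andbT -(S'W j); apply: le_measure; rewrite ?inE.
    + exact: measurableD.
    + exact: measurableC.
    + by move=> x [].
  have bW : b `&` W `<=` W by move=> x [].
  have mbW : measurable (b `&` W : set (borelRn R d)) by exact: measurableI.
  have pE i : (b `&` W) `&` piece i = b `&` piece i.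
    by apply/seteqP; split=> x; [case=> -[]|case=> bx px; split=> //; split=> //; rewrite -bigcup_piece; exists i].
  rewrite SE (bU _ bW) measure_bigcupT//; last by move=> i; exact: mbp.
  apply: eq_eseriesr => i _; rewrite pE; have [q gq] := piece_good i mb.
  rewrite (hnu i j _ _ mb gq); have [_ h] := gq.
  apply: (ereal_spoly_unique (x := fun j => S' j (b `&` piece i))) => // e e0.
  rewrite -h// hS'//; first exact: mbp.
  by move=> x [_ px]; rewrite -bigcup_piece; exists i.
Qed.

(** Finitely many of the balls from [local_steiner] cover [k]. *)
Lemma sweep_compact (k : set 'rV[R]_d) (e : R) : compact k -> k `<=` W -> 0 < e ->
  (leb d.+1 (sweep W om u e k) < +oo)%E.
Proof.
move=> ck kW e0; have [nu hnu] := sweep_measure_exists.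
have /choice[r hr] (y : 'rV[R]_d) : exists r : R, W y -> 0 < r /\
    forall b : set (borelRn R d), measurable b -> (forall z, b z -> `|z - y| < r) ->
    exists q, steiner_good b q.
  have [Wy|nW] := pselect (W y); last by exists 0.
  by have [r r0 [_ h]] := local_steiner Wy; exists r.
pose B y : set (borelRn R d) := [set z : 'rV[R]_d | `|z - y| < r y].
have oB y : open (B y : set 'rV[R]_d).
  apply: ballP_open => x /= yr; exists (r y - `|x - y|); first by rewrite subr_gt0.
  by move=> z zy; have := ler_distD x z y; rewrite /B /=; lra.
have fB y : W y -> (leb d.+1 (sweep W om u e (B y)) < +oo)%E.
  move=> Wy; have [_ h] := hr y Wy; have [|q [_ hq]] := h (B y) _ (fun z => id).
    exact: open_borel.
  by rewrite hq// ltry.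
move: ck; rewrite compact_cover => /(_ _ k B)[y _|y ky|D Dk kD].
- exact: oB.
- by exists y => //; rewrite /B /= subrr normr0; have [] := hr y (kW _ ky).
pose s := finmap.enum_fset D.
have {}kD : sweep W om u e k `<=` \big[setU/set0]_(y <- s) sweep W om u e (B y).
  move=> X [z [t [th [kz It]]]]; have [y yD Bz] := kD _ kz.
  by rewrite -bigcup_seq; exists y => //; exists z, t.
have sk y : y \in s -> W y by move=> /Dk; rewrite inE => /kW.
apply: le_lt_trans (le_lebn kD) _ => /=.
elim: s sk {kD} => [|y s IH] sk; first by rewrite big_nil lebn0.
rewrite big_cons; apply: le_lt_trans (lebn_setU _ _) _.
apply: lte_add_pinfty; first by apply: fB; apply: sk; rewrite mem_head.
by apply: IH => z zs; apply: sk; rewrite in_cons zs orbT.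
Qed.

End GlobalSteiner.

(** * Support functions of convex sets *)

Section ConvexGeometry.
Context {R : realType} {n : nat}.
Implicit Types (F : set 'rV[R]_n) (x y p q a k : 'rV[R]_n).

Lemma closure_rvP F x : closure F x <-> forall e : R, 0 < e -> exists2 y, F y & `|y - x| < e.
Proof.
split=> [h e e0|h].
  have [|y [Fy /rv_ballP xy]] := h (ball x e); first exact: nbhsx_ballx.
  by exists y => //; rewrite distrC.
move=> U /nbhs_ballP[e /= e0 eU]; have [y Fy yx] := h e e0; exists y; split=> //.
by apply: eU; apply/rv_ballP; rewrite distrC.
Qed.

Lemma dotrv_continuous a : continuous (fun x => dotrv a x).
Proof. by move=> x; apply: (@sdiff_continuous _ _ _ a); exact: sdiff_linear. Qed.

(** The normal is [p - q] for a nearest point [q] of the closure. A point of [F] beyond the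
    hyperplane through [q] would give, on the segment towards it, a point nearer to [p]. *)
Lemma separation F p : F !=set0 -> (forall x y (t : R), 0 <= t <= 1 -> F x -> F y ->
    F (t *: x + (1 - t) *: y)) -> ~ closure F p ->
  exists2 a, a != 0 & forall k, F k -> dotrv a k <= dotrv a p.
Proof.
move=> [k0 Fk0] cF np; pose N x := dotrv (x - p) (x - p).
have Nc : continuous N.
  move=> x; have cN i : {for x, continuous (fun y : 'rV[R]_n => (y - p) 0 i)}.
    rewrite (_ : (fun y => _) = fun y => dotrv (delta_mx 0 i) y - p 0 i).
      by apply: continuousB; [exact: dotrv_continuous|exact: cst_continuous].
    by apply/funext => y; rewrite coordB dotrv_delta.
  by apply: continuous_sum_at => i; apply: continuousM; exact: cN.
have coordN x i : (x 0 i - p 0 i) ^+ 2 <= N x.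
  rewrite /N /dotrv (bigD1 i)//= coordB -expr2 lerDl; apply: sumr_ge0 => j _.
  by rewrite -expr2 sqr_ge0.
pose M := N k0 + 1; have N0 x : 0 <= N x by exact: dotrv_ge0.
have M1 : 1 <= M by rewrite /M; have := N0 k0; lra.
pose B := closure F `&` [set x | `|x| <= M + `|p|].
have cB : compact B.
  rewrite /B setIC; apply: compact_closedI; first exact: compact_cball.
  exact: closed_closure.
have small x : N x <= N k0 -> `|x| <= M + `|p|.
  move=> Nx; have := ler_normD (x - p) p; rewrite subrK => h; apply: le_trans h _.
  rewrite lerD2r; apply/rv_norm_leP => [|i]; first lra.
  rewrite coordB; have := coordN x i; have := N0 k0; rewrite ler_norml /M.
  move: (x 0 i - p 0 i) (N k0) Nx => t v; nra.
have Bk0 : B k0 by split; [exact: subset_closure|exact: small].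
have [q] := compact_EVT_min (ex_intro _ k0 Bk0) cB (continuous_subspaceT Nc).
rewrite inE => -[Fq _] qmin.
have {}qmin x : F x -> N q <= N x.
  move=> Fx; case: (leP (N x) (N k0)) => h.
    by apply: qmin; rewrite inE; split; [exact: subset_closure|exact: small].
  by apply: le_trans (ltW h); apply: qmin; rewrite inE.
exists (p - q); first by apply: contra_notN np => /eqP/subr0_eq ->.
move=> k Fk.
have main : dotrv (p - q) (k - q) <= 0.
  rewrite leNgt; apply/negP => s0; set s := dotrv _ _ in s0.
  pose D := dotrv (k - q) (k - q); have D0 : 0 <= D by exact: dotrv_ge0.
  (* Small enough for the quadratic term [t^2 D] to stay below [t s]. *)
  pose t := Num.min 1 (s / (D + 1)).
  have D1 : 0 < D + 1 by lra.
  have t0 : 0 < t by rewrite lt_min ltr01 divr_gt0.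
  have t1 : t <= 1 by rewrite ge_min lexx.
  have tD : t * D < s.
    have : t <= s / (D + 1) by rewrite ge_min lexx orbT.
    by rewrite ler_pdivlMr// mulrDr mulr1; lra.
  pose w := t *: k + (1 - t) *: q.
  have Nw : N w = N q - 2 * t * s + t ^+ 2 * D.
    have -> : N w = dotrv ((q - p) + t *: (k - q)) ((q - p) + t *: (k - q)).
      by rewrite /N; congr dotrv; rewrite /w; apply/rowP => i; rewrite !mxE; ring.
    have sq v v' : dotrv (v + t *: v') (v + t *: v') = dotrv v v + 2 * t * dotrv v v' + t ^+ 2 * dotrv v' v'.
      by rewrite dotrvDl !dotrvDr !dotrvZl !dotrvZr (dotrvC v' v); ring.
    rewrite sq.
    have -> : dotrv (q - p) (k - q) = - s by rewrite -dotrvNl opprB.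
    by rewrite /N /D; ring.
  have {}Nw : N w < N q.
    by rewrite Nw; have : t * (t * D) < t * s by [rewrite ltr_pM2l]; rewrite expr2; nra.
  have cw : closure F w.
    apply/closure_rvP => e e0; have /closure_rvP/(_ e e0)[q' Fq' qq] := Fq.
    exists (t *: k + (1 - t) *: q'); first by apply: cF => //; rewrite ltW.
    have -> : t *: k + (1 - t) *: q' - w = (1 - t) *: (q' - q).
      by rewrite /w; apply/rowP => i; rewrite !mxE; ring.
    rewrite normrZ ger0_norm; last by lra.
    apply: le_lt_trans qq; rewrite -[leRHS]mul1r; apply: ler_wpM2r => //; lra.
  have ce : 0 < N q - N w by rewrite subr_gt0.
  have [r r0 hr] := continuous_at_rv (Nc w) ce.
  have /closure_rvP/(_ r r0)[x Fx xw] := cw.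
  have := hr _ xw; have := qmin _ Fx; rewrite ltr_norml => ? /andP[]; lra.
have : dotrv (p - q) p = dotrv (p - q) q + dotrv (p - q) (p - q) by rewrite -dotrvDr [q + _]addrC subrK.
have := dotrv_ge0 (p - q); move: main; rewrite dotrvBr; lra.
Qed.

Lemma rat_dense F x : open F -> F x -> exists c : 'rV[rat]_n, F (map_mx ratr c).
Proof.
move=> oF /(open_ballP oF)[r r0 rF].
have /choice[a aP] (i : 'I_n) : exists q : rat, (x 0 i - r < ratr q < x 0 i)%R.
  by have [|q] := @rat_in_itvoo R (x 0 i - r)%R (x 0 i)%R; [lra|rewrite in_itv/=; exists q].
exists (\row_i a i); apply: rF; apply/rv_norm_ltP => // i; rewrite !mxE ltr_norml.
by have := aP i; lra.
Qed.

End ConvexGeometry.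

Section DualDomain.
Context {R : realType} {d : nat}.
Variable Om : set 'rV[R]_d.
Hypotheses (oO : open Om) (bO : bounded_set Om) (O0 : Om 0).
Notation W := (dual_domain Om).

Lemma closure_Om_bounded : exists2 B : R, 0 < B & forall x, closure Om x -> `|x| <= B.
Proof.
case: bO => B [_ hB]; have h1 : B < `|B| + 1 by have := ler_norm B; lra.
exists (`|B| + 1 + 1); first by have := normr_ge0 B; lra.
move=> x /closure_rvP/(_ 1 ltr01)[y Oy yx]; have hy : `|y| <= `|B| + 1 := hB _ h1 y Oy.
have := ler_normD (x - y) y; rewrite subrK (distrC x); lra.
Qed.

(** Compactness of the closure of [Om] turns the strict inequality into a uniform one; the margin is
    what makes the dual domain open. *)
Lemma dual_margin y : W y -> exists2 c : R, 0 < c & forall x, closure Om x -> dotrv y x <= 1 - c.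
Proof.
move=> Wy; have [B B0 hB] := closure_Om_bounded.
have cO : compact (closure Om).
  rewrite (_ : closure Om = closure Om `&` [set x | `|x| <= B]).
    rewrite setIC; apply: compact_closedI; [exact: compact_cball|exact: closed_closure].
  by apply/seteqP; split=> [x cx|x []]//; split=> //; exact: hB.
have cl0 : closure Om !=set0 by exists 0; exact: subset_closure.
have [x] := compact_EVT_max cl0 cO (continuous_subspaceT (@dotrv_continuous R d y)).
rewrite inE => cx xmax; exists (1 - dotrv y x).
  by rewrite subr_gt0 dotrvC; have := Wy _ cx; rewrite dotrvC.
by move=> z cz; have := xmax z; rewrite inE => /(_ cz); lra.
Qed.

Lemma dual_domain_open : open W.
Proof.
apply: ballP_open => y Wy; have [c c0 hc] := dual_margin Wy; have [B B0 hB] := closure_Om_bounded.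
have K0 : 0 < d%:R * B + 1 by rewrite ltr_wpDl// mulr_ge0// ltW.
exists (c / (d%:R * B + 1)); first exact: divr_gt0.
move=> z; rewrite ltr_pdivlMr// => zy x cx; rewrite dotrvC.
have : dotrv z x = dotrv y x + dotrv (z - y) x by rewrite -dotrvDl [y + _]addrC subrK.
have := hc x cx; have := le_trans (ler_norm _) (dotrv_le (z - y) x).
have : l1norm (z - y) * `|x| <= d%:R * `|z - y| * B.
  by apply: ler_pM => //; [exact: l1norm_ge0|exact: l1norm_le|exact: hB].
have : `|z - y| * (d%:R * B + 1) = d%:R * `|z - y| * B + `|z - y| by ring.
have := normr_ge0 (z - y); lra.
Qed.

Lemma dual_domain_convex : convex_set W.
Proof.
apply: convex_setPC => y z t /andP[t0 t1] Wy Wz x cx.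
have := Wy _ cx; have := Wz _ cx; rewrite dotrvDr !dotrvZr.
move: (dotrv x y) (dotrv x z) => a b b1 a1.
have [->|tn] := eqVneq t 0; first by lra.
have tp : 0 < t by rewrite lt_neqAle eq_sym tn.
have : t * a < t * 1 by rewrite ltr_pM2l.
have : (1 - t) * b <= (1 - t) * 1 by rewrite ler_wpM2l//; lra.
lra.
Qed.

Lemma dual_domain0 : W 0.
Proof. by move=> x _; rewrite dotrv0r. Qed.

Lemma dual_domain_bounded : exists M : R, forall y, W y -> `|y| <= M.
Proof.
have [r r0 rO] := open_ballP oO O0; exists (2 / r) => y Wy.
apply/rv_norm_leP => [|i]; first by rewrite divr_ge0// ltW.
have sd (s : R) : `|s| = r / 2 -> closure Om (s *: delta_mx 0 i).
  move=> sr; apply: subset_closure; apply: rO; rewrite subr0; apply/rv_norm_ltP => // j.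
  by rewrite coordZ mxE eqxx /= normrM sr; case: (j == i); rewrite ?normr1 ?normr0; lra.
have := Wy _ (sd (r / 2) _); have := Wy _ (sd (- (r / 2)) _).
rewrite !dotrvZl dotrv_delta normrN => h1 h2.
have r2 : `|r / 2| = r / 2 by rewrite ger0_norm// divr_ge0// ltW.
move: (h1 r2) (h2 r2); rewrite ler_pdivlMr// => {}h1 {}h2.
have : `|y 0 i * r| <= 2 by rewrite ler_norml; apply/andP; split; lra.
by rewrite normrM (gtr0_norm r0).
Qed.

End DualDomain.

(** * The support function in the dual chart *)

Section SupportFunction.
Context {R : realType} {d : nat}.
Variable Om : set 'rV[R]_d.
Hypotheses (oO : open Om) (bO : bounded_set Om) (O0 : Om 0).
Notation W := (dual_domain Om).
Variable Kc : set 'rV[R]_d.+1.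
Hypotheses (oK : open Kc) (K0 : Kc !=set0).
Hypothesis cK : forall x y (t : R), 0 <= t <= 1 -> Kc x -> Kc y -> Kc (t *: x + (1 - t) *: y).
Hypothesis recK : forall p x (t : R), Kc p -> 0 < t -> Om x -> Kc (p + t *: snoc x 1).
Hypothesis bndK : forall y, W y -> exists M : R, forall k, Kc k -> lform y k <= M.

Definition supfun y : R := sup [set lform y k | k in Kc].

Lemma supfun_has_sup y : W y -> has_sup [set lform y k | k in Kc].
Proof.
move=> /bndK[M hM]; split; first by case: K0 => k Kk; exists (lform y k), k.
by exists M => _ [k Kk <-]; exact: hM.
Qed.

Lemma supfun_ge y k : W y -> Kc k -> lform y k <= supfun y.
Proof. by move=> Wy Kk; apply: (ub_le_sup (supfun_has_sup Wy).2); exists k. Qed.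

Lemma supfun_le y (M : R) : W y -> (forall k, Kc k -> lform y k <= M) -> supfun y <= M.
Proof.
move=> Wy h; apply: ge_sup; first by case: K0 => k Kk; exists (lform y k), k.
by move=> _ [k Kk <-]; exact: h.
Qed.

Lemma supfun_near y (e : R) : W y -> 0 < e -> exists2 k, Kc k & supfun y - e < lform y k.
Proof.
by move=> Wy e0; have [_ [k Kk <-] h] := sup_adherent e0 (supfun_has_sup Wy); exists k.
Qed.

Lemma supfun_convex : convex_on W supfun.
Proof.
move=> x y t t01 Wx Wy; have Wz := convex_setP (@dual_domain_convex _ _ Om) t01 Wx Wy.
apply: supfun_le => // k Kk; rewrite lform_convex; case/andP: t01 => t0 t1.
apply: lerD; apply: ler_wpM2l => //; first exact: supfun_ge.
  by rewrite subr_ge0.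
exact: supfun_ge.
Qed.

Lemma supfun_lsc : lsc_on W supfun.
Proof.
move=> y e Wy e0; have e20 : 0 < e / 2 by rewrite divr_gt0.
have [k Kk hk] := supfun_near Wy e20.
have [r r0 hr] := sdiff_near (lform_sdiff k y) e20; exists r => // z Wz zy.
have := supfun_ge Wz Kk; have := hr _ zy; rewrite /= ltr_norml => /andP[]; lra.
Qed.

(** [snoc 0 1] is the axis of the cone, as 0 lies in [Om]; all forms [lform y] decrease along it at
    the same rate. *)
Lemma lform_shift (y : 'rV[R]_d) k (t : R) : lform y (k + t *: snoc 0 1) = lform y k - t.
Proof.
rewrite -[t *: _]opprK lformBr; congr (_ - _); rewrite /lform -scaleNr snocZ scaler0 mulr1.
by rewrite rinit_snoc rlast_snoc dotrv0r; ring.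
Qed.

Lemma Kc_lift k : Kc k -> exists2 t : R, 0 < t & Kc (k - t *: snoc 0 1).
Proof.
move=> Kk; have [r r0 rK] := open_ballP oK Kk; exists (r / 2); first exact: divr_gt0.
apply: rK; rewrite addrC addKr normrN normrZ ger0_norm; last by rewrite divr_ge0// ltW.
have : `|snoc 0 1 : 'rV[R]_d.+1| <= 1 by rewrite snoc_norm_le// normr0 normr1 ler01 lexx.
nra.
Qed.

(** A point [p] of the gap domain outside [Kc] is moved back along the axis to [p'] by half the gap.
    If [p'] were in the closure, recession would bring [p] into [Kc]. Otherwise a separating form
    exists, its last coefficient is negative, and after scaling it is [(y, -1)] with [y] in the
    closure of [W]; a multiple [s y] with [s] slightly below 1 contradicts the gap. *)
Lemma gap_domain_supfun : gap_domain W supfun = Kc.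
Proof.
apply/seteqP; split=> p; last first.
  move=> /Kc_lift[t t0 Kp]; exists t => // y Wy; have := supfun_ge Wy Kp.
  by rewrite -scaleNr lform_shift /gap; lra.
move=> [c c0 hc]; apply: contrapT => nKp.
pose p' := p - (c / 2) *: snoc 0 1.
have c20 : 0 < c / 2 by rewrite divr_gt0.
have ncl : ~ closure Kc p'.
  move=> /closure_rvP cl; apply: nKp.
  have [r r0 rO] := open_ballP oO O0.
  (* For [k] within [e] of [p'], the vector [p - k] has height above [c / 4] and horizontal part
     below [r c / 4], so it lies in the cone. *)
  pose e := Num.min (c / 4) (r * (c / 4)).
  have e0 : 0 < e by rewrite lt_min !mulr_gt0 ?divr_gt0.
  have [k Kk kp] := cl e e0.
  pose v := p - k; pose s := rlast v.
  have vE : v = (c / 2) *: snoc 0 1 - (k - p') by rewrite /v /p'; apply/rowP => i; rewrite !mxE; ring.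
  have sE : `|s - c / 2| < e.
    apply: le_lt_trans kp; rewrite /s vE rlastB snocZ rlast_snoc mulr1 addrAC subrr add0r normrN.
    exact: rlast_norm_le.
  have ic : `|rinit v| < e.
    apply: le_lt_trans kp; rewrite vE rinitB snocZ rinit_snoc scaler0 sub0r normrN.
    exact: rinit_norm_le.
  have ec : e <= c / 4 by rewrite ge_min lexx.
  have er : e <= r * (c / 4) by rewrite ge_min lexx orbT.
  have s0 : c / 4 < s by move: sE; rewrite ltr_norml => /andP[]; lra.
  have s00 : 0 < s by lra.
  have -> : p = k + s *: snoc (s^-1 *: rinit v) 1.
    rewrite snocZ scalerA divff ?gt_eqF// scale1r mulr1 /s snoc_rinit /v addrC subrK//.
  apply: recK => //; apply: rO; rewrite subr0 normrZ gtr0_norm ?invr_gt0//.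
  rewrite mulrC ltr_pdivrMr//; apply: lt_le_trans ic _; apply: le_trans er _.
  by rewrite ler_pM2l// ltW.
have [a a0 ha] := separation K0 cK ncl.
pose a1 := rinit a; pose a2 := rlast a.
have aE x t : dotrv a (snoc x t) = dotrv a1 x + a2 * t.
  by rewrite -{1}(snoc_rinit a) dotrv_snoc.
have reca x : Om x -> dotrv a1 x + a2 <= 0.
  move=> Ox; rewrite leNgt; apply/negP => pos; case: K0 => k Kk.
  pose D := `|dotrv a p' - dotrv a k| + 1.
  have D0 : 0 < D by rewrite /D; have := normr_ge0 (dotrv a p' - dotrv a k); lra.
  have t0 : 0 < D / (dotrv a1 x + a2) by rewrite divr_gt0.
  have := ha _ (recK Kk t0 Ox); rewrite dotrvDr dotrvZr aE mulr1 divfK ?gt_eqF//.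
  by have := ler_norm (dotrv a p' - dotrv a k); rewrite /D; lra.
(* If [a2] were 0, the form [a1] would be nonpositive on a neighbourhood of 0, hence 0. *)
have a2n : a2 < 0.
  have := reca _ O0; rewrite dotrv0r add0r le_eqVlt => /predU1P[a20|//].
  exfalso; move/negP: a0; apply; rewrite -(snoc_rinit a) -/a1 -/a2 a20.
  have [r r0 rO] := open_ballP oO O0.
  suff -> : a1 = 0 by apply/eqP/rowP => i; rewrite !mxE; case: unlift => // j; rewrite mxE.
  pose t := r / 2 / (`|a1| + 1).
  have n0 : 0 < `|a1| + 1 by have := normr_ge0 a1; lra.
  have t0 : 0 < t by rewrite !divr_gt0.
  have : Om (t *: a1).
    apply: rO; rewrite subr0 normrZ gtr0_norm// /t mulrAC ltr_pdivrMr//.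
    have := normr_ge0 a1; nra.
  move=> /reca; rewrite a20 addr0 dotrvZr pmulr_rle0// => h; apply: dotrv_self_eq0.
  by apply/eqP; rewrite eq_le h dotrv_ge0.
pose y := (- a2)^-1 *: a1; have na2 : 0 < - a2 by rewrite oppr_gt0.
have yk k : lform y k = (- a2)^-1 * dotrv a k.
  by rewrite -{2}(snoc_rinit k) aE /lform /y dotrvZl; field; rewrite lt_eqF.
have ylep k : Kc k -> lform y k <= lform y p'.
  by move=> Kk; rewrite !yk ler_pM2l ?invr_gt0//; exact: ha.
have ycl x : closure Om x -> dotrv y x <= 1.
  move=> cx; rewrite leNgt; apply/negP => h.
  have h0 : 0 < dotrv y x - 1 by rewrite subr_gt0.
  have [r r0 hr] := continuous_at_rv (@dotrv_continuous R d y x) h0.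
  have /closure_rvP/(_ r r0)[z Oz zx] := cx.
  have := hr _ zx; have : dotrv y z <= 1.
    rewrite /y dotrvZl mulrC ler_pdivrMr// mul1r; have := reca _ Oz; lra.
  rewrite ltr_norml => ? /andP[]; lra.
have Wth (s : R) : 0 <= s < 1 -> W (s *: y).
  by move=> /andP[s0 s1] x cx; rewrite dotrvC dotrvZl; have := ycl _ cx; nra.
pose U0 := supfun 0 - lform 0 p.
pose D := `|U0| + c.
have D0 : 0 < D by rewrite /D; have := normr_ge0 U0; lra.
(* So close to 1 that [(1 - s) U0 <= c / 4]; the gap at [s y] is then at most [c / 2 + c / 4]. *)
pose s := 1 - Num.min 1 (c / (4 * D)).
have m0 : 0 < Num.min 1 (c / (4 * D)) by rewrite lt_min ltr01 divr_gt0// mulr_gt0.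
have m1 : Num.min 1 (c / (4 * D)) <= 1 by rewrite ge_min lexx.
have m2 : Num.min 1 (c / (4 * D)) * (4 * D) <= c.
  by rewrite -ler_pdivlMr ?mulr_gt0// ge_min lexx orbT.
have s01 : 0 <= s < 1 by rewrite /s; lra.
have Ws := Wth _ s01; have W0 := @dual_domain0 _ _ Om.
have lfs k : lform (s *: y) k = s * lform y k + (1 - s) * lform 0 k.
  by rewrite -lform_convex scaler0 addr0.
have ub : supfun (s *: y) <= s * lform y p' + (1 - s) * supfun 0.
  apply: supfun_le => // k Kk; rewrite lfs; case/andP: s01 => s0 s1.
  apply: lerD; apply: ler_wpM2l => //; [exact: ylep|lra|exact: supfun_ge].
have a1_ : (1 - s) * U0 <= c / 4.
  have -> : 1 - s = Num.min 1 (c / (4 * D)) by rewrite /s; ring.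
  have : Num.min 1 (c / (4 * D)) * U0 <= Num.min 1 (c / (4 * D)) * D.
    by rewrite ler_pM2l// /D; have := ler_norm U0; lra.
  by move: m2; rewrite mulrCA; move: (Num.min _ _ * D) (Num.min _ _ * U0) => v v'; lra.
have a2_ : s * (c / 2) <= c / 2 by rewrite ler_piMl// ?ltW//; lra.
have := hc _ Ws; rewrite /gap lfs.
have h2 : lform y p' = lform y p + c / 2 by rewrite /p' -scaleNr lform_shift opprK.
move: ub a1_; rewrite h2 /U0; move: a2_; rewrite (mulrBr (1 - s)) (mulrDr s (lform y p)).
move: (s * (c / 2)) (s * lform y p) ((1 - s) * lform 0 p) ((1 - s) * supfun 0) (supfun (s *: y)).
move=> v1 v2 v3 v4 v5; lra.
Qed.

(** The rational points of the open set [Kc], with [k0] in place of the others. For the last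
    property a rational point is taken near [p - t (0, 1)], at which every form exceeds its value at
    [p] by [t]. *)
Lemma supfun_sequence : exists Xs : nat -> 'rV[R]_d.+1,
  [/\ forall i y, W y -> lform y (Xs i) <= supfun y,
      forall y (e : R), W y -> 0 < e -> exists i, supfun y - e < lform y (Xs i) &
      forall p, gap_domain W supfun p -> exists i, exists2 c : R, 0 < c &
        forall y, W y -> c <= lform y (Xs i) - lform y p].
Proof.
case: (K0) => k0 Kk0.
pose Xs i : 'rV[R]_d.+1 := if @unpickle 'rV[rat]_d.+1 i is Some c then
  if `[< Kc (map_mx ratr c) >] then map_mx ratr c else k0 else k0.
have XK i : Kc (Xs i) by rewrite /Xs; case: unpickle => // c; case: asboolP.
have Xd U k : open U -> U k -> Kc k -> exists i, U (Xs i).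
  move=> oU Uk Kk; have [c [Uc Kc_]] := @rat_dense R _ (U `&` Kc) k (openI oU oK) (conj Uk Kk).
  by exists (pickle c); rewrite /Xs pickleK; case: asboolP.
exists Xs; split.
- by move=> i y Wy; exact: supfun_ge.
- move=> y e Wy e0; have [k Kk hk] := supfun_near Wy e0.
  have oU : open [set X : 'rV[R]_d.+1 | supfun y - e < lform y X].
    apply: ballP_open => X /= hX; pose B := l1norm y + 1.
    have B0 : 0 < B by rewrite /B; have := l1norm_ge0 y; lra.
    exists ((lform y X - (supfun y - e)) / B); first by rewrite divr_gt0// subr_gt0.
    move=> Z; rewrite ltr_pdivlMr// mulrC => h; have := lform_le y (Z - X); rewrite lformBr -/B.
    by rewrite ler_norml => /andP[]; lra.
  exact: Xd oU hk Kk.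
- move=> p; rewrite gap_domain_supfun => /Kc_lift[t t0 Kt].
  have [M hM] := dual_domain_bounded oO O0.
  pose B := d%:R * `|M| + 1; have B0 : 0 < B by rewrite ltr_wpDl// mulr_ge0.
  have oU : open [set X : 'rV[R]_d.+1 | `|X - (p - t *: snoc 0 1)| < t / 2 / B].
    apply: ballP_open => X /= hX; exists (t / 2 / B - `|X - (p - t *: snoc 0 1)|).
      by rewrite subr_gt0.
    by move=> Z ZX; have := ler_distD X Z (p - t *: snoc 0 1); lra.
  have [|i /= hi] := Xd _ _ oU _ Kt; first by rewrite /= subrr normr0 !divr_gt0.
  exists i, (t / 2); first exact: divr_gt0.
  move=> y Wy; have := lform_le y (Xs i - (p - t *: snoc 0 1)); rewrite lformBr.
  have : (l1norm y + 1) * `|Xs i - (p - t *: snoc 0 1)| <= B * (t / 2 / B).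
    apply: ler_pM => //; [by rewrite addr_ge0// l1norm_ge0| |exact: ltW].
    rewrite lerD2r; apply: le_trans (l1norm_le _) _; apply: ler_wpM2l => //.
    by apply: le_trans (hM _ Wy) (ler_norm _).
  have -> : B * (t / 2 / B) = t / 2 by field; rewrite gt_eqF.
  rewrite -scaleNr lform_shift ler_norml => ? /andP[]; lra.
Qed.

End SupportFunction.

(** * Coordinates in the affine space *)

Lemma mulmx_bounded {R : realType} m n (A : 'M[R]_(m, n)) :
  exists2 c : R, 0 < c & forall x : 'rV[R]_m, `|x *m A| <= c * `|x|.
Proof.
pose c := \sum_i \sum_j `|A i j|.
have c0 : 0 <= c by apply: sumr_ge0 => i _; exact: sumr_ge0.
exists (c + 1); first lra.
move=> x; apply/rv_norm_leP => [|j]; first by rewrite mulr_ge0//; lra.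
rewrite mxE; apply: le_trans (ler_norm_sum _ _ _) _.
apply: le_trans (_ : c * `|x| <= _); last by rewrite ler_wpM2r//; lra.
rewrite mulr_suml; apply: ler_sum => i _; rewrite normrM mulrC; apply: ler_pM => //.
  by rewrite (bigD1 j)//= lerDl; exact: sumr_ge0.
exact: rv_coord_le.
Qed.

Section BasisCoordinates.
Context {R : realType} {V : vectType R} (n : nat) (b : n.-tuple V).
Hypothesis bP : basis_of {:V} b.

Definition comb (x : 'rV[R]_n) : V := \sum_i x 0 i *: b`_i.
Definition coords (v : V) : 'rV[R]_n := \row_i coord b i v.

Lemma combD x y : comb (x + y) = comb x + comb y.
Proof. by rewrite /comb -big_split; apply: eq_bigr => i _; rewrite mxE scalerDl. Qed.

Lemma combZ (a : R) x : comb (a *: x) = a *: comb x.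
Proof. by rewrite /comb scaler_sumr; apply: eq_bigr => i _; rewrite mxE scalerA. Qed.

Lemma comb0 : comb 0 = 0. Proof. by rewrite -(scale0r 0) combZ scale0r. Qed.

Lemma combK : cancel comb coords.
Proof. by move=> x; apply/rowP => i; rewrite mxE coord_sum_free// (basis_free bP). Qed.

Lemma coordsK : cancel coords comb.
Proof.
move=> v; rewrite [RHS](coord_basis bP (memvf v)).
by apply: eq_bigr => i _; rewrite mxE.
Qed.

Lemma comb_mulmx m (f : 'I_m -> V) (x : 'rV[R]_m) :
  comb (x *m \matrix_(i, j) coord b j (f i)) = \sum_i x 0 i *: f i.
Proof.
rewrite -[RHS]coordsK; congr comb; apply/rowP => j; rewrite !mxE linear_sum /=.
by apply: eq_bigr => i _; rewrite linearZ mxE.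
Qed.

End BasisCoordinates.

Lemma chart0E {R : realType} {V : vectType R} x : @chart0 R V x = comb (vbasis {:V}) x.
Proof. by []. Qed.

Section Transfer.
Context {R : realType} {d : nat} {V : vectType R} {A : affineSpace V}.
Variables (C : set V) (K : set A) (o : A) (e : d.+1.-tuple V) (Om : set 'rV[R]_d).
Hypothesis hK : C_convex_domain C K.
Hypothesis eb : basis_of {:V} e.
Hypotheses (oO : open Om) (bO : bounded_set Om) (O0 : Om 0).
Hypothesis hC : C = [set v | exists t x, [/\ 0 < t, Om x & v = t *: vecf e (snoc x 1)]].
Notation W := (dual_domain Om).
Notation b0 := (vbasis {:V}).

Lemma vecfE x : vecf e x = comb e x.
Proof. by apply: eq_bigr => i _; rewrite (tnth_nth 0). Qed.

Definition apt x : A := Defs.atrans o (vecf e x).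

Lemma atrans_apt x y : Defs.atrans (apt x) (vecf e y) = apt (x + y).
Proof. by rewrite /apt atransD !vecfE combD. Qed.

Lemma apt_inj : injective apt.
Proof.
move=> x y /(congr1 (avec o)); rewrite !atransK !vecfE => /(congr1 (coords e)).
by rewrite !combK.
Qed.

Lemma apt_surj p : exists x, p = apt x.
Proof. by exists (coords e (avec o p)); rewrite /apt vecfE coordsK// avecK. Qed.

Lemma avec_apt x y : avec (apt x) (apt y) = vecf e (y - x).
Proof. by rewrite -(subrKC x y) -atrans_apt atransK addrAC subrr add0r. Qed.

Lemma dual_formE y x : dual_form e y (vecf e x) = lform y x.
Proof.
rewrite /dual_form sum_lfunE.
transitivity (dotrv (snoc y (-1)) x).
  apply: eq_bigr => i _; rewrite scale_lfunE lfunE /= vecfE.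
  by have := congr1 (fun v : 'rV_d.+1 => v 0 i) (combK eb x); rewrite mxE => ->.
by rewrite -[x in LHS]snoc_rinit dotrv_snoc mulN1r.
Qed.

Definition Kcoord : set 'rV[R]_d.+1 := [set x | K (apt x)].

(** Changes of basis between [e] and the basis [vbasis] through which the topology of [V] is
    defined. *)
Let Mx : 'M[R]_(\dim {:V}, d.+1) := \matrix_(i, j) coord e j b0`_i.
Let Nx : 'M[R]_(d.+1, \dim {:V}) := \matrix_(i, j) coord b0 j e`_i.

Let MxE x : vecf e (x *m Mx) = chart0 x.
Proof. by rewrite vecfE comb_mulmx. Qed.

Let NxE x : chart0 (x *m Nx) = vecf e x.
Proof. by rewrite chart0E comb_mulmx ?vbasisP// vecfE. Qed.

Let chart0_inj : injective (@chart0 R V).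
Proof. by move=> x y; rewrite !chart0E => /(congr1 (coords b0)); rewrite !combK ?vbasisP. Qed.

Let chart00 : @chart0 R V 0 = 0. Proof. by rewrite chart0E comb0. Qed.

Let NMx (x : 'rV[R]_d.+1) : (x *m Nx) *m Mx = x.
Proof. by apply: (can_inj (combK eb)); rewrite -!vecfE MxE NxE. Qed.

Lemma Kcoord_open : open Kcoord.
Proof.
have [[_ /(_ o) oK _] _ _ _] := hK; have [c c0 hc] := mulmx_bounded Nx.
apply: ballP_open => x Kx.
have Kx' : (@chart0 R V @^-1` vec_from o K) (x *m Nx) by rewrite /preimage /= NxE.
have [r r0 hr] := open_ballP oK Kx'; exists (r / c); first exact: divr_gt0.
move=> y; rewrite ltr_pdivlMr// mulrC => yx.
have := hr (y *m Nx); rewrite -mulmxBl /preimage /= NxE; apply.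
exact: le_lt_trans (hc _) yx.
Qed.

Lemma vec_from_apt p x : vec_from (apt p) K (chart0 x) <-> Kcoord (p + x *m Mx).
Proof. by rewrite /vec_from /= -MxE atrans_apt. Qed.

Lemma vclosure_apt p : vclosure (vec_from (apt p) K) 0 <-> closure Kcoord p.
Proof.
split.
  move=> [x0 cx x00]; have {x00}x0E : x0 = 0 by apply: chart0_inj; rewrite chart00.
  subst x0; have [c c0 hc] := mulmx_bounded Mx.
  apply/closure_rvP => r r0; have /closure_rvP/(_ (r / c) (divr_gt0 r0 c0))[x Kx] := cx.
  rewrite subr0 ltr_pdivlMr// mulrC => xr; exists (p + x *m Mx); first exact/vec_from_apt.
  by rewrite addrC addKr; exact: le_lt_trans (hc _) xr.
move=> /closure_rvP cp; exists 0; last exact: chart00.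
apply/closure_rvP => r r0; have [c c0 hc] := mulmx_bounded Nx.
have [q Kq] := cp (r / c) (divr_gt0 r0 c0); rewrite ltr_pdivlMr// mulrC => qr.
exists ((q - p) *m Nx); last by rewrite subr0; exact: le_lt_trans (hc _) qr.
by apply/vec_from_apt; rewrite NMx addrC subrK.
Qed.

Lemma vinterior_apt p : vinterior (vec_from (apt p) K) 0 <-> Kcoord p.
Proof.
split.
  move=> [x0 ix x00]; have {x00}x0E : x0 = 0 by apply: chart0_inj; rewrite chart00.
  subst x0; have := nbhs_singleton ix; rewrite /preimage /= => /vec_from_apt.
  by rewrite mul0mx addr0.
move=> Kp; exists 0; last exact: chart00.
have [r r0 hr] := open_ballP Kcoord_open Kp; have [c c0 hc] := mulmx_bounded Mx.
apply/nbhs_ballP; exists (r / c); first exact: divr_gt0.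
move=> x /rv_ballP; rewrite sub0r normrN ltr_pdivlMr// mulrC => xr.
apply/vec_from_apt; apply: hr; rewrite addrC addKr; exact: le_lt_trans (hc _) xr.
Qed.

Lemma aboundary_apt p : aboundary K (apt p) <-> closure Kcoord p /\ ~ Kcoord p.
Proof.
by split=> -[h1 h2]; split; [exact/vclosure_apt|move/vinterior_apt|exact/vclosure_apt|move/vinterior_apt].
Qed.

Lemma ahyperplane_apt y q p : ahyperplane (dual_form e y) (apt q) (apt p) <-> lform y p = lform y q.
Proof.
rewrite /ahyperplane /= avec_apt dual_formE lformBr; split=> [h|->]; last by rewrite subrr.
exact: subr0_eq.
Qed.

Lemma Kcoord_neq0 : Kcoord !=set0.
Proof.
have [[[q Kq] _ _] _ _ _] := hK; have [x qE] := apt_surj q; exists x.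
by rewrite /Kcoord /= -qE.
Qed.

Lemma Kcoord_convex x y (t : R) : 0 <= t <= 1 -> Kcoord x -> Kcoord y ->
  Kcoord (t *: x + (1 - t) *: y).
Proof.
have [[_ _ /(_ o) cK] _ _ _] := hK => t01 Kx Ky.
have := convex_setP cK t01 Kx Ky; rewrite /vec_from /= /Kcoord /= /apt !vecfE.
by rewrite combD !combZ.
Qed.

Lemma Kcoord_rec p x (t : R) : Kcoord p -> 0 < t -> Om x -> Kcoord (p + t *: snoc x 1).
Proof.
have [_ KC _ _] := hK => Kp t0 Ox; rewrite /Kcoord /= -KC; exists (apt p) => //.
exists (t *: vecf e (snoc x 1)); first by rewrite hC; exists t, x.
by rewrite vecfE -combZ -vecfE atrans_apt.
Qed.

(** The dual cone is an interior in the space of linear forms. The margin of [y] leaves room for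
    perturbation: a form with coordinates close to those of [dual_form e y] differs from it by less
    than the margin at all points [(z, 1)] with [z] in [Om]. *)
Lemma dual_form_direction y : W y -> dual_directions C (dual_form e y).
Proof.
move=> Wy; split.
  apply/eqP => h; have := dual_formE y (snoc 0 1); rewrite h lfunE /= /lform rinit_snoc rlast_snoc.
  by rewrite dotrv0r sub0r => /eqP; rewrite eq_sym oppr_eq0 oner_eq0.
exists 1; first exact: oner_neq0.
rewrite scale1r; pose H := 'Hom(V, R^o); pose h0 := vbasis {:H}.
have h0P : basis_of {:H} h0 by exact: vbasisP.
exists (coords h0 (dual_form e y)); last by rewrite chart0E coordsK.
have [c c0 hc] := dual_margin bO O0 Wy; have [B B0 hB] := closure_Om_bounded bO.
(* [(B + 1) Q] bounds the values of a form at the points [(z, 1)] in terms of its coordinates. *)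
pose Q : R := \sum_(i < \dim {:H}) \sum_(j < d.+1) `|(h0`_i : H) e`_j|.
have Q0 : 0 <= Q by apply: sumr_ge0 => i _; exact: sumr_ge0.
have BQ : 0 < (B + 1) * Q + 1 by rewrite ltr_wpDl// mulr_ge0//; lra.
apply/nbhs_ballP; exists (c / ((B + 1) * Q + 1)); first exact: divr_gt0.
set x0 := coords _ _ => x /rv_ballP; rewrite distrC ltr_pdivlMr// => xr v.
rewrite hC => -[t [z [t0 Oz ->]]]; rewrite linearZ /= pmulr_rle0//.
have -> : x = x0 + (x - x0) by rewrite addrC subrK.
rewrite chart0E combD (coordsK h0P) add_lfunE dual_formE.
have l1 : lform y (snoc z 1) <= - c.
  rewrite /lform rinit_snoc rlast_snoc; have := hc z (subset_closure Oz); lra.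
suff : `|comb h0 (x - x0) (vecf e (snoc z 1))| <= `|x - x0| * ((B + 1) * Q).
  by rewrite ler_norml mulrDr mulr1 in xr *; have := normr_ge0 (x - x0); lra.
rewrite /comb sum_lfunE; apply: le_trans (ler_norm_sum _ _ _) _.
rewrite /Q mulr_sumr mulr_sumr; apply: ler_sum => i _; rewrite scale_lfunE normrM.
apply: ler_pM => //; first exact: rv_coord_le.
rewrite /vecf linear_sum /=; apply: le_trans (ler_norm_sum _ _ _) _.
rewrite mulr_sumr; apply: ler_sum => j _; rewrite linearZ (tnth_nth 0) normrM.
apply: ler_wpM2r => //; apply: le_trans (rv_coord_le _ _) _.
have B1 : 0 <= B + 1 by lra.
rewrite snoc_norm_le// normr1; apply/andP; split; last by lra.
by apply: le_trans (hB _ (subset_closure Oz)) _; lra.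
Qed.

(** A point of [K] with a larger value of the form, pushed along the axis, would stay in [K] and
    meet the hyperplane. *)
Lemma supporting_le y p : ahyperplane (dual_form e y) (apt p) `&` K = set0 ->
  forall k, Kcoord k -> lform y k < lform y p.
Proof.
move=> HK k Kk; rewrite ltNge; apply/negP; rewrite le_eqVlt => /predU1P[E|lt].
  have : set0 (apt k) by rewrite -HK; split=> //; exact/ahyperplane_apt.
  by [].
have t0 : 0 < lform y k - lform y p by rewrite subr_gt0.
have Kk' := Kcoord_rec Kk t0 O0.
have : set0 (apt (k + (lform y k - lform y p) *: snoc 0 1)).
  rewrite -HK; split=> //; apply/ahyperplane_apt; rewrite lform_shift; ring.
by [].
Qed.

Lemma Kcoord_bounded y : W y -> exists M : R, forall k, Kcoord k -> lform y k <= M.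
Proof.
move=> /dual_form_direction Dy; have [_ _ /(_ _ Dy)[_ [q [HK _]]] _] := hK.
have [p qE] := apt_surj q; rewrite qE in HK; exists (lform y p) => k Kk.
exact/ltW/(supporting_le HK).
Qed.

Notation u := (supfun Kcoord).

Lemma gap_domain_Kcoord : gap_domain W u = Kcoord.
Proof.
exact: (gap_domain_supfun oO O0 Kcoord_open Kcoord_neq0 Kcoord_convex Kcoord_rec Kcoord_bounded).
Qed.

(** Pushed along the axis, a contact point acquires positive gaps and enters [K], so it lies in the
    closure. Conversely, the forms at a boundary point are limits of values on [K], hence at most
    [u], and the supporting hyperplane gives equality at [y]. *)
Lemma contact_apt y p : W y ->
  contact W u y p <-> aboundary K (apt p) /\ exists2 q, supporting (ahyperplane (dual_form e y) q) K &
     ahyperplane (dual_form e y) q (apt p).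
Proof.
move=> Wy; split=> [[_ [E h]]|].
  have bd : aboundary K (apt p).
    apply/aboundary_apt; split; last first.
      by rewrite -gap_domain_Kcoord => -[c c0 /(_ y Wy)]; rewrite E; lra.
    apply/closure_rvP => r r0; exists (p + (r / 2) *: snoc 0 1).
      rewrite -gap_domain_Kcoord; exists (r / 2); first exact: divr_gt0.
      by move=> z Wz; have := h _ Wz; rewrite /gap lform_shift; lra.
    rewrite addrC addKr normrZ ger0_norm; last by rewrite divr_ge0// ltW.
    have : `|snoc 0 1 : 'rV[R]_d.+1| <= 1 by rewrite snoc_norm_le// normr0 normr1 ler01 lexx.
    nra.
  have Hp : ahyperplane (dual_form e y) (apt p) (apt p) by exact/ahyperplane_apt.
  split=> //; exists (apt p) => //; split; last by exists (apt p).
  rewrite -subset0 => q [Hq Kq]; have [k qE] := apt_surj q; subst q.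
  move/ahyperplane_apt: Hq => Ek; move: Kq; rewrite -[K (apt k)]/(Kcoord k) -gap_domain_Kcoord.
  by move=> [c c0 /(_ y Wy)]; move: E; rewrite /gap Ek; lra.
move=> [/aboundary_apt[/closure_rvP cp _] [q0 [HK _]]]; have [q qE] := apt_surj q0; subst q0.
move=> /ahyperplane_apt Epq.
have up : u y <= lform y p.
  apply: (supfun_le Kcoord_neq0 Wy) => k Kk; rewrite Epq; exact/ltW/(supporting_le HK).
have ge z : W z -> lform z p <= u z.
  move=> Wz; rewrite leNgt; apply/negP => lt; pose D := l1norm z + 1.
  have D0 : 0 < D by rewrite /D; have := l1norm_ge0 z; lra.
  have r0 : 0 < (lform z p - u z) / D by rewrite divr_gt0// subr_gt0.
  have [k Kk] := cp _ r0; rewrite ltr_pdivlMr// mulrC => kp.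
  have := lform_le z (k - p); rewrite lformBr -/D ler_norml => /andP[].
  by have := supfun_ge Kcoord_neq0 Kcoord_bounded Wz Kk; lra.
split=> //; split; last by move=> z Wz; rewrite /gap subr_ge0; exact: ge.
by apply/eqP; rewrite /gap subr_eq0 eq_le up; exact: ge.
Qed.

Variables (om : 'rV[R]_d -> R).
Hypothesis hom : cheng_yau W om.

Lemma frame_preimage_parallel (eps : R) (b : set 'rV[R]_d) : b `<=` W ->
  frame_preimage o e (parallel_nbhd e om K eps b) = sweep W om u eps b.
Proof.
move=> bW; have oW := dual_domain_open bO O0; have cW := @dual_domain_convex R d Om.
have cu := supfun_convex Kcoord_neq0 Kcoord_bounded.
apply/seteqP; split=> X.
  move=> [y [t [P [by_ /andP[t0 te] bP sP XE]]]]; have [p PE] := apt_surj P; subst P.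
  have Wy := bW _ by_; have /(contact_apt p Wy) cp := conj bP sP.
  have -> : X = p + t *: nsphere om y.
    apply: apt_inj; rewrite -atrans_apt [LHS]XE; congr (Defs.atrans _ _).
    by rewrite [RHS]vecfE combZ -vecfE.
  by exists y, t; split; [exact: (contact_touch oW hom t0 cp)|split=> //=; rewrite in_itv /= t0].
move=> [y [t [th [by_ /=]]]]; rewrite in_itv /= => te; have Wy := bW _ by_.
have /(contact_apt _ Wy)[bP sP] := touch_contact oW cW hom cu th.
exists y, t, (apt (X - t *: nsphere om y)); split=> //.
have -> : t *: sphere_normal e om y = vecf e (t *: nsphere om y) by rewrite [RHS]vecfE combZ -vecfE.
by rewrite atrans_apt subrK.
Qed.

End Transfer.

(** The identity is measurable from the Caratheodory to the Borel sigma-algebra and pushes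
    [lebesgueRn] forward to [leb]. *)
Lemma polar_sphere_volumeE {R : realType} {d : nat} (W : set 'rV[R]_d) (om : 'rV[R]_d -> R)
  (b : set (borelRn R d)) : open W -> cheng_yau W om -> measurable b -> b `<=` W ->
  polar_sphere_volume om b = sphvol om b.
Proof.
move=> oW hom mb bW.
pose X : measurableType _ := caratheodory_type (@leb_outer R d).
have mid : measurable_fun setT (id : X -> borelRn R d).
  by move=> _ Y mY; rewrite setTI; exact: borel_caratheodory.
have mf : measurable_fun b (fun y : borelRn R d => ((- om y) ^- d.+1)%:E).
  apply: (measurable_funS (E := W : set (borelRn R d))) => //; first exact: open_borel.
  apply/measurable_EFinP; apply: measurable_fun_on_open => // y Wy.
  have o0 : (- om y) ^+ d.+1 != 0 by rewrite expf_neq0// oppr_eq0 lt_eqF// (om_lt0 hom).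
  apply: (@continuousV _ _ (fun y => (- om y) ^+ d.+1)) => //.
  apply: (@continuous_comp _ _ _ (fun y => - om y) (fun t => t ^+ d.+1)); last exact: exprn_continuous.
  by apply: continuousN; exact: (om_continuous hom).
have f0 : {in b, forall y : borelRn R d, (0 <= ((- om y) ^- d.+1)%:E :> \bar R)%E}.
  move=> y /set_mem /bW Wy; rewrite lee_fin invr_ge0 exprn_ge0// oppr_ge0 ltW//.
  exact: (om_lt0 hom).
exact/esym/(@ge0_integral_pushforward _ _ X (borelRn R d) R id mid (@lebesgueRn R d) b _ mb mf f0).
Qed.

Theorem theorem1 (R : realType) (d : nat) (d_ge2 : (2 <= d)%N)
    (V : vectType R) (dimV : \dim {:V} = d.+1)
    (w : ('I_d.+1 -> V) -> R) (w_vol : volume_form w)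
    (A : affineSpace V)
    (C : set V) (hC : proper_open_convex_cone C)
    (K : set A) (hK : C_convex_domain C K)
    (o : A) (e : d.+1.-tuple V) (Om : set 'rV[R]_d)
    (he : adapted_basis w C e Om)
    (om : 'rV[R]_d -> R) (hom : cheng_yau (dual_domain Om) om) :
  (forall (eps : R) (b : set (borelRn R d)),
     0 < eps -> measurable b -> b `<=` dual_domain Om ->
     avol_measurable o e (parallel_nbhd e om K eps b)) /\
  exists S : 'I_d.+1 -> {measure set (borelRn R d) -> \bar R},
    [/\ forall i, radon_on (dual_domain Om) (S i),
        steiner_formula o e om Om K S,
        forall S' : 'I_d.+1 -> {measure set (borelRn R d) -> \bar R},
          (forall i, radon_on (dual_domain Om) (S' i)) ->
          steiner_formula o e om Om K S' ->
          forall i (b : set (borelRn R d)), measurable b -> S' i b = S i b &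
        forall b : set (borelRn R d),
          measurable b -> b `<=` dual_domain Om ->
          S ord0 b = polar_sphere_volume om b].
Proof.
have d0 : (0 < d)%N by exact: leq_trans d_ge2.
have [eb _ [oO _ bO O0] CE] := he.
have oW := dual_domain_open bO O0; have cW := @dual_domain_convex R d Om.
have W0 := @dual_domain0 R d Om; have [MW WM] := dual_domain_bounded oO O0.
have oK := @Kcoord_open _ _ _ _ _ _ o e hK; have K0 := Kcoord_neq0 o hK eb.
have cK := @Kcoord_convex _ _ _ _ _ _ o e hK.
have recK := @Kcoord_rec _ _ _ _ _ _ o e _ hK CE.
have bK := Kcoord_bounded o hK eb bO O0 CE.
set W := dual_domain Om in oW cW W0 WM bK hom *.
pose u := supfun (Kcoord K o e).
have cu : convex_on W u by exact: supfun_convex.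
have lu : lsc_on W u by exact: supfun_lsc.
have [Xs [Xs_le Xs_sup Xs_dense]] := supfun_sequence oO O0 oK K0 cK recK bK.
have frame eps (b : set 'rV[R]_d) : b `<=` W ->
    frame_preimage o e (parallel_nbhd e om K eps b) = sweep W om u eps b.
  by move=> bW; exact: (frame_preimage_parallel o hK eb oO bO O0 CE hom).
have avolE eps (b : set 'rV[R]_d) : b `<=` W ->
    avol o e (parallel_nbhd e om K eps b) = leb d.+1 (sweep W om u eps b).
  by move=> bW; rewrite /avol frame.
split.
  move=> eps b eps0 mb bW; rewrite /avol_measurable frame//; apply: borel_caratheodory.
  exact: (measurable_sweep oW cW hom W0 WM cu lu).
have [T [TW TE Ttop Tuniq]] := global_steiner d0 oW cW hom W0 WM cu lu Xs_le Xs_sup Xs_dense.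
have binp (i : 'I_d.+1) : 0 < 'C(d.+1, i)%:R :> R.
  by rewrite ltr0n bin_gt0 ltnW// ltn_ord.
have c0 (i : 'I_d.+1) : 0 <= d.+1%:R / 'C(d.+1, i)%:R :> R by rewrite divr_ge0.
have c'0 (i : 'I_d.+1) : 0 <= 'C(d.+1, i)%:R / d.+1%:R :> R by rewrite divr_ge0.
(* [T j] belongs to [eps^(j+1)], so [S i] uses [j = d - i], which is [rev_ord i]; the factor undoes
   [C(d+1, i) / (d+1)]. *)
pose S (i : 'I_d.+1) : {measure set (borelRn R d) -> \bar R} :=
  mscale (NngNum (c0 i)) (T (rev_ord i)).
have SE i b : S i b = ((d.+1%:R / 'C(d.+1, i)%:R)%:E * T (rev_ord i) b)%E by [].
have rev1 (i : 'I_d.+1) : (rev_ord i).+1 = (d.+1 - i)%N.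
  by rewrite /= subSS subSn// -ltnS.
exists S; split.
- move=> i; split; first by rewrite SE TW mule0.
  move=> k ck kW; have mk : measurable (k : set (borelRn R d)).
    by apply: closed_borel; apply: compact_closed => //; exact: norm_hausdorff.
  rewrite SE lte_mul_pinfty//.
  (* At radius 1 every coefficient is bounded by the volume. *)
  have := sweep_compact d0 oW cW hom W0 WM cu lu Xs_le Xs_sup Xs_dense ck kW ltr01.
  rewrite TE// (bigD1 (rev_ord i))//= expr1n mul1e; apply: le_lt_trans; rewrite leeDl//.
  by apply: sume_ge0 => j _; rewrite expr1n mul1e.
- move=> eps b eps0 mb bW; rewrite avolE// TE// ge0_sume_distrr; last first.
    by move=> i _; rewrite mule_ge0// lee_fin mulr_ge0// exprn_ge0// ltW.
  rewrite (reindex_inj rev_ord_inj); apply: eq_bigr => i _.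
  rewrite rev1 SE !muleA -!EFinM; congr (_%:E * _)%E.
  by field; rewrite !gt_eqF// ltr0n.
- move=> S' S'rad S'st i b mb.
  (* The inverse rescaling, which brings a competitor to the normal form of [global_steiner]. *)
  pose T' (j : 'I_d.+1) : {measure set (borelRn R d) -> \bar R} :=
    mscale (NngNum (c'0 (rev_ord j))) (S' (rev_ord j)).
  have T'E j b' : T' j b' = (('C(d.+1, rev_ord j)%:R / d.+1%:R)%:E * S' (rev_ord j) b')%E by [].
  rewrite SE -(Tuniq T')//.
  + rewrite T'E rev_ordK muleA -EFinM (_ : _ * _ = 1) ?mul1e//.
    by field; rewrite !gt_eqF// ltr0n.
  + by move=> j; have [h _] := S'rad (rev_ord j); rewrite T'E h mule0.
  + move=> b' eps mb' bW' eps0; rewrite -avolE// S'st// ge0_sume_distrr; last first.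
      by move=> j _; rewrite mule_ge0// lee_fin mulr_ge0// exprn_ge0// ltW.
    rewrite (reindex_inj rev_ord_inj); apply: eq_bigr => j _.
    rewrite T'E !muleA -!EFinM -rev1 rev_ordK; congr (_%:E * _)%E.
    by field; rewrite !gt_eqF// ltr0n.
(* Index 0 corresponds to the top coefficient [T ord_max], with binomial coefficient 1. *)
- move=> b mb bW; rewrite SE (polar_sphere_volumeE oW hom mb bW) -Ttop// bin0 divr1.
  by congr (_ * T _ b)%E; apply: val_inj; rewrite /= subn1.
Qed.
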